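(* Let $0<p<\infty$ and let $n\ge2$ be an integer. Then $\varrho_p$ is absolutely continuous with respect to $\mu_p$, and for $\mu_p$-almost every $x\in\Delta_p^n$, $$\frac{d\varrho_p}{d\mu_p}(x)=\frac{n\,\lambda([0,1]\cdot\Delta_p^n)}{\mathcal{H}(\Delta_p^n)}\,\bigl\|\nabla(\|\cdot\|_p)(x)\bigr\|_2=c_{p,n}^{-1}\left(\sum_{i=1}^n x_i^{2p-2}\right)^{1/2},$$ where $$c_{p,n}=\int_{\Delta_p^n}\left(\sum_{i=1}^n x_i^{2p-2}\right)^{1/2}d\mu_p(x)$$ is the normalizing constant.
   Context: Let $\mathbb{R}_+=[0,\infty)$, $\|x\|_p=(\sum_{j=1}^n|x_j|^p)^{1/p}$, and $\Delta_p^n=\{t\in\mathbb{R}_+^n:\sum_{j=1}^n t_j^p=1\}$. Let $\lambda$ be Lebesgue measure on $\mathbb{R}^n$ and $\mathcal{H}$ the $(n-1)$-dimensional Hausdorff measure in $\mathbb{R}^n$; $I\cdot A=\{tx:t\in I,x\in A\}$. The normalized cone measure and the normalized surface measure on $\Delta_p^n$ are $$\mu_p(\mathcal{A})=\frac{\lambda([0,1]\cdot\mathcal{A})}{\lambda([0,1]\cdot\Delta_p^n)},\qquad \varrho_p(\mathcal{A})=\frac{\mathcal{H}(\mathcal{A})}{\mathcal{H}(\Delta_p^n)},\qquad \mathcal{A}\subset\Delta_p^n.$$ $\nabla(\|\cdot\|_p)(x)$ denotes the gradient at $x$ of the map $y\mapsto\|y\|_p$. *)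

(* Defs.v *)
From HB Require Import structures.
From mathcomp Require Import all_boot all_order all_algebra.
From mathcomp Require Import all_classical all_reals all_analysis.
From mathcomp Require Import measurable_realfun lra.
Set Implicit Arguments.
Unset Strict Implicit.
Unset Printing Implicit Defensive.
Import Order.TTheory GRing.Theory Num.Theory.
Import numFieldNormedType.Exports.
Local Open Scope classical_set_scope.
Local Open Scope ring_scope.

(* R^n is 'rV[R]_n, with the product (i.e. Borel) sigma-algebra. *)
Section rowvec_measurable.
Context {R : realType} {n : nat}.

Definition rowvec_coord (i : 'I_n) (x : 'rV[R]_n) : R := x 0 i.

Let rowvec_set0 : g_sigma_preimage rowvec_coord set0.
Proof. exact: sigma_algebra0. Qed.

Let rowvec_setC A :
  g_sigma_preimage rowvec_coord A -> g_sigma_preimage rowvec_coord (~` A).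
Proof. exact: sigma_algebraC. Qed.

Let rowvec_bigcup (F : (set 'rV[R]_n)^nat) :
  (forall i, g_sigma_preimage rowvec_coord (F i)) ->
  g_sigma_preimage rowvec_coord (\bigcup_i F i).
Proof. exact: sigma_algebra_bigcup. Qed.

HB.instance Definition _ := @isMeasurable.Build default_measure_display
  'rV[R]_n (g_sigma_preimage rowvec_coord)
  rowvec_set0 rowvec_setC rowvec_bigcup.

End rowvec_measurable.

Section definitions.
Context {R : realType}.
Implicit Types (n m : nat) (p : R).

Definition pnorm p n (x : 'rV[R]_n) : R := (\sum_j `|x 0 j| `^ p) `^ p^-1.

Definition simplex p n : set 'rV[R]_n :=
  [set t | (forall i, 0 <= t 0 i) /\ \sum_j t 0 j `^ p = 1].

Definition dilate (I : set R) n (A : set 'rV[R]_n) : set 'rV[R]_n :=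
  [set t *: x | t in I & x in A].

Definition gradient n (f : 'rV[R]_n -> R) (x : 'rV[R]_n) : 'rV[R]_n :=
  \row_i ('d f x : 'rV[R]_n -> R) (delta_mx 0 i).

Local Open Scope ereal_scope.

(* n-dimensional Lebesgue measure, as the n-fold product of the measure on R. *)
Fixpoint lebesgue_rV n : set 'rV[R]_n -> \bar R :=
  match n with
  | 0%N => dirac (0%R : 'rV[R]_0)
  | m.+1 => pushforward (lebesgue_measure \x @lebesgue_rV m)
              (fun z : R * 'rV[R]_m => row_mx z.1%:M z.2 : 'rV[R]_m.+1)
  end.

(* Euclidean diameter; equal to -oo on the empty set. *)
Definition diam n (A : set 'rV[R]_n) : \bar R :=
  ereal_sup [set (pnorm 2 (x - y))%:E | x in A & y in A].

Definition hgauge m n (A : set 'rV[R]_n) : \bar R :=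
  if A == set0 then 0 else diam A ^+ m.

Definition hausdorff_delta m (delta : R) n (A : set 'rV[R]_n) : \bar R :=
  ereal_inf [set \sum_(k <oo) hgauge m (F k) | F in
    [set F : (set 'rV[R]_n)^nat |
       (forall k, diam (F k) <= delta%:E) /\ A `<=` \bigcup_k F k]].

Definition hausdorff_raw m n (A : set 'rV[R]_n) : \bar R :=
  ereal_sup [set hausdorff_delta m delta A |
              delta in [set delta | (0 < delta)%R]].

Definition unit_cube n : set 'rV[R]_n :=
  [set x | forall i, (0 <= x 0%R i <= 1)%R].

(* The m-dimensional Hausdorff measure on R^n, with the dimensional constant
   that makes it coincide with Lebesgue measure when n = m, so that it is the
   m-dimensional area on m-dimensional surfaces. *)
Definition hausdorff m n (A : set 'rV[R]_n) : \bar R :=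
  hausdorff_raw m A / hausdorff_raw m (@unit_cube m).

(* Both measures on the simplex are extended by 0 to all of R^n. *)
Definition cone_measure p & (0 < p)%R := fun n (A : set 'rV[R]_n) =>
  lebesgue_rV (dilate `[0%R, 1%R] (A `&` @simplex p n)) /
  lebesgue_rV (dilate `[0%R, 1%R] (@simplex p n)).

Definition surface_measure p n (A : set 'rV[R]_n) : \bar R :=
  hausdorff n.-1 (A `&` @simplex p n) / hausdorff n.-1 (@simplex p n).

(* For 2 * p < 2 this takes 0 `^ (2 * p - 2) to be 0, which only matters on the
   null set where a coordinate vanishes. *)
Definition cone_density p n (x : 'rV[R]_n) : R :=
  Num.sqrt (\sum_i x 0%R i `^ (2 * p - 2)).

Definition cone_density_cst p (p_gt0 : (0 < p)%R) n : \bar R :=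
  \int[@cone_measure p p_gt0 n]_(x in @simplex p n) (cone_density p x)%:E.

End definitions.

Arguments pnorm {R} p {n} x.
Arguments simplex {R} p n _.
Arguments unit_cube {R} n _.
Arguments cone_measure {R} [p] p_gt0 n A : rename.
Arguments surface_measure {R} p n A.
Arguments cone_density {R} p {n} x.
Arguments cone_density_cst {R} [p] p_gt0 n.

(* An alias with every subset measurable, so that mu_ext ranges over arbitrary
   covers. *)
Definition powerset_type (T : Type) := T.

Section powerset_measurable.
Variable T : pointedType.
HB.instance Definition _ := Pointed.on (powerset_type T).
HB.instance Definition _ := @isMeasurable.Build default_measure_display
  (powerset_type T) setT I (fun _ _ => I) (fun _ _ => I).
End powerset_measurable.

Section hausdorff_outer_measure.
Context {R : realType} (m n : nat).
Local Open Scope ereal_scope.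
Implicit Types A B : set 'rV[R]_n.

Lemma diam_ge0 A : A !=set0 -> 0 <= diam A.
Proof.
move=> [x Ax]; apply: le_trans (ereal_sup_ubound _); last by exists x => //; exists x.
by rewrite lee_fin powR_ge0.
Qed.

Lemma hgauge_ge0 A : 0 <= hgauge m A.
Proof.
rewrite /hgauge; case: ifPn => // /set0P A0.
by rewrite expe_ge0// diam_ge0.
Qed.

Lemma hgauge0 : hgauge m (set0 : set 'rV[R]_n) = 0.
Proof. by rewrite /hgauge eqxx. Qed.

Lemma diam0 : diam (set0 : set 'rV[R]_n) = -oo.
Proof.
rewrite /diam (_ : [set _ | _ in _ & _ in _] = set0) ?ereal_sup0//.
by rewrite -subset0 => _ [x []].
Qed.

Let g (d : R) A : \bar R := if diam A <= d%:E then hgauge m A else +oo.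

Let g0 d : g d set0 = 0.
Proof. by rewrite /g diam0 leNye hgauge0. Qed.

Let g_ge0 d A : 0 <= g d A.
Proof. by rewrite /g; case: ifPn => // _; exact: hgauge_ge0. Qed.

Let hdE d A : hausdorff_delta m d A =
  @mu_ext _ (powerset_type 'rV[R]_n) R (g d) A.
Proof.
apply/eqP; rewrite eq_le; apply/andP; split.
- apply: le_ereal_inf_tmp => _ [F [_ AF] <-].
  have [dF|] := pselect (forall k, diam (F k) <= d%:E).
    apply: ereal_inf_lbound; exists F => //.
    by apply: eq_eseriesr => k _; rewrite /g dF.
  move=> /existsNP[k /negP dk].
  rewrite (@nneseries_pinfty _ _ _ k) ?leey//.
  by rewrite /g (negbTE dk).
- apply: le_ereal_inf_tmp => _ [F [dF AF] <-].
  apply: ereal_inf_lbound; exists F => //.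
  by apply: eq_eseriesr => k _; rewrite /g dF.
Qed.

Lemma hausdorff_delta_ge0 d A : 0 <= hausdorff_delta m d A.
Proof. by rewrite hdE; exact: mu_ext_ge0. Qed.

Lemma le_hausdorff_delta d A B :
  A `<=` B -> hausdorff_delta m d A <= hausdorff_delta m d B.
Proof. by move=> AB; rewrite !hdE; exact: le_mu_ext. Qed.

Lemma hausdorff_delta_sigma_subadditive d :
  sigma_subadditive (@hausdorff_delta R m d n).
Proof.
move=> F; rewrite hdE; under eq_eseriesr do rewrite hdE.
exact: mu_ext_sigma_subadditive.
Qed.

Lemma hausdorff_delta_anti d1 d2 A : (d1 <= d2)%R ->
  hausdorff_delta m d2 A <= hausdorff_delta m d1 A.
Proof.
move=> d12; apply: ereal_inf_le_tmp => _ [F [dF AF] <-]; exists F => //.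
by split=> // k; apply: le_trans (dF k) _; rewrite lee_fin.
Qed.

Lemma hausdorff_delta_le_raw d A : (0 < d)%R ->
  hausdorff_delta m d A <= hausdorff_raw m A.
Proof. by move=> d0; apply: ereal_sup_ubound; exists d. Qed.

Let raw0 : hausdorff_raw m (set0 : set 'rV[R]_n) = 0.
Proof.
apply/eqP; rewrite eq_le; apply/andP; split.
  by apply: ge_ereal_sup => _ [d d0 <-]; rewrite hdE mu_ext0.
exact: le_trans (hausdorff_delta_ge0 1 _) (hausdorff_delta_le_raw _ ltr01).
Qed.

Let raw_ge0 A : 0 <= hausdorff_raw m A.
Proof.
exact: le_trans (hausdorff_delta_ge0 1 _) (hausdorff_delta_le_raw _ ltr01).
Qed.

Let le_raw : {homo @hausdorff_raw R m n : A B / A `<=` B >-> A <= B}.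
Proof.
move=> A B AB; apply: ge_ereal_sup => _ [d d0 <-].
exact: le_trans (le_hausdorff_delta d AB) (hausdorff_delta_le_raw _ d0).
Qed.

Let raw_sigma_subadditive : sigma_subadditive (@hausdorff_raw R m n).
Proof.
move=> F; apply: ge_ereal_sup => _ [d d0 <-].
apply: le_trans (hausdorff_delta_sigma_subadditive d F) _.
apply: lee_nneseries => [k _ _|k _]; first exact: hausdorff_delta_ge0.
exact: hausdorff_delta_le_raw.
Qed.

HB.instance Definition _ := isOuterMeasure.Build R _ (@hausdorff_raw R m n)
  raw0 raw_ge0 le_raw raw_sigma_subadditive.

End hausdorff_outer_measure.

Section hausdorff_caratheodory.
Context {R : realType} (m n : nat).
Local Open Scope ereal_scope.
Implicit Types A B E : set 'rV[R]_n.
Notation H := (@hausdorff_raw R m n).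

Lemma coord_le_pnorm2 (x : 'rV[R]_n) i : (`|x 0%R i| <= pnorm 2 x)%R.
Proof.
rewrite /pnorm.
have -> : `|x 0%R i|%R = ((`|x 0%R i| `^ 2) `^ 2^-1)%R.
  by rewrite -powRrM mulfV ?powRr1// pnatr_eq0.
apply: ge0_ler_powR.
- by rewrite invr_ge0.
- by rewrite nnegrE powR_ge0.
- by rewrite nnegrE sumr_ge0// => *; rewrite powR_ge0.
- by rewrite (bigD1 i)//= lerDl sumr_ge0// => *; rewrite powR_ge0.
Qed.

Lemma hausdorff_delta_sep (i : 'I_n) (a b d : R) A B : (0 < d < b - a)%R ->
  (forall x, A x -> (b <= x 0%R i)%R) -> (forall x, B x -> (x 0%R i <= a)%R) ->
  hausdorff_delta m d A + hausdorff_delta m d B <=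
  hausdorff_delta m d (A `|` B).
Proof.
move=> /andP[d0 dba] Ab Ba; apply: le_ereal_inf_tmp => _ [F [dF ABF] <-].
pose GA k := if `[< F k `&` A !=set0 >] then F k else set0.
pose GB k := if `[< F k `&` B !=set0 >] then F k else set0.
apply: (@le_trans _ _ (\sum_(k <oo) hgauge m (GA k) +
                       \sum_(k <oo) hgauge m (GB k))).
  apply: leeD; apply: ereal_inf_lbound.
  - exists GA => //; split => [k|x Ax].
      by rewrite /GA; case: ifPn => // _; rewrite diam0 leNye.
    have [k _ Fkx] := ABF x (or_introl Ax).
    by exists k => //; rewrite /GA; case: asboolP => // -[]; exists x.
  - exists GB => //; split => [k|x Bx].
      by rewrite /GB; case: ifPn => // _; rewrite diam0 leNye.
    have [k _ Fkx] := ABF x (or_intror Bx).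
    by exists k => //; rewrite /GB; case: asboolP => // -[]; exists x.
rewrite -nneseriesD; [|by move=> *; exact: hgauge_ge0..].
apply: lee_nneseries => k _; first by rewrite adde_ge0// hgauge_ge0.
rewrite /GA /GB; case: asboolP => [[x [Fx Ax]]|_].
  case: asboolP => [[y [Fy By]]|_]; last by rewrite hgauge0 adde0.
  suff : (b - a <= d)%R by rewrite leNgt dba.
  rewrite -lee_fin (le_trans _ (dF k))//.
  apply: (@le_trans _ _ (pnorm 2 (x - y)%R)%:E); last first.
    by apply: ereal_sup_ubound; exists x => //; exists y.
  rewrite lee_fin (le_trans _ (coord_le_pnorm2 _ i))// !mxE.
  by rewrite (le_trans _ (ler_norm _))// lerB// ?Ab// Ba.
by case: ifPn => _; rewrite hgauge0 add0e// hgauge_ge0.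
Qed.

Lemma hausdorff_sep (i : 'I_n) (a b : R) A B : (a < b)%R ->
  (forall x, A x -> (b <= x 0%R i)%R) -> (forall x, B x -> (x 0%R i <= a)%R) ->
  H A + H B <= H (A `|` B).
Proof.
move=> ab Ab Ba.
have key d1 d2 : (0 < d1)%R -> (0 < d2)%R ->
    hausdorff_delta m d1 A + hausdorff_delta m d2 B <= H (A `|` B).
  move=> d10 d20; pose d := Num.min (Num.min d1 d2) ((b - a) / 2)%R.
  have d0 : (0 < d)%R by rewrite !lt_min d10 d20/= divr_gt0// subr_gt0.
  have dba : (d < b - a)%R.
    rewrite (@le_lt_trans _ _ ((b - a) / 2)%R)//; first by rewrite ge_min lexx orbT.
    lra.
  apply: le_trans (hausdorff_delta_le_raw m _ d0).
  apply: le_trans (hausdorff_delta_sep _ Ab Ba); last by rewrite d0.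
  by rewrite leeD// hausdorff_delta_anti// !ge_min lexx ?orbT.
have [->|Hoo] := eqVneq (H (A `|` B)) +oo; first by rewrite leey.
have Hfin : H (A `|` B) \is a fin_num by rewrite ge0_fin_numE ?ltey ?outer_measure_ge0.
have B1 : H B <= H (A `|` B) by exact/le_outer_measure/subsetUr.
have HBfin : H B \is a fin_num.
  by rewrite ge0_fin_numE ?outer_measure_ge0// (le_lt_trans B1)// ltey.
rewrite -leeBrDr//; apply: ge_ereal_sup => _ [d1 d10 <-].
have hA : hausdorff_delta m d1 A \is a fin_num.
  rewrite ge0_fin_numE ?hausdorff_delta_ge0//.
  rewrite (@le_lt_trans _ _ (H (A `|` B))) ?ltey//.
  rewrite (le_trans (hausdorff_delta_le_raw m _ d10))//.
  exact/le_outer_measure/subsetUl.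
rewrite leeBrDr// addeC -leeBrDr//.
apply: ge_ereal_sup => _ [d2 d20 <-].
by rewrite leeBrDr// addeC key.
Qed.

Lemma caratheodory_halfspace (i : 'I_n) (a : R) :
  H.-caratheodory [set x | (a < x 0%R i)%R].
Proof.
apply: le_caratheodory_measurable => E.
have [HEoo|HEoo] := eqVneq (H E) +oo; first by rewrite [leRHS]HEoo leey.
have HEfin : H E < +oo by rewrite ltey.
pose P := [set x : 'rV[R]_n | (a < x 0%R i)%R]; rewrite -/P; set EN := E `&` ~` P.
pose t k : R := (a + k.+1%:R^-1)%R.
have tS k : (t k.+1 < t k)%R by rewrite ltrD2l ltf_pV2 ?posrE ?ltr_nat.
have ta k : (a < t k)%R by rewrite ltrDl invr_gt0.
have tW k l : (k <= l)%N -> (t l <= t k)%R.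
  by move=> kl; rewrite lerD2l lef_pV2 ?posrE ?ler_nat.
pose S k := E `&` [set x : 'rV[R]_n | (t k <= x 0%R i)%R].
pose D k := E `&` [set x : 'rV[R]_n | (t k.+1 <= x 0%R i < t k)%R].
have HS k : H (S k) + H EN <= H E.
  apply: (@le_trans _ _ (H (S k `|` EN))).
    apply: (hausdorff_sep (i := i) (ta k)); first by move=> x [_ /=].
    by move=> x [_ /= /negP]; rewrite -leNgt.
  by apply: le_outer_measure => x; rewrite /S /EN => -[[]|[]].
have HD (s : nat) k : \sum_(0 <= j < k) H (D (s + j.*2)%N) <= H E.
  pose U k := \bigcup_(j in `I_k) D (s + j.*2)%N.
  suff : \sum_(0 <= j < k) H (D (s + j.*2)%N) <= H (U k).
    by move/le_trans; apply; apply: le_outer_measure => x [j _ []].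
  elim: k => [|k ih]; first by rewrite big_geq// outer_measure_ge0.
  rewrite big_nat_recr//= (le_trans (leeD ih (lexx _)))//.
  apply: (@le_trans _ _ (H (U k `|` D (s + k.*2)%N))); last first.
    apply: le_outer_measure => x [[j /= jk Dx]|Dx]; last by exists k => //=.
    by exists j => //=; exact: ltn_trans jk _.
  case: k ih => [|k] ih.
    have -> : U 0%N = set0 by rewrite -subset0 => x [].
    by rewrite outer_measure0 set0U add0e.
  apply: (hausdorff_sep (i := i) (tS (s + k.*2).+1)).
    move=> x [j /= jk [_ /= /andP[+ _]]]; apply: le_trans; apply: tW.
    by rewrite ltnS leq_add2l leq_double -ltnS.
  by move=> x [_ /= /andP[_ /ltW]]; rewrite doubleS !addnS.
have Dsum : \sum_(0 <= k <oo) H (D k) < +oo.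
  apply: (@le_lt_trans _ _ (H E + H E)); last by rewrite lte_add_pinfty.
  apply: lime_le; first by apply: is_cvg_nneseries => *; exact: outer_measure_ge0.
  near=> N; apply: (@le_trans _ _ (\sum_(0 <= k < N.*2) H (D k))).
    rewrite -addnn (@big_cat_nat _ _ _ N 0 (N + N))//= ?leq_addr//.
    apply: leeDl; apply: sume_ge0 => *; exact: outer_measure_ge0.
  have -> : \sum_(0 <= k < N.*2) H (D k) =
      \sum_(0 <= j < N) H (D (0 + j.*2)%N) + \sum_(0 <= j < N) H (D (1 + j.*2)%N).
    elim: (N) => [|k ih]; first by rewrite !big_geq// adde0.
    by rewrite doubleS !big_nat_recr//= ih add0n add1n -addeA addeACA addeA.
  by apply: leeD; exact: HD.
have tail : \sum_(k <= j <oo) H (D j) @[k --> \oo] --> 0.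
  by apply: nneseries_tail_cvg => // k _; exact: outer_measure_ge0.
have SD k : H (E `&` P) <= H (S k) + \sum_(k <= j <oo) H (D j).
  apply: (@le_trans _ _ (H (S k `|` \bigcup_j D (k + j)%N))).
    apply: le_outer_measure => x [Ex /= ax].
    have [tx|xt] := leP (t k) (x 0%R i); first by left.
    right.
    have [j0 tj0] : exists j, (t (k + j)%N <= x 0%R i)%R.
      have [j aj] := ltr_add_invr ax.
      exists j; rewrite (le_trans _ (ltW aj))// lerD2l lef_pV2 ?posrE//.
      by rewrite ler_nat ltnS leq_addl.
    have [j tj jmin] := ex_minnP (ex_intro (fun j => t (k + j)%N <= x 0%R i)%R j0 tj0).
    case: j tj jmin => [|j] tj jmin.
      by move: tj; rewrite addn0 leNgt xt.
    exists j => //; split => //=; rewrite -addnS tj/= ltNge.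
    by apply/negP => /jmin; rewrite ltnn.
  apply: (le_trans (outer_measureU2 _ _ _)).
  rewrite leeD2l// (le_trans (outer_measure_sigma_subadditive H _))//.
  rewrite -(@nneseries_addn _ (fun j => H (D j)) k); last first.
    by move=> j; exact: outer_measure_ge0.
  by under eq_eseriesr do rewrite addnC.
suff : H (E `&` P) + H EN <= H E + 0 by rewrite adde0.
have def0 : H E +? 0 by rewrite fin_num_adde_defl.
have cvgH : H E + \sum_(k <= j <oo) H (D j) @[k --> \oo] --> H E + 0.
  exact: cvgeD def0 (cvg_cst _) tail.
rewrite -(cvg_lim _ cvgH)//.
apply: lime_ge; first by apply/cvg_ex; exists (H E + 0).
apply: nearW => k /=; rewrite (le_trans (leeD (SD k) (lexx _)))//.
by rewrite addeAC leeD// HS.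
Unshelve. all: by end_near. Qed.

End hausdorff_caratheodory.

Lemma hausdorff_measurable_caratheodory {R : realType} (m n : nat)
    (A : set 'rV[R]_n) :
  measurable A -> (@hausdorff_raw R m n).-caratheodory A.
Proof.
move=> mA; apply: mA; split.
  split; first exact: caratheodory_measurable_set0.
    by move=> B cB; rewrite setTD; exact: caratheodory_measurable_setC.
  exact: caratheodory_measurable_bigcup.
case: n {A} => [|k]; first by rewrite big_ord0.
rewrite -bigcup_mkord_ord => B [i _ [C mC <-]]; rewrite setTI.
have {}mC : (@measurable_realfun.RGenOInfty.G R).-sigma.-measurable C.
  by rewrite -measurable_realfun.RGenOInfty.measurableE.
pose K := [set C : set R |
  (@hausdorff_raw R m k.+1).-caratheodory (rowvec_coord (inord i) @^-1` C)].
suff GK : (@measurable_realfun.RGenOInfty.G R).-sigma.-measurable `<=` K by exact: GK.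
apply: smallest_sub; first split.
- exact: caratheodory_measurable_set0.
- by move=> D cD; rewrite setTD; exact: caratheodory_measurable_setC.
- move=> F cF; rewrite /K /= preimage_bigcup.
  exact: caratheodory_measurable_bigcup.
move=> _ [x ->]; rewrite /K /=.
rewrite (_ : _ @^-1` _ = [set y : 'rV[R]_k.+1 | (x < y 0 (inord i))%R]).
  exact: caratheodory_halfspace.
by apply/seteqP; split => y /=; rewrite in_itv/= andbT.
Qed.

Section ereal_scaling.
Local Open Scope ereal_scope.
Context {R : realType}.

Lemma inve_nonneg (x : \bar R) : 0 <= x -> 0 <= x^-1.
Proof. by case: (inveP x) => [||//|r r0]; rewrite ?leey// !lee_fin invr_ge0. Qed.

Lemma ediv_fin_num (a b : \bar R) : 0 <= a -> a <= b -> a / b \is a fin_num.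
Proof.
move=> a0 ab; case: (inveP b) ab => [ab|ab||r r0 ar].
- by (have -> : a = 0 by apply/eqP; rewrite eq_le ab); rewrite mul0e.
- by rewrite mule0.
- by rewrite leeNy_eq => /eqP ay; move: a0; rewrite ay.
- by rewrite fin_numM// ge0_fin_numE// (le_lt_trans ar)// ltry.
Qed.

Lemma semi_sigma_additive_scale d (T : measurableType d)
    (M : set T -> \bar R) (c : \bar R) : (forall A, 0 <= M A) -> 0 <= c ->
  semi_sigma_additive M -> semi_sigma_additive (fun A => M A * c).
Proof.
move=> M0 c0 MA F mF tF mUF.
have MF := MA F mF tF mUF.
have -> : (fun n => \sum_(0 <= i < n) (M (F i) * c)) =
          (fun n => (\sum_(0 <= i < n) M (F i)) * c).
  by apply/funext => k; rewrite ge0_sume_distrl.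
case: c c0 => [r|_|//].
  by rewrite lee_fin => r0; apply: cvgeZr.
have [U0|U0] := eqVneq (M (\bigcup_n F n)) 0.
  have F0 k : \sum_(0 <= i < k) M (F i) = 0.
    apply/eqP; rewrite eq_le sume_ge0// andbT.
    apply: (@le_trans _ _ (\sum_(i <oo) M (F i))).
      by apply: (@nneseries_lim_ge _ (M \o F) xpredT 0 k) => i _ _; exact: M0.
    by rewrite (cvg_lim _ MF)// U0.
  rewrite U0 mul0e; under eq_fun do rewrite F0 mul0e.
  exact: cvg_cst.
have Upos : 0 < M (\bigcup_n F n) by rewrite lt0e U0 M0.
rewrite gt0_muley//.
apply: cvg_near_cst.
have [k Fk] : exists k, 0 < M (F k).
  apply: contrapT => /forallNP F0; move: Upos.
  suff -> : M (\bigcup_n F n) = 0 by rewrite ltxx.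
  rewrite -(cvg_lim _ MF)//; apply: lim_near_cst => //; apply: nearW => n.
  rewrite big1// => i _; apply/eqP; rewrite eq_le M0 andbT leNgt.
  exact/negP/F0.
near=> n; rewrite gt0_muley// (lt_le_trans Fk)//.
rewrite (bigD1_seq k)//= ?iota_uniq ?mem_index_iota//=; last by near: n; exists k.+1.
by rewrite leeDl// sume_ge0.
Unshelve. all: by end_near. Qed.

End ereal_scaling.

Section surface.
Context {R : realType} (p : R) (n : nat).
Local Open Scope ereal_scope.

Lemma measurable_coord k (i : 'I_k) :
  measurable_fun [set: 'rV[R]_k] (fun x : 'rV[R]_k => x 0%R i).
Proof.
move=> _ Y mY; rewrite setTI; apply: sub_sigma_algebra => /=.
rewrite -bigcup_seq/=; exists i => /=; first by rewrite mem_index_enum.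
by exists Y => //; rewrite setTI.
Qed.

Lemma measurable_simplex : measurable (simplex p n : set 'rV[R]_n).
Proof.
rewrite (_ : simplex p n = (\bigcap_(i : 'I_n) (fun x : 'rV[R]_n => x 0%R i) @^-1` `[0%R, +oo[) `&`
  (fun x : 'rV[R]_n => \sum_j x 0 j `^ p)%R @^-1` [set 1%R]).
  apply: measurableI.
    apply: fin_bigcap_measurable; first exact: finite_finset.
    move=> i _; rewrite -[X in measurable X]setTI.
    by apply: measurable_coord => //.
  rewrite -[X in measurable X]setTI.
  apply: measurable_sum => // j.
  apply: (measurableT_comp (measurable_powR p)).
  exact: measurable_coord.
apply/seteqP; split => x /= [x0 xp]; split => // i.
  by move=> _ /=; rewrite in_itv/= x0.
by have := x0 i I; rewrite /= in_itv/= andbT.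
Qed.

Lemma hausdorff_ge0 m (A : set 'rV[R]_n) : 0 <= hausdorff m A.
Proof.
by rewrite mule_ge0 ?outer_measure_ge0 ?inve_nonneg ?outer_measure_ge0.
Qed.

Let H A : \bar R := @hausdorff R n.-1 n (A `&` simplex p n).

Let H_sigma_additive : semi_sigma_additive H.
Proof.
rewrite /H /hausdorff.
apply: semi_sigma_additive_scale => [A||F mF tF mUF].
- exact: outer_measure_ge0.
- by rewrite inve_nonneg// outer_measure_ge0.
rewrite setI_bigcupl.
apply: (@caratheodory_measure_sigma_additive _ _ (@hausdorff_raw R n.-1 n)
  (fun k => F k `&` simplex p n)).
- move=> k; apply: hausdorff_measurable_caratheodory.
  exact: measurableI (mF k) measurable_simplex.
- exact: trivIset_setIr.
- rewrite -setI_bigcupl; apply: hausdorff_measurable_caratheodory.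
  exact: measurableI mUF measurable_simplex.
Qed.

Lemma surface_measure0 : surface_measure p n set0 = 0 :> \bar R.
Proof. by rewrite /surface_measure /hausdorff set0I outer_measure0 !mul0e. Qed.

Lemma surface_measure_ge0 (A : set 'rV[R]_n) : 0 <= surface_measure p n A.
Proof. by rewrite mule_ge0 ?hausdorff_ge0// inve_nonneg// hausdorff_ge0. Qed.

Lemma surface_measure_semi_sigma_additive :
  semi_sigma_additive (surface_measure p n).
Proof.
apply: semi_sigma_additive_scale.
- by move=> A; exact: hausdorff_ge0.
- by apply: inve_nonneg; exact: hausdorff_ge0.
- exact: H_sigma_additive.
Qed.

HB.instance Definition _ := isMeasure.Build _ _ _ (surface_measure p n)
  surface_measure0 surface_measure_ge0 surface_measure_semi_sigma_additive.

Let surface_measure_fin : fin_num_fun (surface_measure p n).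
Proof.
move=> A mA; apply: ediv_fin_num; first exact: hausdorff_ge0.
apply: lee_wpmul2r; first by apply: inve_nonneg; exact: outer_measure_ge0.
by apply: le_outer_measure; exact: subIsetr.
Qed.

HB.instance Definition _ := @Measure_isFinite.Build _ _ _
  (surface_measure p n) surface_measure_fin.

End surface.

Section measure_sigma_finite.
Context d (T : measurableType d) (R : realType).
Variable m : {measure set T -> \bar R}.
Hypothesis sf : sigma_finite setT m.

Definition measure_sigma_finite & sigma_finite setT m : set T -> \bar R := m.

HB.instance Definition _ := Measure.on (measure_sigma_finite sf).

HB.instance Definition _ := Measure_isSigmaFinite.Build _ _ _
  (measure_sigma_finite sf) sf.

End measure_sigma_finite.

Section lebesgue.
Context {R : realType}.

Lemma measurable_fun_rowvec d (T : measurableType d) n (f : T -> 'rV[R]_n) :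
  (forall i, measurable_fun [set: T] (fun t => f t 0 i)) ->
  measurable_fun [set: T] f.
Proof.
move=> mf; apply: (@measurability _ _ _ _ _ _
  (\big[setU/set0]_(i < n) preimage_set_system setT (@rowvec_coord R n i) measurable)) => //.
case: n f mf => [|n] f mf; first by rewrite big_ord0 => _ [A []].
rewrite -bigcup_mkord_ord => _ [_ [i _ [C mC <-]] <-].
by rewrite setTI; exact: (mf (inord i) measurableT C mC).
Qed.

Let psi n (z : R * 'rV[R]_n) : 'rV[R]_n.+1 := row_mx z.1%:M z.2.
Let phi n (x : 'rV[R]_n.+1) : R * 'rV[R]_n :=
  (x 0 0, \row_j x 0 (lift ord0 j)).

Let psi0 n z : @psi n z 0 0 = z.1.
Proof.
have <- : lshift n 0 = 0 :> 'I_(1 + n) by exact/val_inj.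
by rewrite [LHS](@row_mxEl _ 1 1 n) mxE eqxx mulr1n.
Qed.

Let psiS n z j : @psi n z 0 (lift ord0 j) = z.2 0 j.
Proof.
have <- : rshift 1 j = lift ord0 j :> 'I_(1 + n) by exact/val_inj.
by rewrite [LHS](@row_mxEr _ 1 1 n).
Qed.

Let psiK n : cancel (@psi n) (@phi n).
Proof.
by case=> a v; rewrite /phi psi0; congr pair; apply/rowP => j; rewrite mxE psiS.
Qed.

Let phiK n : cancel (@phi n) (@psi n).
Proof.
move=> x; apply/rowP => i; case: (unliftP ord0 i) => [j ->|->].
  by rewrite psiS mxE.
by rewrite psi0.
Qed.

Let mpsi n : measurable_fun [set: R * 'rV[R]_n] (@psi n).
Proof.
apply: measurable_fun_rowvec => i; case: (unliftP ord0 i) => [j ->|->].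
  under eq_fun do rewrite psiS.
  exact: (measurableT_comp (measurable_coord j) measurable_snd).
by under eq_fun do rewrite psi0; exact: measurable_fst.
Qed.

Let mphi n : measurable_fun [set: 'rV[R]_n.+1] (@phi n).
Proof.
apply/measurable_fun_pairP; split; first exact: measurable_coord.
apply: measurable_fun_rowvec => j /=.
by under eq_fun do rewrite mxE; exact: measurable_coord.
Qed.

Local Open Scope ereal_scope.

Let lebesgue_rV_spec n :
  exists mu : {sigma_finite_measure set 'rV[R]_n -> \bar R},
    @lebesgue_rV R n = mu.
Proof.
elim: n => [|n [mu muE]].
  by exists (dirac (0%R : 'rV[R]_0)).
pose nu := pushforward (lebesgue_measure \x mu) (@psi n).
have nuE : @lebesgue_rV R n.+1 = nu by rewrite /= muE.
pose m : {measure set 'rV[R]_n.+1 -> \bar R} :=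
  measure_function_pushforward__canonical__measure_function_Measure
    (lebesgue_measure \x mu) (@mpsi n).
have sf : sigma_finite setT m.
  have [F FT mF] : sigma_finite setT (lebesgue_measure \x mu).
    have /sigma_finiteP[F [TF ndF Foo]] := sigma_finiteT (@lebesgue_measure R).
    have /sigma_finiteP[G [TG ndG Goo]] := sigma_finiteT mu.
    exists (fun k => F k `*` G k).
      rewrite -setXTT TF TG predeqE => -[x y]; split.
        move=> [/= [l _ Flx] [k _ Gky]]; exists (maxn l k) => //; split.
        - by move: x Flx; exact/subsetPset/ndF/leq_maxl.
        - by move: y Gky; exact/subsetPset/ndG/leq_maxr.
      by move=> [l _ []/= ? ?]; split; exists l.
    move=> k; have [? ?] := Foo k; have [? ?] := Goo k.
    split; first exact: measurableX.
    by rewrite product_measure1E// lte_mul_pinfty// ge0_fin_numE.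
  exists (fun k => @phi n @^-1` F k).
    by rewrite -preimage_bigcup -FT preimage_setT.
  move=> k; have [mFk Fkoo] := mF k; split.
    by rewrite -[X in measurable X]setTI; exact: mphi.
  rewrite /m/= /pushforward -comp_preimage.
  by rewrite (_ : @phi n \o @psi n = id)//; apply/funext; exact: psiK.
by exists (measure_sigma_finite sf); rewrite nuE.
Qed.

Let leb0 n : @lebesgue_rV R n set0 = 0.
Proof. by have [mu ->] := lebesgue_rV_spec n. Qed.

Let leb_ge0 n A : 0 <= @lebesgue_rV R n A.
Proof. by have [mu ->] := lebesgue_rV_spec n. Qed.

Let leb_sigma_additive n : semi_sigma_additive (@lebesgue_rV R n).
Proof.
by have [mu ->] := lebesgue_rV_spec n; exact: measure_semi_sigma_additive.
Qed.

HB.instance Definition _ n := isMeasure.Build _ _ _ (@lebesgue_rV R n)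
  (leb0 n) (@leb_ge0 n) (@leb_sigma_additive n).

Let leb_sigma_finite n : sigma_finite setT (@lebesgue_rV R n).
Proof. by have [mu ->] := lebesgue_rV_spec n; exact: sigma_finiteT. Qed.

HB.instance Definition _ n := Measure_isSigmaFinite.Build _ _ _
  (@lebesgue_rV R n) (@leb_sigma_finite n).

Lemma lebesgue_rV_origin n : @lebesgue_rV R n.+1 [set 0%R] = 0.
Proof.
rewrite /= /pushforward (_ : _ @^-1` _ = [set 0%R] `*` [set 0%R]).
  rewrite product_measure1E//=.
    by rewrite lebesgue_measure_set1 mul0e.
  rewrite (_ : [set 0%R] = \bigcap_(i in [set: 'I_n])
      (fun x : 'rV[R]_n => x 0%R i) @^-1` [set 0%R]).
    apply: fin_bigcap_measurable; first exact: finite_finset.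
    by move=> i _; rewrite -[X in measurable X]setTI; exact: measurable_coord.
  apply/seteqP; split => [x -> i _ /=|x x0]; first by rewrite mxE.
  by apply/rowP => i; rewrite mxE; exact: x0.
apply/seteqP; split => [[a v] /= av0|[a v] /= [-> ->]].
  have /rowP av : psi (a, v) = 0%R := av0.
  split; first by have := av 0%R; rewrite psi0 mxE.
  by apply/rowP => j; have := av (lift ord0 j); rewrite psiS !mxE.
suff : psi (0, 0)%R = 0%R :> 'rV[R]_n.+1 by [].
apply/rowP => i; rewrite [RHS]mxE; case: (unliftP ord0 i) => [j ->|->].
  by rewrite psiS /= mxE.
by rewrite psi0.
Qed.

End lebesgue.

Section cone.
Context {R : realType} (p : R) (p_gt0 : 0 < p) (n : nat).
Implicit Types A : set 'rV[R]_n.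

Let S (y : 'rV[R]_n) : R := \sum_j y 0 j `^ p.

Let proj (y : 'rV[R]_n) : 'rV[R]_n := (S y `^ (- p^-1)) *: y.

Let C A := dilate `[0, 1] (A `&` simplex p n).

Let Q A := [set y : 'rV[R]_n | 0 < S y <= 1] `&`
  (proj @^-1` (A `&` simplex p n)).

Let mS : measurable_fun [set: 'rV[R]_n] S.
Proof.
apply: measurable_sum => j.
exact: (measurableT_comp (measurable_powR p) (measurable_coord j)).
Qed.

Let mproj : measurable_fun [set: 'rV[R]_n] proj.
Proof.
apply: measurable_fun_rowvec => i.
under eq_fun do rewrite mxE.
apply: measurable_funM; last exact: measurable_coord.
exact: (measurableT_comp (measurable_powR _) mS).
Qed.

Let mQ A : measurable A -> measurable (Q A).
Proof.
move=> mA; apply: measurableI.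
  rewrite (_ : [set _ | _] = S @^-1` `]0, 1]).
    by rewrite -[X in measurable X]setTI; exact: mS.
  by apply/seteqP; split => y /=; rewrite in_itv.
rewrite -[X in measurable X]setTI; apply: mproj => //.
by apply: measurableI => //; exact: measurable_simplex.
Qed.

Let Sscale (t : R) x : 0 <= t -> simplex p n x -> S (t *: x) = t `^ p.
Proof.
move=> t0 [x0 x1]; rewrite /S -[RHS]mulr1 -x1 mulr_sumr.
by apply: eq_bigr => i _; rewrite mxE powRM.
Qed.

Let powRVp (t : R) : 0 <= t -> (t `^ p) `^ (- p^-1) = t^-1.
Proof.
by move=> t0; rewrite -powRrM mulrN mulfV ?gt_eqF// powR_inv1.
Qed.

Let QC A : Q A `<=` C A.
Proof.
move=> y [/= /andP[S0 S1] [Ay Dy]].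
exists (S y `^ p^-1); last first.
  exists (proj y) => //; rewrite scalerA -powRD; last by apply/implyP => _; rewrite gt_eqF.
  by rewrite subrr powRr0 scale1r.
rewrite /= in_itv/= powR_ge0/=.
have -> : 1 = 1 `^ p^-1 :> R by rewrite powR1.
by rewrite ge0_ler_powR// ?nnegrE ?invr_ge0 ?ltW.
Qed.

Let CQ A : C A `<=` Q A `|` [set 0].
Proof.
move=> y [t /= t01 [x [Ax Dx] <-]].
move: t01; rewrite in_itv/= => /andP[].
rewrite le_eqVlt => /predU1P[<- _|t0 t1]; first by right; rewrite scale0r.
left; rewrite /Q /proj /= (Sscale (ltW t0) Dx) powR_gt0//=; split.
  have -> : 1 = 1 `^ p :> R by rewrite powR1.
  by rewrite ge0_ler_powR// ?nnegrE ?ltW.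
by rewrite powRVp ?ltW// scalerA mulVf ?gt_eqF// scale1r.
Qed.

Let simplex_dim0 : n = 0%N -> simplex p n = set0.
Proof.
move=> n0; rewrite -subset0 => x [_ /eqP].
rewrite big1 ?(eq_sym 0) ?oner_eq0// => -[i i0] _.
by exfalso; move: i0; rewrite n0.
Qed.

Let origin_measurable : measurable [set 0 : 'rV[R]_n].
Proof.
rewrite (_ : [set 0] = \bigcap_(i in [set: 'I_n])
    (fun x : 'rV[R]_n => x 0%R i) @^-1` [set 0%R]).
  apply: fin_bigcap_measurable; first exact: finite_finset.
  by move=> i _; rewrite -[X in measurable X]setTI; exact: measurable_coord.
apply/seteqP; split => [x -> i _ /=|x x0]; first by rewrite mxE.
by apply/rowP => i; rewrite mxE; exact: x0.
Qed.

Let mC A : measurable A -> measurable (C A).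
Proof.
move=> mA; have [C0|C0] := pselect (C A 0).
  rewrite (_ : C A = Q A `|` [set 0]).
    by apply: measurableU => //; exact: mQ.
  by apply/seteqP; split => //; rewrite subUset; split => // x ->.
rewrite (_ : C A = Q A); first exact: mQ.
apply/seteqP; split => // y Cy; have [//|y0] := CQ Cy.
by exfalso; apply: C0; rewrite -y0.
Qed.

Local Open Scope ereal_scope.

Let lamC A : measurable A -> lebesgue_rV (C A) = lebesgue_rV (Q A).
Proof.
move=> mA; have [n0|n0] := eqVneq n 0%N.
  congr lebesgue_rV; apply/seteqP; split => [y [t _ [x [_]]]|y [_ [_]]].
    by rewrite (simplex_dim0 n0).
  by rewrite (simplex_dim0 n0).
have lam0 : lebesgue_rV [set 0%R : 'rV[R]_n] = 0.
  by case: n n0 => // k _; exact: lebesgue_rV_origin.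
apply/eqP; rewrite eq_le; apply/andP; split.
  apply: (@le_trans _ _ (lebesgue_rV (Q A `|` [set 0%R]))).
    apply: le_measure; rewrite ?inE//; first exact: mC.
    by apply: measurableU => //; exact: mQ.
  apply: (le_trans (measureU2 _ (mQ mA) origin_measurable)).
  by rewrite -[X in _ + X]/(lebesgue_rV [set 0%R]) lam0 adde0.
by apply: le_measure; rewrite ?inE//; [exact: mQ|exact: mC].
Qed.

Let lamC_sigma_additive : semi_sigma_additive (fun A => lebesgue_rV (C A)).
Proof.
move=> F mF tF mUF; rewrite lamC//.
under eq_fun do under eq_bigr do rewrite lamC//.
have -> : Q (\bigcup_k F k) = \bigcup_k Q (F k).
  by rewrite /Q setI_bigcupl preimage_bigcup setI_bigcupr.
apply: measure_semi_sigma_additive.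
- by move=> k; exact: mQ.
- move=> i j _ _ [y [[_ [Fi _]] [_ [Fj _]]]].
  by apply: tF => //; exists (proj y).
- by apply: bigcupT_measurable => k; exact: mQ.
Qed.

Let cone_measure0 : cone_measure p_gt0 n set0 = 0.
Proof.
rewrite /cone_measure set0I (_ : dilate _ set0 = set0) ?measure0 ?mul0e//.
by rewrite -subset0 => y [t _ [x []]].
Qed.

Let cone_measure_ge0 A : 0 <= cone_measure p_gt0 n A.
Proof. by rewrite mule_ge0// inve_nonneg. Qed.

Let cone_measure_semi_sigma_additive :
  semi_sigma_additive (cone_measure p_gt0 n).
Proof.
by apply: semi_sigma_additive_scale; [|exact: inve_nonneg|exact: lamC_sigma_additive].
Qed.

HB.instance Definition _ := isMeasure.Build _ _ _ (cone_measure p_gt0 n)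
  cone_measure0 cone_measure_ge0 cone_measure_semi_sigma_additive.

Let cone_measure_fin : fin_num_fun (cone_measure p_gt0 n).
Proof.
move=> A mA; apply: ediv_fin_num => //.
rewrite -[in leRHS](setTI (simplex p n)).
apply: le_measure; rewrite ?inE; [exact: mC|exact: mC|].
by move=> y [t t01 [x [Ax Dx] <-]]; exists t => //; exists x.
Qed.

HB.instance Definition _ := @Measure_isFinite.Build _ _ _
  (cone_measure p_gt0 n) cone_measure_fin.

End cone.

(* Main.v *)
(* Near an interior point [x0] of the simplex, let [w = (x0_i ^ (p - 1))_i], the
   gradient of the p-norm at [x0]. Since [sum_i x_i ^ p] is constant on the simplex,
   the radial projection [x |-> x / <x, w>] onto the tangent hyperplane [<x, w> = 1]
   is [L]-bi-Lipschitz with [L] as close to 1 as desired: it changes the Hausdorff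
   measure of a small Borel piece [A] by a factor at most [L ^ (n - 1)], and the
   volume of the cone over [A] by a factor at most [L ^ n]. In the hyperplane,
   Hausdorff measure is [n * |w|] times the volume of the cone: a reflection, which
   preserves both measures, makes the hyperplane horizontal, and Tonelli applies.
   Summing over countably many small pieces and letting [L] tend to 1 gives
   [H(A) = n * lambda(K) * int_A |grad| d mu_p] for [A] in the interior of the simplex,
   [K] being the cone over the simplex. The boundary is null for both measures, and
   [H] is finite on the simplex because the differences [x_i - x_0] parametrize it
   with a Lipschitz inverse.
   By Tonelli, translation-invariant measures are proportional, which gives the
   scaling and the isometry invariance of Lebesgue measure, and its proportionality
   to the top-dimensional Hausdorff measure. *)
Require Import Defs.
From HB Require Import structures.
From mathcomp Require Import all_boot all_order all_algebra.
From mathcomp Require Import all_classical all_reals all_analysis.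
From mathcomp Require Import measurable_realfun ring lra.
Import Order.TTheory GRing.Theory Num.Theory.
Import numFieldNormedType.Exports.
Set Implicit Arguments.
Unset Strict Implicit.
Unset Printing Implicit Defensive.
Local Open Scope classical_set_scope.
Local Open Scope ring_scope.

(** * The Euclidean norm *)

Section euclidean_norm.
Context {R : realType}.
Implicit Types (n : nat).

(** Hausdorff measure is controlled here only through Lipschitz maps, which lose a factor; so no
    change of variables is performed, and equality appears only in the limit [L -> 1]. No radius of
    comparison is claimed uniformly: for [p < 1] the powers [x_i ^ (p - 1)] blow up at the boundary,
    so the radius depends on the point and countably many pieces are used. The losses do not
    accumulate, because every piece carries the same factor. For [p < 1] the density is unbounded
    and the finiteness of [c_{p,n}] is not read off the integrand. Applied to the whole simplex, the
    formula says [H(simplex) = n * lambda(K) * c_{p,n}], so it follows from the finiteness of [H].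
    The same identity turns the constant in front of the gradient into the inverse of [c_{p,n}]. The
    raw Hausdorff measure of the unit cube is never computed: being finite and positive, it
    cancels. *)

Lemma pnorm2E n (x : 'rV[R]_n) : pnorm 2 x = Num.sqrt (\sum_i x 0 i ^+ 2).
Proof.
rewrite /pnorm powR12_sqrt ?sumr_ge0//.
by congr Num.sqrt; apply: eq_bigr => i _; rewrite powR_mulrn// real_normK ?num_real.
Qed.

Local Opaque pnorm.

Lemma pnorm2_ge0 n (x : 'rV[R]_n) : 0 <= pnorm 2 x.
Proof. exact: powR_ge0. Qed.

Lemma sqr_pnorm2 n (x : 'rV[R]_n) : pnorm 2 x ^+ 2 = \sum_i x 0 i ^+ 2.
Proof. by rewrite pnorm2E sqr_sqrtr// sumr_ge0// => i _; rewrite sqr_ge0. Qed.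

Lemma pnorm2Z n (a : R) (x : 'rV[R]_n) : pnorm 2 (a *: x) = `|a| * pnorm 2 x.
Proof.
rewrite !pnorm2E -sqrtr_sqr -sqrtrM ?sqr_ge0// mulr_sumr.
by congr Num.sqrt; apply: eq_bigr => i _; rewrite mxE exprMn.
Qed.

Lemma pnorm2N n (x : 'rV[R]_n) : pnorm 2 (- x) = pnorm 2 x.
Proof. by rewrite -scaleN1r pnorm2Z normrN1 mul1r. Qed.

Lemma Cauchy_Schwarz_sum n (x y : 'rV[R]_n) :
  \sum_i x 0 i * y 0 i <= pnorm 2 x * pnorm 2 y.
Proof.
have := sqr_pnorm2 x; have := sqr_pnorm2 y.
have := coord_le_pnorm2 x; have := coord_le_pnorm2 y.
have := pnorm2_ge0 x; have := pnorm2_ge0 y.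
move: (pnorm 2 x) (pnorm 2 y) => a b b0 a0 yb xa sy sx.
(* With [a = |x|] and [b = |y|], expanding this sum gives [2ab (ab - <x, y>) >= 0]. The division by
   [ab] is why the zero cases are treated apart. *)
have : 0 <= \sum_i (b * x 0 i - a * y 0 i) ^+ 2.
  by rewrite sumr_ge0// => i _; rewrite sqr_ge0.
have -> : \sum_i (b * x 0 i - a * y 0 i) ^+ 2 =
    b ^+ 2 * (\sum_i x 0 i ^+ 2) + a ^+ 2 * (\sum_i y 0 i ^+ 2)
    - 2 * a * b * (\sum_i x 0 i * y 0 i).
  by rewrite !mulr_sumr -big_split/= -sumrB; apply: eq_bigr => i _; ring.
rewrite -sx -sy => h.
have [a_eq0|a_neq0] := eqVneq a 0.
  rewrite big1 ?a_eq0 ?mul0r// => i _.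
  have : `|x 0 i| <= 0 by rewrite -a_eq0.
  by rewrite normr_le0 => /eqP ->; rewrite mul0r.
have [b_eq0|b_neq0] := eqVneq b 0.
  rewrite big1 ?b_eq0 ?mulr0// => i _.
  have : `|y 0 i| <= 0 by rewrite -b_eq0.
  by rewrite normr_le0 => /eqP ->; rewrite mulr0.
have ab0 : 0 < a * b by rewrite mulr_gt0// lt0r ?a_neq0 ?b_neq0.
rewrite -(ler_pM2l ab0) -subr_ge0 -(@pmulr_rge0 _ 2)//.
by apply: le_trans h _; rewrite le_eqVlt; apply/orP; left; apply/eqP; ring.
Qed.

Lemma ler_pnorm2D n (x y : 'rV[R]_n) : pnorm 2 (x + y) <= pnorm 2 x + pnorm 2 y.
Proof.
rewrite -(@ler_pXn2r _ 2)// ?nnegrE ?addr_ge0 ?pnorm2_ge0//.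
have := sqr_pnorm2 x; have := sqr_pnorm2 y; have := sqr_pnorm2 (x + y).
have := Cauchy_Schwarz_sum x y.
move: (pnorm 2 x) (pnorm 2 y) (pnorm 2 (x + y)) => a b c cs -> yE xE.
rewrite sqrrD yE xE.
have -> : \sum_i (x + y) 0 i ^+ 2 =
    \sum_i x 0 i ^+ 2 + (\sum_i x 0 i * y 0 i) *+ 2 + \sum_i y 0 i ^+ 2.
  rewrite -sumrMnl -!big_split/=; apply: eq_bigr => i _.
  by rewrite mxE sqrrD.
by rewrite lerD2r lerD2l lerMn2r/=.
Qed.

Lemma pnorm2_le_sum n (x : 'rV[R]_n) : pnorm 2 x <= \sum_i `|x 0 i|.
Proof.
have s0 : 0 <= \sum_i `|x 0 i| by rewrite sumr_ge0.
rewrite -(@ler_pXn2r _ 2)// ?nnegrE ?pnorm2_ge0// (sqr_pnorm2 x) expr2 mulr_suml.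
apply: ler_sum => i _; rewrite -real_normK ?num_real// expr2 ler_wpM2l//.
by rewrite (bigD1 i)//= lerDl sumr_ge0.
Qed.

(** The factor [n] is crude ([sqrt n] would do), but it only enters bounds whose exact size does not
    matter: finiteness, or errors made arbitrarily small. *)
Lemma pnorm2_le_bound n (x : 'rV[R]_n) (c : R) :
  (forall i, `|x 0 i| <= c) -> pnorm 2 x <= n%:R * c.
Proof.
move=> xc; rewrite (le_trans (pnorm2_le_sum x))//.
rewrite (le_trans (ler_sum _ (fun i _ => xc i)))//.
by rewrite sumr_const card_ord mulr_natl.
Qed.

Lemma pnorm2_le_diam n (A : set 'rV[R]_n) x y : A x -> A y ->
  ((pnorm 2 (x - y))%:E <= diam A)%E.
Proof. by move=> Ax Ay; apply: ereal_sup_ubound; exists x => //; exists y. Qed.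

End euclidean_norm.

(** * Lebesgue measure on row vectors *)

Section translation_invariant.
Context {R : realType}.
Local Open Scope ereal_scope.

Lemma measurable_rowvecD n :
  measurable_fun [set: 'rV[R]_n * 'rV[R]_n] (fun z => (z.1 + z.2)%R).
Proof.
apply: measurable_fun_rowvec => i; under eq_fun do rewrite mxE.
by apply: measurable_funD; exact: (measurableT_comp (measurable_coord i)).
Qed.

Lemma measurable_rowvecB n :
  measurable_fun [set: 'rV[R]_n * 'rV[R]_n] (fun z => (z.2 - z.1)%R).
Proof.
apply: measurable_fun_rowvec => i; under eq_fun do rewrite !mxE.
by apply: measurable_funB; exact: (measurableT_comp (measurable_coord i)).
Qed.

Lemma measurable_rowvec_translate n (v : 'rV[R]_n) :
  measurable_fun [set: 'rV[R]_n] (fun x => (x + v)%R).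
Proof.
apply: measurable_fun_rowvec => i; under eq_fun do rewrite !mxE.
by apply: measurable_funD => //; exact: measurable_coord.
Qed.

Lemma product_measureE2 d1 d2 (T1 : measurableType d1) (T2 : measurableType d2)
    (m1 : {sigma_finite_measure set T1 -> \bar R})
    (m2 : {sigma_finite_measure set T2 -> \bar R}) (E : set (T1 * T2)) :
  measurable E -> (m1 \x m2) E = \int[m2]_y m1 (ysection E y).
Proof.
move=> mE; rewrite (@product_measure_unique _ _ _ _ _ m1 m2 (m1 \x^ m2))//.
by move=> A B mA mB; exact: product_measure2E.
Qed.

Definition translation_invariant n (mu : set 'rV[R]_n -> \bar R) :=
  forall (v : 'rV[R]_n) (A : set 'rV[R]_n), measurable A -> mu [set x | A (x + v)%R] = mu A.

(* Tonelli applied to the sets [{(x, y) | x + y \in A, y \in B}] and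
   [{(x, z) | z \in A, z - x \in B}], which have the same [x]-sections up to
   translation. *)
Lemma translation_invariant_proportional n
    (mu la : {sigma_finite_measure set 'rV[R]_n -> \bar R}) (A B : set 'rV[R]_n) :
  translation_invariant mu -> translation_invariant la ->
  measurable A -> measurable B -> (forall x, B (- x)%R = B x) ->
  mu A * la B = la A * mu B.
Proof.
move=> mut lat mA mB symB.
pose E := [set z : 'rV[R]_n * 'rV[R]_n | A (z.1 + z.2)%R /\ B z.2].
pose E' := [set z : 'rV[R]_n * 'rV[R]_n | A z.2 /\ B (z.2 - z.1)%R].
have mE : measurable E.
  apply: measurableI.
    by rewrite -[X in measurable X]setTI; exact: measurable_rowvecD.
  by rewrite -[X in measurable X]setTI; exact: measurable_snd.
have mE' : measurable E'.
  apply: measurableI.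
    by rewrite -[X in measurable X]setTI; exact: measurable_snd.
  by rewrite -[X in measurable X]setTI; exact: measurable_rowvecB.
have const (nu : {sigma_finite_measure set 'rV[R]_n -> \bar R}) c C :
    measurable C -> 0 <= c -> \int[nu]_y (c * (\1_C y)%:E) = c * nu C.
  move=> mC c0; rewrite ge0_integralZl//.
    by rewrite integral_indic// setIT.
  exact: measurableT_comp.
transitivity ((mu \x la) E).
  rewrite product_measureE2// -const//; apply: eq_integral => y _.
  rewrite indicE; case: (boolP (y \in B)) => yB.
    rewrite mule1 -(mut y A mA); congr (mu _); apply/seteqP; split => x.
      by move=> Ax; rewrite /ysection/= inE; split => //; exact/set_mem.
    by rewrite /ysection/= inE => -[].
  rewrite mule0 (_ : ysection E y = set0) ?measure0//.
  rewrite -subset0 => x; rewrite /ysection/= inE => -[_].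
  by move/mem_set; rewrite (negbTE yB).
transitivity ((mu \x la) E').
  rewrite /product_measure1/=; apply: eq_integral => x _.
  rewrite /= -[RHS](lat x); last exact: measurable_xsection.
  congr (la _); apply/seteqP; split => y; rewrite /xsection/= !inE /E/E'/=.
    by rewrite addrK (addrC x).
  by rewrite addrK (addrC x).
rewrite product_measureE2// muleC -const//; apply: eq_integral => y _.
rewrite indicE; case: (boolP (y \in A)) => yA.
  (* The section over [y] is [{x | y - x \in B}], a translate of [-B]: this is where the symmetry of
     [B] enters. *)
  rewrite mule1 -(mut (- y)%R B mB); congr (mu _); apply/seteqP; split => x.
    rewrite /ysection/= inE => -[_] /=.
    by rewrite -symB opprB.
  move=> /= Bx; rewrite /ysection/= inE; split => /=; first exact/set_mem.
  by rewrite -symB opprB.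
rewrite mule0 (_ : ysection E' y = set0) ?measure0//.
rewrite -subset0 => x; rewrite /ysection/= inE => -[+ _].
by move/mem_set; rewrite (negbTE yA).
Qed.

End translation_invariant.

Section row_cons.
Context {R : realType} {n : nat}.

(** The map along which [lebesgue_rV] is pushed forward, under a name of its own; [lebesgue_rVSE]
    then holds by conversion. *)
Definition row_cons (z : R * 'rV[R]_n) : 'rV[R]_n.+1 := row_mx z.1%:M z.2.

Lemma row_cons0 (z : R * 'rV[R]_n) : row_cons z 0 0 = z.1.
Proof.
have <- : lshift n 0 = 0 :> 'I_(1 + n) by exact/val_inj.
by rewrite [LHS](@row_mxEl _ 1 1 n) mxE eqxx mulr1n.
Qed.

Lemma row_consS (z : R * 'rV[R]_n) j : row_cons z 0 (lift ord0 j) = z.2 0 j.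
Proof.
have <- : rshift 1 j = lift ord0 j :> 'I_(1 + n) by exact/val_inj.
by rewrite [LHS](@row_mxEr _ 1 1 n).
Qed.

Lemma row_consP (x : 'rV[R]_n.+1) (z : R * 'rV[R]_n) :
  x 0 0 = z.1 -> (forall j, x 0 (lift ord0 j) = z.2 0 j) -> x = row_cons z.
Proof.
move=> x0 xS; apply/rowP => i; case: (unliftP ord0 i) => [j ->|->].
  by rewrite row_consS xS.
by rewrite row_cons0 x0.
Qed.

Lemma forall_row_cons (P : 'I_n.+1 -> Prop) :
  (forall i, P i) <-> P 0 /\ forall j, P (lift ord0 j).
Proof.
split=> [H|[P0 PS] i]; first by split.
by case: (unliftP ord0 i) => [j ->|->].
Qed.

Lemma measurable_row_cons : measurable_fun [set: R * 'rV[R]_n] row_cons.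
Proof.
apply: measurable_fun_rowvec => i; case: (unliftP ord0 i) => [j ->|->].
  under eq_fun do rewrite row_consS.
  exact: (measurableT_comp (measurable_coord j) measurable_snd).
by under eq_fun do rewrite row_cons0; exact: measurable_fst.
Qed.

Lemma lebesgue_rVSE (A : set 'rV[R]_n.+1) :
  lebesgue_rV A = (lebesgue_measure \x @lebesgue_rV R n)%E (row_cons @^-1` A).
Proof. by []. Qed.

End row_cons.

(** * Cubes and translation invariance of Lebesgue measure *)

Section cube.
Context {R : realType}.

(** A closed ball of the maximum norm. With centre [0] it is a symmetric test set; with [r = 0] it
    is a single point and stands for the apex of a cone. *)
Definition cube n (c : 'rV[R]_n) (r : R) : set 'rV[R]_n :=
  [set x | forall i, `|x 0 i - c 0 i| <= r].

Lemma measurable_cube n (c : 'rV[R]_n) r : measurable (cube c r).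
Proof.
rewrite (_ : cube c r = \bigcap_(i in [set: 'I_n])
    (fun x : 'rV[R]_n => x 0%R i) @^-1` `[c 0 i - r, c 0 i + r]).
  apply: fin_bigcap_measurable; first exact: finite_finset.
  by move=> i _; rewrite -[X in measurable X]setTI; exact: measurable_coord.
apply/seteqP; split=> [x xc i _|x xc i].
  by rewrite /= in_itv/= -ler_distl; exact: xc.
by have := xc i I; rewrite /= in_itv/= -ler_distl.
Qed.

Lemma unit_cubeE n : unit_cube n = cube (const_mx 2^-1) 2^-1 :> set 'rV[R]_n.
Proof.
have h : 2^-1 + 2^-1 = 1 :> R by lra.
by apply/seteqP; split=> x xi i; have := xi i; rewrite !mxE ler_distl subrr h.
Qed.

Local Open Scope ereal_scope.

Lemma lebesgue_rV_cube n (c : 'rV[R]_n) r : (0 <= r)%R ->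
  lebesgue_rV (cube c r) = ((r *+ 2) ^+ n)%:E.
Proof.
move=> r0; elim: n c => [|n ih] c.
  rewrite /= diracE (_ : _ \in _) ?expr0//.
  by rewrite inE => -[].
pose c' : 'rV[R]_n := (\row_j c 0 (lift ord0 j))%R.
rewrite lebesgue_rVSE (_ : row_cons @^-1` cube c r =
    `[(c 0 0 - r)%R, (c 0 0 + r)%R] `*` cube c' r).
  rewrite product_measure1E//; last exact: measurable_cube.
  rewrite [X in _ * X]ih /= lebesgue_measure_itv/= lte_fin.
  case: ltP => [_|r2].
    by rewrite -EFinD -EFinM exprS; congr (_ * _)%:E; lra.
  have -> : r = 0%R by apply/eqP; rewrite eq_le r0 andbT; lra.
  by rewrite mul0rn exprS mul0r mul0e.
apply/seteqP; split=> -[a v] /=.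
  move=> /forall_row_cons[]; rewrite row_cons0/= => a0 vS.
  split => /=; first by rewrite in_itv/= -ler_distl.
  by move=> j; have := vS j; rewrite row_consS mxE.
rewrite in_itv/= -ler_distl => -[a0 vS]; apply/forall_row_cons.
rewrite row_cons0; split => // j; have := vS j.
by rewrite row_consS mxE.
Qed.

Lemma lebesgue_rV_unit_cube n : lebesgue_rV (@unit_cube R n) = 1.
Proof.
have h : (2^-1 *+ 2 = 1 :> R)%R by lra.
by rewrite unit_cubeE lebesgue_rV_cube ?invr_ge0// h expr1n.
Qed.

Lemma cube_bigcup n : \bigcup_k cube 0 k%:R = [set: 'rV[R]_n].
Proof.
rewrite -subTset => x _.
exists (\sum_i (Num.truncn `|x 0 i|%R).+1)%N => // i.
rewrite mxE subr0 (le_trans (ltW (truncnS_gt _)))//.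
by rewrite ler_nat (bigD1 i)//= leq_addr.
Qed.

Lemma cube_sigma_finite n (mu : {measure set 'rV[R]_n -> \bar R}) :
  (forall k : nat, mu (cube 0 k%:R) < +oo) -> sigma_finite setT mu.
Proof.
move=> muoo; exists (fun k => cube 0 k%:R); first by rewrite cube_bigcup.
by move=> k; split; [exact: measurable_cube|exact: muoo].
Qed.

Lemma lebesgue_measure_translation (v : R) (A : set (measurableTypeR R)) :
  measurable A -> lebesgue_measure [set x : R | A (x + v)%R] = lebesgue_measure A.
Proof.
have mv : measurable_fun setT (fun x : measurableTypeR R => (x + v)%R : measurableTypeR R).
  exact: measurable_funD.
pose m : {measure set (measurableTypeR R) -> \bar R} :=
  measure_function_pushforward__canonical__measure_function_Measure
    lebesgue_measure mv.
move=> mA; apply/esym/(@lebesgue_measure_unique _ m) => // _ [[a b]] _ <-.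
rewrite [RHS](_ : _ = lebesgue_measure (`](a - v)%R, (b - v)%R] : set R)).
  rewrite !lebesgue_measure_itv/= !lte_fin ltrD2r -!EFinD.
  by have -> : (b - v - (a - v) = b - a)%R by ring.
congr lebesgue_measure; apply/seteqP; split=> x /=; rewrite !in_itv/=;
  by rewrite ltrBlDr lerBrDr.
Qed.

(** A translation acts on each factor separately, so the translated measure agrees with the product
    on rectangles; uniqueness of product measures and induction do the rest. *)
Lemma lebesgue_rV_translation n : translation_invariant (@lebesgue_rV R n).
Proof.
elim: n => [|n ih] v A mA.
  congr (dirac _ _); apply/seteqP; split=> x /=; by rewrite [(x + v)%R]thinmx0 [x]thinmx0.
pose v0 := v 0%R 0%R; pose v' : 'rV[R]_n := (\row_j v 0 (lift ord0 j))%R.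
pose T (z : measurableTypeR R * 'rV[R]_n) : measurableTypeR R * 'rV[R]_n :=
  ((z.1 + v0)%R, (z.2 + v')%R).
have TE z : (row_cons z + v)%R = row_cons (T z).
  by apply: row_consP => [|j]; rewrite mxE ?row_cons0 ?row_consS//= !mxE.
have mT : measurable_fun setT T.
  apply: measurable_fun_pair.
    exact: measurable_funD.
  exact: measurableT_comp (measurable_rowvec_translate v') measurable_snd.
pose m : {measure set (measurableTypeR R * 'rV[R]_n) -> \bar R} :=
  measure_function_pushforward__canonical__measure_function_Measure
    (lebesgue_measure \x @lebesgue_rV R n) mT.
rewrite !lebesgue_rVSE [RHS](@product_measure_unique _ _ _ _ _ _ _ m); last 1 first.
- by rewrite -[X in measurable X]setTI; exact: measurable_row_cons.
- rewrite /m/= /pushforward; congr ((_ \x _) _).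
  by apply/funext => z /=; rewrite TE.
- move=> B C mB mC; rewrite /m/= /pushforward.
  rewrite (_ : T @^-1` _ = [set x : R | B (x + v0)%R] `*` [set x : 'rV[R]_n | C (x + v')%R])//.
  have mB' : measurable [set x : R | B (x + v0)%R].
    by rewrite -[X in measurable X]setTI; exact: measurable_funD.
  have mC' : measurable [set x : 'rV[R]_n | C (x + v')%R].
    by rewrite -[X in measurable X]setTI; exact: measurable_rowvec_translate.
  rewrite product_measure1E//; congr (_ * _); last exact: ih.
  exact: lebesgue_measure_translation.
Qed.

Lemma lebesgue_rV_hyperplane n (i : 'I_n) (a : R) :
  lebesgue_rV [set x : 'rV[R]_n | x 0%R i = a] = 0.
Proof.
elim: n i => [[]//|n ih] i; rewrite lebesgue_rVSE.
case: (unliftP ord0 i) => [j ->|->].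
  rewrite (_ : _ @^-1` _ = setT `*` [set x : 'rV[R]_n | x 0%R j = a]).
    rewrite product_measure1E//; first by rewrite [X in _ * X]ih mule0.
    rewrite -[X in measurable X]setTI.
    exact: (measurable_coord j _ (measurable_set1 a)).
  by apply/seteqP; split=> -[b x] /=; rewrite row_consS => // -[].
rewrite (_ : _ @^-1` _ = [set a] `*` setT).
  rewrite product_measure1E//.
  by rewrite [X in X * _](_ : _ = 0) ?mul0e//; exact: lebesgue_measure_set1.
by apply/seteqP; split=> -[b x] /=; rewrite row_cons0 => // -[].
Qed.

End cube.

(** * Lebesgue measure under scalings and linear isometries *)

Section lebesgue_linear_preimage.
Context {R : realType}.
Local Open Scope ereal_scope.

Lemma measurable_preimageT d1 d2 (T1 : measurableType d1)
    (T2 : measurableType d2) (f : T1 -> T2) (A : set T2) :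
  measurable_fun setT f -> measurable A -> measurable (f @^-1` A).
Proof. by move=> mf mA; rewrite -[X in measurable X]setTI; exact: mf. Qed.

Lemma mulIe_fin_num (z x y : \bar R) : z \is a fin_num -> z != 0 ->
  x * z = y * z -> x = y.
Proof.
case: z => // r _ r0 /(congr1 (fun u => u * (r^-1)%:E)).
by rewrite -!muleA -!EFinM mulfV ?mule1.
Qed.

Lemma measurable_pnorm (p : R) n : measurable_fun [set: 'rV[R]_n] (pnorm p).
Proof.
apply: (measurableT_comp (measurable_powR _)).
apply: measurable_sum => j; apply: (measurableT_comp (measurable_powR p)).
exact: (measurableT_comp (@normr_measurable R setT) (measurable_coord j)).
Qed.

Lemma measurable_rowvecZ n (t : R) :
  measurable_fun [set: 'rV[R]_n] (fun x => t *: x)%R.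
Proof.
apply: measurable_fun_rowvec => i; under eq_fun do rewrite mxE.
by apply: measurable_funM => //; exact: measurable_coord.
Qed.

(** Since [f] carries translations to translations, the measure of preimages is again translation
    invariant. The factor of proportionality is then found from one convenient symmetric test set
    [B]. *)
Lemma lebesgue_rV_preimage_proportional n (f : 'rV[R]_n -> 'rV[R]_n) :
  measurable_fun setT f ->
  (forall v, exists u, forall x, (f x + v = f (x + u))%R) ->
  (forall k : nat, lebesgue_rV (f @^-1` cube 0 k%:R) < +oo) ->
  forall A B : set 'rV[R]_n, measurable A -> measurable B -> (forall x, B (- x)%R = B x) ->
  lebesgue_rV (f @^-1` A) * lebesgue_rV B = lebesgue_rV A * lebesgue_rV (f @^-1` B).
Proof.
move=> mf fD foo A B mA mB symB.
pose m : {measure set 'rV[R]_n -> \bar R} :=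
  measure_function_pushforward__canonical__measure_function_Measure
    (@lebesgue_rV R n) mf.
have sf : sigma_finite setT m by apply: cube_sigma_finite => k; exact: foo.
rewrite -[LHS]/(measure_sigma_finite sf A * lebesgue_rV B).
rewrite (translation_invariant_proportional (la := @lebesgue_rV R n))//.
  move=> v C mC; have [u uE] := fD v.
  rewrite /measure_sigma_finite/= /pushforward.
  rewrite -[RHS](lebesgue_rV_translation u); last first.
    exact: measurable_preimageT mC.
  by congr lebesgue_rV; apply/seteqP; split=> x /=; rewrite uE.
exact: lebesgue_rV_translation.
Qed.

Lemma cubeN n (r : R) x : cube (0 : 'rV[R]_n)%R r (- x)%R = cube 0%R r x.
Proof.
by apply/propext; split=> h i; have := h i; rewrite !mxE !subr0 normrN.
Qed.

Lemma lebesgue_rV_scale n (t : R) (A : set 'rV[R]_n) : (0 < t)%R ->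
  measurable A ->
  lebesgue_rV [set x | A (t *: x)%R] = (t^-1 ^+ n)%:E * lebesgue_rV A.
Proof.
move=> t0 mA.
have cubeZ r : (fun x : 'rV[R]_n => t *: x)%R @^-1` cube 0 r = cube 0 (r / t)%R.
  apply/seteqP; split=> x h i; have := h i;
    by rewrite !mxE !subr0 normrM (gtr0_norm t0) ler_pdivlMr// mulrC.
have t0' : (0 <= t)%R by exact: ltW.
have := @lebesgue_rV_preimage_proportional n (fun x => t *: x)%R
  (measurable_rowvecZ t) _ _ A (cube 0%R 1%R) mA (measurable_cube _ _) (@cubeN n 1).
have E : ((1 / t) *+ 2 = t^-1 * 2)%R by rewrite mul1r mulr_natr.
rewrite cubeZ !lebesgue_rV_cube// ?divr_ge0// E exprMn => H.
have {}H : lebesgue_rV [set x : 'rV[R]_n | A (t *: x)%R] * (2 ^+ n)%:E =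
    lebesgue_rV A * (t^-1 ^+ n * 2 ^+ n)%:E.
  apply: H => [v|k].
    by exists (t^-1 *: v)%R => x; rewrite scalerDr scalerA mulfV ?gt_eqF// scale1r.
  by rewrite cubeZ lebesgue_rV_cube ?divr_ge0// ltry.
apply: (@mulIe_fin_num (2 ^+ n)%:E) => //.
by rewrite H EFinM muleA (muleC (lebesgue_rV A)).
Qed.

Lemma pnorm2_ball_sub_cube n (r : R) :
  [set x : 'rV[R]_n | pnorm 2 x <= r]%R `<=` cube 0%R r.
Proof.
by move=> x xr i; rewrite mxE subr0; exact: le_trans (coord_le_pnorm2 x i) xr.
Qed.

Lemma cube_sub_pnorm2_ball n : (0 < n)%N ->
  cube (0%R : 'rV[R]_n) (n%:R^-1)%R `<=` [set x | pnorm 2 x <= 1]%R.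
Proof.
move=> n0 x xn.
have n1 : (n%:R * n%:R^-1 = 1 :> R)%R by rewrite mulfV// pnatr_eq0 -lt0n.
have xi i : (`|x 0 i| <= n%:R^-1)%R by have := xn i; rewrite mxE subr0.
by have := pnorm2_le_bound xi; rewrite n1.
Qed.

(** The test set is the Euclidean unit ball, which [O] preserves, so the factor is 1. Cubes inside
    and around the ball show that its volume can be cancelled. *)
Lemma lebesgue_rV_isometry n (O : 'rV[R]_n -> 'rV[R]_n) (A : set 'rV[R]_n) :
  measurable_fun setT O -> (forall x y, O (x + y) = O x + O y)%R ->
  involutive O -> (forall x, pnorm 2 (O x) = pnorm 2 x) ->
  measurable A -> lebesgue_rV (O @^-1` A) = lebesgue_rV A.
Proof.
move=> mO OD OK On mA.
have [n0|n_gt0] := posnP n.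
  have thin (x y : 'rV[R]_n) : x = y by apply/rowP => -[i i0]; exfalso; move: i0; rewrite n0.
  by congr lebesgue_rV; apply/seteqP; split => x; rewrite /= (thin (O x) x).
pose B := [set x : 'rV[R]_n | pnorm 2 x <= 1]%R.
have mB : measurable B.
  rewrite (_ : B = pnorm 2 @^-1` `]-oo, 1%R]).
    by apply: measurable_preimageT; [exact: measurable_pnorm|].
  by apply/seteqP; split=> x; rewrite /= in_itv.
have BN x : B (- x)%R = B x by rewrite /B/= pnorm2N.
have OB : O @^-1` B = B by apply/seteqP; split => x; rewrite /B/= On.
have B1 : B `<=` cube (0%R : 'rV[R]_n) 1%R by exact: pnorm2_ball_sub_cube.
have Bn : cube (0%R : 'rV[R]_n) (n%:R^-1)%R `<=` B by exact: cube_sub_pnorm2_ball.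
clearbody B.
have B_fin : lebesgue_rV B \is a fin_num.
  rewrite ge0_fin_numE//; apply: (@le_lt_trans _ _ (lebesgue_rV (cube (0%R : 'rV[R]_n) 1%R))).
    by apply: le_measure; rewrite ?inE//; exact: measurable_cube.
  by rewrite lebesgue_rV_cube// ltry.
have B_neq0 : lebesgue_rV B != 0.
  rewrite gt_eqF//; apply: (@lt_le_trans _ _ (lebesgue_rV (cube (0%R : 'rV[R]_n) (n%:R^-1)%R))).
    by rewrite lebesgue_rV_cube ?invr_ge0// lte_fin exprn_gt0// mulrn_wgt0// invr_gt0 ltr0n.
  by apply: le_measure; rewrite ?inE//; exact: measurable_cube.
have := @lebesgue_rV_preimage_proportional n O mO _ _ A B mA mB BN.
rewrite OB => H; apply: (mulIe_fin_num B_fin B_neq0); apply: H => [v|k].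
  by exists (O v) => x; rewrite OD OK.
apply: (@le_lt_trans _ _ (lebesgue_rV (cube (0%R : 'rV[R]_n) (n%:R * k%:R)%R))).
  apply: le_measure; rewrite ?inE.
  - by apply: measurable_preimageT => //; exact: measurable_cube.
  - exact: measurable_cube.
  - move=> x xk i; rewrite mxE subr0 (le_trans (coord_le_pnorm2 x i))//.
    rewrite -On pnorm2_le_bound// => j.
    by have := xk j; rewrite mxE subr0.
by rewrite lebesgue_rV_cube ?ltry// mulr_ge0.
Qed.

End lebesgue_linear_preimage.

(** * Hausdorff measure *)

Section hausdorff_lipschitz.
Context {R : realType}.
Local Open Scope ereal_scope.

Lemma lee_expe (x y : \bar R) m : 0 <= x -> x <= y -> x ^+ m <= y ^+ m.
Proof.
move=> x0 xy; elim: m => [//|m ih]; rewrite !expeS.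
by apply: lee_pmul => //; exact: expe_ge0.
Qed.

Lemma expe_scale (a : R) (x : \bar R) m : 0 <= x ->
  (a%:E * x) ^+ m = (a ^+ m)%:E * x ^+ m.
Proof.
move=> x0; elim: m => [|m ih]; first by rewrite !expe0 mule1.
by rewrite !expeS ih exprS EFinM muleACA.
Qed.

Lemma diam_lipschitz n n' (f : 'rV[R]_n -> 'rV[R]_n') (A : set 'rV[R]_n) (L : R) :
  (0 < L)%R -> A !=set0 ->
  (forall x y, A x -> A y -> (pnorm 2 (f x - f y) <= L * pnorm 2 (x - y))%R) ->
  diam (f @` A) <= L%:E * diam A.
Proof.
move=> L0 A0 fL; apply: ge_ereal_sup => _ [_ [x Ax <-] [_ [y Ay <-] <-]].
apply: (@le_trans _ _ (L * pnorm 2 (x - y))%:E); first by rewrite lee_fin fL.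
by rewrite EFinM lee_pmul2l// ?lte_fin// pnorm2_le_diam.
Qed.

Lemma le_diam n (A B : set 'rV[R]_n) : A `<=` B -> diam A <= diam B.
Proof.
move=> AB; apply: ge_ereal_sup => _ [x Ax [y Ay <-]].
by apply: pnorm2_le_diam; exact: AB.
Qed.

Lemma hausdorff_raw_lipschitz m n n' (f : 'rV[R]_n -> 'rV[R]_n')
    (A : set 'rV[R]_n) (L : R) : (0 < L)%R ->
  (forall x y, A x -> A y -> (pnorm 2 (f x - f y) <= L * pnorm 2 (x - y))%R) ->
  hausdorff_raw m (f @` A) <= (L ^+ m)%:E * hausdorff_raw m A.
Proof.
move=> L0 fL; apply: ge_ereal_sup => _ [d /= d0 <-].
(* Sets of diameter at most [d / L] have images of diameter at most [d]. *)
have dL0 : (0 < d / L)%R by rewrite divr_gt0.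
apply: (@le_trans _ _ ((L ^+ m)%:E * hausdorff_delta m (d / L) A)); last first.
  by rewrite lee_pmul2l ?lte_fin ?exprn_gt0//; exact: hausdorff_delta_le_raw.
rewrite muleC -lee_pdivrMr ?exprn_gt0//.
apply: le_ereal_inf_tmp => _ [F [dF AF] <-].
rewrite lee_pdivrMr ?exprn_gt0// muleC -nneseriesZl; last first.
  by move=> k _; exact: hgauge_ge0.
(* [f] is controlled on [A] only, so the sets of the cover are cut down to [A] before being
   mapped. *)
pose G k := f @` (F k `&` A).
have dG k : G k !=set0 -> diam (G k) <= L%:E * diam (F k).
  move=> [_ [x FAx _]]; apply: le_trans (diam_lipschitz L0 _ _) _.
  - by exists x.
  - by move=> y z [_ Ay] [_ Az]; exact: fL.
  - by rewrite lee_pmul2l ?lte_fin//; apply: le_diam => y [].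
apply: (@le_trans _ _ (\sum_(k <oo) hgauge m (G k))).
  apply: ereal_inf_lbound; exists G => //; split => [k|_ [x Ax <-]].
    have [->|/set0P/dG] := eqVneq (G k) set0; first by rewrite diam0 leNye.
    move/le_trans; apply; rewrite muleC -lee_pdivlMr// -EFinM//.
  by have [k _ Fkx] := AF x Ax; exists k => //; exists x.
apply: lee_nneseries => [k _ _|k _]; first exact: hgauge_ge0.
rewrite {1}/hgauge; case: ifPn => [_|/set0P Gk0].
  by rewrite mule_ge0 ?hgauge_ge0// lee_fin exprn_ge0// ltW.
have Fk0 : F k !=set0 by case: Gk0 => _ [x [Fkx _] _]; exists x.
rewrite /hgauge ifF; last by apply/negbTE/set0P.
rewrite -expe_scale ?diam_ge0//; apply: lee_expe; first exact: diam_ge0.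
exact: dG.
Qed.

Lemma pnorm2_eq0 n (x : 'rV[R]_n) : (pnorm 2 x <= 0)%R -> x = 0%R.
Proof.
move=> x0; apply/rowP => i; rewrite mxE; apply/eqP; rewrite -normr_le0.
exact: le_trans (coord_le_pnorm2 x i) x0.
Qed.

Lemma pnorm2_0 n : pnorm 2 (0 : 'rV[R]_n)%R = 0%R.
Proof. by rewrite -(scale0r (0 : 'rV[R]_n)%R) pnorm2Z normr0 mul0r. Qed.

(** The hypothesis makes [f] injective on [A] with an [L]-Lipschitz inverse, to which
    [hausdorff_raw_lipschitz] applies. *)
Lemma hausdorff_raw_expanding m n n' (f : 'rV[R]_n -> 'rV[R]_n')
    (A : set 'rV[R]_n) (L : R) : (0 < L)%R ->
  (forall x y, A x -> A y -> (pnorm 2 (x - y) <= L * pnorm 2 (f x - f y))%R) ->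
  hausdorff_raw m A <= (L ^+ m)%:E * hausdorff_raw m (f @` A).
Proof.
move=> L0 fL; pose g y := xget 0%R [set x | A x /\ f x = y].
have gK x : A x -> g (f x) = x.
  move=> Ax; rewrite /g; case: xgetP => [z _ [Az fzx]|/(_ x)]; last by case.
  apply/eqP; rewrite -subr_eq0; apply/eqP/pnorm2_eq0.
  by have := fL _ _ Az Ax; rewrite fzx subrr pnorm2_0 mulr0.
rewrite [X in hausdorff_raw m X <= _](_ : A = g @` (f @` A)).
  apply: hausdorff_raw_lipschitz => // _ _ [x Ax <-] [y Ay <-].
  by rewrite !gK//; exact: fL.
apply/seteqP; split=> [x Ax|_ [_ [x Ax <-] <-]]; last by rewrite gK.
by exists (f x); [exists x|exact: gK].
Qed.

Lemma hausdorff_raw_isometry m n n' (f : 'rV[R]_n -> 'rV[R]_n')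
    (A : set 'rV[R]_n) :
  (forall x y, pnorm 2 (f x - f y) = pnorm 2 (x - y)) ->
  hausdorff_raw m (f @` A) = hausdorff_raw m A.
Proof.
move=> fi; apply/eqP; rewrite eq_le; apply/andP; split.
  have := @hausdorff_raw_lipschitz m _ _ f A 1%R ltr01.
  by rewrite expr1n mul1e; apply => x y _ _; rewrite fi mul1r.
have := @hausdorff_raw_expanding m _ _ f A 1%R ltr01.
by rewrite expr1n mul1e; apply => x y _ _; rewrite fi mul1r.
Qed.

Lemma hausdorff_raw_translation m n : translation_invariant (@hausdorff_raw R m n).
Proof.
move=> v A _; rewrite (_ : [set x | A (x + v)%R] = (fun x => x - v)%R @` A).
  apply: hausdorff_raw_isometry => x y.
  by rewrite opprB addrA subrK.
apply/seteqP; split=> [x Ax|_ [x Ax <-]/=]; last by rewrite subrK.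
by exists (x + v)%R => //; rewrite addrK.
Qed.

End hausdorff_lipschitz.

(** * Hausdorff measure of the unit cube in its own dimension *)

Section hausdorff_top_dimension.
Context {R : realType}.
Local Open Scope ereal_scope.

Lemma finite_cover_hausdorff_delta m n (N : nat) (Q : nat -> set 'rV[R]_n)
    (A : set 'rV[R]_n) (d c : R) :
  (forall k, diam (Q k) <= d%:E) -> (forall k, hgauge m (Q k) <= c%:E) ->
  (0 <= c)%R -> A `<=` \bigcup_(k in `I_N) Q k ->
  hausdorff_delta m d A <= (N%:R * c)%:E.
Proof.
move=> Qd Qc c0 AQ; pose F k := if (k < N)%N then Q k else set0.
apply: (@le_trans _ _ (\sum_(k <oo) hgauge m (F k))).
  apply: ereal_inf_lbound; exists F => //; split => [k|x Ax].
    by rewrite /F; case: ifPn => // _; rewrite diam0 leNye.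
  by have [k /= kN Qkx] := AQ x Ax; exists k => //; rewrite /F kN.
rewrite (nneseries_split 0 N); last by move=> k _; exact: hgauge_ge0.
rewrite add0n [X in _ + X]eseries0 ?adde0; last first.
  by move=> k /= Nk _; rewrite /F ltnNge Nk hgauge0.
apply: (@le_trans _ _ (\sum_(0 <= k < N) c%:E)).
  apply: lee_sum => k _; rewrite /F; case: ifPn => // _.
  by rewrite hgauge0 lee_fin.
by rewrite sumEFin lee_fin big_const_nat subn0 iter_addr addr0 mulr_natl.
Qed.

Lemma diam_cube n (c : 'rV[R]_n) (r : R) : diam (cube c r) <= (n%:R * (r *+ 2))%:E.
Proof.
apply: ge_ereal_sup => _ [x xc [y yc <-]]; rewrite lee_fin.
apply: pnorm2_le_bound => i; rewrite !mxE.
have -> : (x 0 i - y 0 i = (x 0 i - c 0 i) - (y 0 i - c 0 i))%R by ring.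
by rewrite (le_trans (ler_normB _ _))// mulr2n lerD.
Qed.

Lemma hgauge_le m n (A : set 'rV[R]_n) (c : R) : (0 <= c)%R ->
  diam A <= c%:E -> hgauge m A <= (c ^+ m)%:E.
Proof.
move=> c0 Ac; rewrite /hgauge; case: ifPn => [_|/set0P A0].
  by rewrite lee_fin exprn_ge0.
by rewrite EFin_expe lee_expe// diam_ge0.
Qed.

(* The cube is cut into at most [(k + 1) ^ m] cells of side [1 / k]. *)
Lemma hausdorff_raw_unit_cube_fin m : hausdorff_raw m (@unit_cube R m) < +oo.
Proof.
(* A bound uniform in [d]: cells of diameter at most [m / k] contribute at most
   [((k + 1) * m / k) ^ m], and [(k + 1) / k <= 2]. *)
apply: (@le_lt_trans _ _ ((m%:R * 2) ^+ m)%:E); last by rewrite ltry.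
apply: ge_ereal_sup => _ [d /= d0 <-].
pose k := (Num.truncn (m%:R / d)).+1.
have k0 : (0 < k%:R :> R)%R by rewrite ltr0n.
have mkd : (m%:R * k%:R^-1 <= d)%R.
  rewrite ler_pdivrMr// mulrC -ler_pdivrMr//; apply/ltW/truncnS_gt.
(* There are [k + 1] indices per axis, not [k], because a coordinate equal to 1 truncates to index
   [k]. *)
pose T := {ffun 'I_m -> 'I_k.+1}.
pose ctr (f : T) : 'rV[R]_m := (\row_i ((f i)%:R / k%:R + (2 * k%:R)^-1))%R.
pose Q j := if [pick f : T | enum_rank f == j :> nat] is Some f
  then cube (ctr f) ((2 * k%:R)^-1)%R else set0.
have s2 : ((2 * k%:R)^-1 *+ 2 = k%:R^-1 :> R)%R.
  by rewrite -[LHS]mulr_natr invfM mulrAC mulVf ?mul1r// pnatr_eq0.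
have Qdiam j : diam (Q j) <= (m%:R * k%:R^-1)%:E.
  rewrite /Q; case: pickP => [f _|_]; last by rewrite diam0 leNye.
  by apply: le_trans (diam_cube _ _) _; rewrite s2.
have c0 : (0 <= m%:R * k%:R^-1 :> R)%R by rewrite mulr_ge0// invr_ge0.
apply: (@le_trans _ _ (#|T|%:R * (m%:R * k%:R^-1) ^+ m)%:E).
  apply: (@finite_cover_hausdorff_delta m m #|T| Q).
  - by move=> j; apply: le_trans (Qdiam j) _; rewrite lee_fin.
  - by move=> j; exact: hgauge_le.
  - exact: exprn_ge0.
  move=> x x01; pose f : T := [ffun i => inord (Num.truncn (k%:R * x 0 i))%R].
  exists (enum_rank f) => /=; first exact: ltn_ord.
  rewrite /Q; case: pickP => [g /eqP/val_inj/enum_rank_inj ->|/(_ f)]; last first.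
    by rewrite eqxx.
  move=> i; rewrite mxE ffunE.
  have /andP[xi0 xi1] := x01 i.
  have kx0 : (0 <= k%:R * x 0 i)%R by rewrite mulr_ge0.
  have /andP[t1 t2] := truncn_itv kx0.
  rewrite inordK; last first.
    by rewrite ltnS -(ler_nat R) (le_trans t1)// ler_piMr.
  move: t1 t2; set t := Num.truncn _; rewrite -natr1 => t1 t2.
  have k0' := ltW k0.
  rewrite ler_distl; apply/andP; split.
    by rewrite addrK ler_pdivrMr// mulrC.
  by rewrite -addrA -mulr2n s2 -[X in (_ + X)%R]mul1r -mulrDl ler_pdivlMr// mulrC ltW.
rewrite lee_fin card_ffun !card_ord natrX -exprMn lerXn2r ?nnegrE ?mulr_ge0//.
rewrite mulrCA ler_wpM2l// ler_pdivrMr// -natrM ler_nat mul2n -addnn.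
by rewrite -addn1 leq_add2l.
Qed.

(** A non-empty set of diameter [d] lies in the cube of side [2d] around any of its points, whence
    [2 ^ m]. Scale 1 suffices, since it already makes the diameters finite. The lemma serves to show
    that the unit cube has positive Hausdorff measure. *)
Lemma lebesgue_rV_le_hausdorff_raw m (A : set 'rV[R]_m) : measurable A ->
  lebesgue_rV A <= (2 ^+ m)%:E * hausdorff_raw m A.
Proof.
move=> mA; apply: (@le_trans _ _ ((2 ^+ m)%:E * hausdorff_delta m 1 A)); last first.
  by rewrite lee_pmul2l ?lte_fin ?exprn_gt0//; exact: hausdorff_delta_le_raw.
rewrite muleC -lee_pdivrMr ?exprn_gt0//.
apply: le_ereal_inf_tmp => _ [F [dF AF] <-].
rewrite lee_pdivrMr ?exprn_gt0// muleC -nneseriesZl; last first.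
  by move=> k _; exact: hgauge_ge0.
pose G k : set 'rV[R]_m := if pselect (F k !=set0) is left h
  then cube (projT1 (cid h)) (fine (diam (F k))) else set0.
have mG k : measurable (G k).
  by rewrite /G; case: pselect => // h; exact: measurable_cube.
have dFE k : F k !=set0 -> diam (F k) = (fine (diam (F k)))%:E.
  move=> h; rewrite fineK// ge0_fin_numE ?diam_ge0//.
  by rewrite (le_lt_trans (dF k))// ltry.
apply: (@le_trans _ _ (\sum_(k <oo) lebesgue_rV (G k))).
  apply: measure_sigma_subadditive => // x Ax.
  have [k _ Fkx] := AF x Ax; exists k => //.
  rewrite /G; case: pselect => [h|]; last by case; exists x.
  case: cid => y Fky /= i; rewrite -lee_fin -dFE//.
  apply: le_trans (pnorm2_le_diam Fkx Fky).
  by have := coord_le_pnorm2 (x - y) i; rewrite !mxE lee_fin.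
apply: lee_nneseries => [k _ _|k _]; first exact: measure_ge0.
rewrite /G; case: pselect => h; last first.
  by rewrite measure0 mule_ge0 ?hgauge_ge0// lee_fin exprn_ge0.
have d0 : (0 <= fine (diam (F k)))%R by rewrite fine_ge0// diam_ge0.
rewrite lebesgue_rV_cube// /hgauge ifF; last by apply/negbTE/set0P.
by rewrite -expe_scale ?diam_ge0// [in leRHS]dFE// -EFinM -EFin_expe mulr_natl.
Qed.

Lemma hausdorff_raw_unit_cube_gt0 m : 0 < hausdorff_raw m (@unit_cube R m).
Proof.
have mU : measurable (@unit_cube R m) by rewrite unit_cubeE; exact: measurable_cube.
have := lebesgue_rV_le_hausdorff_raw mU.
rewrite lebesgue_rV_unit_cube lt0e outer_measure_ge0 andbT => H.
by apply/eqP => h; move: H; rewrite h mule0 leNgt lte01.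
Qed.

End hausdorff_top_dimension.

Section hausdorff_borel.
Context {R : realType} (m n : nat).
Local Open Scope ereal_scope.

(* An alias carrying a measure structure on Borel sets, next to the outer measure
   structure carried by [hausdorff_raw]. *)
Definition hausdorff_borel : set 'rV[R]_n -> \bar R := @hausdorff_raw R m n.

Let hausdorff_borel0 : hausdorff_borel set0 = 0.
Proof. exact: (outer_measure0 (@hausdorff_raw R m n)). Qed.

Let hausdorff_borel_ge0 A : 0 <= hausdorff_borel A.
Proof. exact: (outer_measure_ge0 (@hausdorff_raw R m n)). Qed.

Let hausdorff_borel_sigma_additive : semi_sigma_additive hausdorff_borel.
Proof.
move=> F mF tF mUF.
apply: (@caratheodory_measure_sigma_additive _ _ (@hausdorff_raw R m n)) => //.
  by move=> k; exact: hausdorff_measurable_caratheodory.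
exact: hausdorff_measurable_caratheodory.
Qed.

HB.instance Definition _ := isMeasure.Build _ _ _ hausdorff_borel
  hausdorff_borel0 hausdorff_borel_ge0 hausdorff_borel_sigma_additive.

End hausdorff_borel.

Section hausdorff_lebesgue.
Context {R : realType} (m : nat).
Local Open Scope ereal_scope.

Lemma cube_image_unit_cube (r : R) : (0 < r)%R ->
  cube (0 : 'rV[R]_m)%R r =
  (fun x => (r *+ 2) *: x - const_mx r)%R @` unit_cube m.
Proof.
move=> r0; have r20 : (0 < r *+ 2)%R by rewrite mulrn_wgt0.
apply/seteqP; split=> [x xr|_ [x x01 <-] i]; last first.
  have /andP[x0 x1] := x01 i; rewrite !mxE subr0 ler_norml; apply/andP; split.
    by rewrite lerBrDr addNr mulr_ge0// ltW.
  by rewrite lerBlDr -mulr2n ler_piMr// ltW.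
exists ((r *+ 2)^-1 *: (x + const_mx r))%R.
  move=> i; have := xr i; rewrite !mxE subr0 ler_norml => /andP[h1 h2].
  rewrite mulr_ge0 ?invr_ge0 ?(ltW r20)//=; last by rewrite -lerBlDr sub0r.
  by rewrite ler_pdivrMl// mulr1 mulr2n lerD2r.
by rewrite scalerA mulfV ?gt_eqF// scale1r addrK.
Qed.

Lemma hausdorff_raw_cube_fin (r : R) :
  hausdorff_raw m (cube (0 : 'rV[R]_m)%R r) < +oo.
Proof.
have s0 : (0 < `|r| + 1)%R by rewrite ltr_wpDl.
have s20 : (0 < (`|r| + 1) *+ 2)%R by rewrite mulrn_wgt0.
apply: (@le_lt_trans _ _ (hausdorff_raw m (cube (0 : 'rV[R]_m)%R (`|r| + 1)))).
  apply: le_outer_measure => x xr i; rewrite (le_trans (xr i))//.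
  by rewrite (le_trans (ler_norm r))// lerDl.
rewrite cube_image_unit_cube//.
apply: le_lt_trans (hausdorff_raw_lipschitz m s20 _) _.
  move=> x y _ _; rewrite opprB addrA subrK -scalerBr pnorm2Z.
  by rewrite gtr0_norm.
apply: lte_mul_pinfty => //.
exact: hausdorff_raw_unit_cube_fin.
Qed.

Lemma hausdorff_raw_lebesgue (A : set 'rV[R]_m) : measurable A ->
  hausdorff_raw m A = hausdorff_raw m (@unit_cube R m) * lebesgue_rV A.
Proof.
move=> mA; have sf : sigma_finite setT (@hausdorff_borel R m m).
  by apply: cube_sigma_finite => k; exact: hausdorff_raw_cube_fin.
(* [unit_cube] is not symmetric about the origin, so [A] and [unit_cube] are both compared with the
   symmetric cube [B]. *)
pose B := cube (0 : 'rV[R]_m)%R 1%R.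
have mB : measurable B by exact: measurable_cube.
have prop (C : set 'rV[R]_m) : measurable C ->
    hausdorff_raw m C * lebesgue_rV B = lebesgue_rV C * hausdorff_raw m B.
  move=> mC; exact: (@translation_invariant_proportional R m
    (measure_sigma_finite sf) (@lebesgue_rV R m) C B
    (@hausdorff_raw_translation R m m) (@lebesgue_rV_translation R m)
    mC mB (@cubeN R m 1%R)).
have mU : measurable (@unit_cube R m) by rewrite unit_cubeE; exact: measurable_cube.
have BE : lebesgue_rV B = (2 ^+ m)%:E by rewrite lebesgue_rV_cube.
apply: (@mulIe_fin_num _ (2 ^+ m)%:E) => //; rewrite -?BE ?prop//.
have := prop _ mU; rewrite lebesgue_rV_unit_cube mul1e => <-.
by rewrite muleA (muleC (lebesgue_rV A)).
Qed.

End hausdorff_lebesgue.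

(** * Cones over hyperplanes *)

Section reflection.
Context {R : realType} {n : nat}.
Implicit Types x y d : 'rV[R]_n.

Definition rowdot x y : R := \sum_i x 0 i * y 0 i.

Lemma rowdotDl x y d : rowdot (x + y) d = rowdot x d + rowdot y d.
Proof. by rewrite /rowdot -big_split; apply: eq_bigr => i _; rewrite mxE mulrDl. Qed.

Lemma rowdotZl a x d : rowdot (a *: x) d = a * rowdot x d.
Proof. by rewrite /rowdot mulr_sumr; apply: eq_bigr => i _; rewrite mxE mulrA. Qed.

Lemma rowdotC x y : rowdot x y = rowdot y x.
Proof. by apply: eq_bigr => i _; rewrite mulrC. Qed.

Lemma rowdotBl x y d : rowdot (x - y) d = rowdot x d - rowdot y d.
Proof. by rewrite rowdotDl -scaleN1r rowdotZl mulN1r. Qed.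

Lemma rowdotBr x y d : rowdot d (x - y) = rowdot d x - rowdot d y.
Proof. by rewrite rowdotC rowdotBl !(rowdotC _ d). Qed.

Lemma rowdotZr a x d : rowdot d (a *: x) = a * rowdot d x.
Proof. by rewrite rowdotC rowdotZl rowdotC. Qed.

Lemma rowdotxx x : rowdot x x = pnorm 2 x ^+ 2.
Proof. by rewrite sqr_pnorm2; apply: eq_bigr => i _; rewrite expr2. Qed.

Lemma rowdot_eq0 x : rowdot x x = 0 -> x = 0.
Proof.
rewrite rowdotxx => /eqP; rewrite sqrf_eq0 => /eqP x0.
by apply: pnorm2_eq0; rewrite x0.
Qed.

Lemma rowdot_delta x i : rowdot x (delta_mx 0 i) = x 0 i.
Proof.
rewrite /rowdot (bigD1 i)//= mxE !eqxx mulr1 big1 ?addr0// => j ji.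
by rewrite mxE (negbTE ji) andbF mulr0.
Qed.

(* For [d = 0] the quotient is [0 / 0 = 0] and the reflection is the identity. *)
Definition reflection d x : 'rV[R]_n :=
  x - (2 * rowdot x d / rowdot d d) *: d.

Lemma reflectionD d x y :
  reflection d (x + y) = reflection d x + reflection d y.
Proof.
by rewrite /reflection rowdotDl mulrDr mulrDl scalerDl opprD addrACA.
Qed.

Lemma reflectionZ d a x : reflection d (a *: x) = a *: reflection d x.
Proof. by rewrite /reflection rowdotZl scalerBr scalerA !mulrA (mulrC 2). Qed.

Lemma reflectionN d x : reflection d (- x) = - reflection d x.
Proof. by rewrite -scaleN1r reflectionZ scaleN1r. Qed.

Lemma reflectionB d x y :
  reflection d (x - y) = reflection d x - reflection d y.
Proof. by rewrite reflectionD reflectionN. Qed.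

Lemma reflection0 x : reflection 0 x = x.
Proof. by rewrite /reflection scaler0 subr0. Qed.

Lemma reflectionK d : involutive (reflection d).
Proof.
move=> x; have [/rowdot_eq0 ->|d0] := eqVneq (rowdot d d) 0.
  by rewrite !reflection0.
rewrite {1}/reflection {2}/reflection rowdotBl rowdotZl divfK//.
rewrite /reflection -addrA -opprD -scalerDl.
rewrite (_ : _ / _ + _ = 0) ?scale0r ?subr0//.
by rewrite -mulrDl; apply/eqP; rewrite mulf_eq0; apply/orP; left; apply/eqP; ring.
Qed.

Lemma pnorm2_reflection d x : pnorm 2 (reflection d x) = pnorm 2 x.
Proof.
have [/rowdot_eq0 ->|d0] := eqVneq (rowdot d d) 0.
  by rewrite !reflection0.
have : rowdot (reflection d x) (reflection d x) = rowdot x x.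
  rewrite /reflection rowdotBl !rowdotBr !rowdotZl !rowdotZr (rowdotC d x).
  by move: (rowdot x d) (rowdot x x) (rowdot d d) d0 => a b c c0; field.
rewrite !rowdotxx; have := pnorm2_ge0 x; have := pnorm2_ge0 (reflection d x).
move: (pnorm 2 (reflection d x)) (pnorm 2 x) => a b a0 b0 /eqP.
by rewrite eqrXn2// => /eqP.
Qed.

Lemma measurable_reflection d : measurable_fun setT (reflection d).
Proof.
apply: measurable_fun_rowvec => i; under eq_fun do rewrite !mxE.
apply: measurable_funB; first exact: measurable_coord.
apply: measurable_funM => //; apply: measurable_funM => //.
apply: measurable_funM => //; apply: measurable_sum => j.
by apply: measurable_funM => //; exact: measurable_coord.
Qed.

(** For a unit vector [y] this reflection exchanges [y] and the basis vector [e_i]. Being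
    self-adjoint, it turns the coordinate along [e_i] into the product with [y]. *)
Lemma reflection_coord (i : 'I_n) x y : pnorm 2 y = 1 ->
  reflection (y - delta_mx 0 i) x 0 i = rowdot x y.
Proof.
move=> y1; have yy : rowdot y y = 1 by rewrite rowdotxx y1 expr1n.
rewrite /reflection; set d := y - _.
have xd : rowdot x d = rowdot x y - x 0 i.
  by rewrite /d rowdotBr rowdot_delta.
have dd : rowdot d d = 2 - 2 * y 0 i.
  rewrite /d rowdotBl !rowdotBr yy rowdot_delta rowdotC rowdot_delta rowdot_delta.
  by rewrite mxE !eqxx /=; ring.
have di : d 0 i = y 0 i - 1 by rewrite /d !mxE !eqxx.
have [d0|d_neq0] := eqVneq (rowdot d d) 0.
  have {}d0 := rowdot_eq0 d0.
  have -> : y = delta_mx 0 i by apply/eqP; rewrite -subr_eq0 -/d d0.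
  by rewrite d0 scaler0 subr0 rowdot_delta.
have entry (a : R) : (x - a *: d) 0 i = x 0 i - a * d 0 i.
  by rewrite mxE [X in _ + X]mxE [X in - X]mxE.
rewrite entry di xd; move: d_neq0; rewrite dd => d_neq0; field.
exact: d_neq0.
Qed.

End reflection.

(** * Volume of a cone and area of its flat base *)

Section cone_over_hyperplane.
Context {R : realType}.
Local Open Scope ereal_scope.

(** The integrand is the ratio of the slice of a cone at height [t] to its base at height [k^-1].
    The factor [n] of the theorem originates here, as [m + 1]. *)
Lemma integral_pow (m : nat) (k : R) : (0 < k)%R ->
  \int[lebesgue_measure]_(t in `]0%R, k^-1%R]) ((k * t) ^+ m)%:E =
  ((m.+1%:R * k)^-1)%:E.
Proof.
move=> k0; have kn0 : k != 0%R by rewrite gt_eqF.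
have mn0 : (m.+1%:R != 0 :> R)%R by rewrite pnatr_eq0.
have mf : measurable_fun setT (fun t : R => (k * t) ^+ m)%R.
  by apply: measurable_funX; apply: measurable_funM.
rewrite integral_itv_obnd_cbnd; last exact/measurable_EFinP/measurable_funTS.
pose F (t : R) : R := ((m.+1%:R * k)^-1 * (k * t) ^+ m.+1)%R.
have dF (t : R) : is_derive t (1%R : R) F ((k * t) ^+ m)%R.
  have -> : F = (k ^+ m / m.+1%:R)%R \*: (@GRing.exp R ^~ m.+1).
    apply/funext => y; rewrite /F/= exprMn [(k ^+ m.+1)%R]exprS.
    by rewrite /GRing.scale/=; move: (m.+1%:R)%R mn0 => c c0; field; apply/andP; split.
  apply: DeriveDef; first by apply: derivableZ; exact: exprn_derivable.
  rewrite deriveZ ?exp_derive; last exact: exprn_derivable.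
  by rewrite /GRing.scale/= mulr1 mulrA divfK// exprMn.
rewrite (@continuous_FTC2 _ _ F)//.
- rewrite /F mulr0 expr0n/= mulr0 sube0 mulfV// expr1n mulr1//.
- by rewrite invr_gt0.
- apply: continuous_subspaceT => t.
  apply: (@continuous_comp _ _ _ (fun t : R => k * t)%R (fun x : R => x ^+ m)%R).
    exact: mulrl_continuous.
  exact: exprn_continuous.
- have Fc t : {for t, continuous F}.
    by apply: differentiable_continuous; apply/derivable1_diffP; have [] := dF t.
  split.
  + by move=> t _; have [] := dF t.
  + exact/cvg_at_right_filter/Fc.
  + exact/cvg_at_left_filter/Fc.
- by move=> t _; rewrite derive1E; have [] := dF t.
Qed.

Definition row_tail m (z : 'rV[R]_m.+1) : 'rV[R]_m := (\row_j z 0 (lift ord0 j))%R.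

Lemma row_consK m (z : R * 'rV[R]_m) : row_tail (row_cons z) = z.2.
Proof. by apply/rowP => j; rewrite mxE row_consS. Qed.

Lemma row_tailK m (x : 'rV[R]_m.+1) : row_cons (x 0%R 0%R, row_tail x) = x.
Proof. by apply/esym/row_consP => // j; rewrite mxE. Qed.

Lemma measurable_cone_preimage m (f : 'rV[R]_m -> R) n (g : 'rV[R]_m -> 'rV[R]_n)
    (A : set 'rV[R]_n) :
  measurable_fun setT f -> measurable_fun setT g -> measurable A ->
  measurable [set z | (0 < f z <= 1)%R /\ A ((f z)^-1 *: g z)%R].
Proof.
move=> mf mg mA.
(* Where [0 < f z] the inverse is the power [-1], whose measurability is that of [powR]. *)
rewrite (_ : [set _ | _] = (f @^-1` `]0%R, 1%R]) `&`
    ((fun z => (f z `^ (- 1)) *: g z)%R @^-1` A)); last first.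
  by apply/seteqP; split => z; rewrite /= in_itv/= => -[f01];
    rewrite powR_inv1 ?(ltW (proj1 (andP f01))).
apply: measurableI; first exact: measurable_preimageT.
apply: (@measurable_preimageT _ _ _ _ (fun z => (f z `^ (- 1)) *: g z)%R) => //.
apply: measurable_fun_rowvec => i; under eq_fun do rewrite mxE.
apply: measurable_funM; first exact: (measurableT_comp (measurable_powR _)).
exact: measurableT_comp (measurable_coord i) mg.
Qed.

(** The set is the cone from the origin, apex removed, over [B] placed at height [k^-1]. Its slice
    at height [t] is [(k * t) B], of volume [(k * t) ^ m] times that of [B]. *)
Lemma lebesgue_rV_horizontal_cone m (k : R) (B : set 'rV[R]_m) : (0 < k)%R ->
  measurable B ->
  lebesgue_rV [set z : 'rV[R]_m.+1 |
    (0 < k * z 0%R 0%R <= 1)%R /\ B ((k * z 0 0)^-1 *: row_tail z)%R] =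
  ((m.+1%:R * k)^-1)%:E * lebesgue_rV B.
Proof.
move=> k0 mB; rewrite lebesgue_rVSE /product_measure1/=.
transitivity (\int[lebesgue_measure]_(t in `]0%R, k^-1%R])
    (((k * t) ^+ m)%:E * lebesgue_rV B)); last first.
  rewrite ge0_integralZr ?integral_pow//.
    apply/measurable_EFinP/measurable_funX/measurable_funM => //.
  move=> t; rewrite /= in_itv/= => /andP[t0 _].
  by rewrite lee_fin exprn_ge0// mulr_ge0// ltW.
rewrite [RHS]integral_mkcond; apply: eq_integral => t _.
rewrite patchE /=; have [|] := boolP (t \in `]0%R, k^-1%R]%classic).
  rewrite inE /= in_itv/= => /andP[t0 tk].
  have kt0 : (0 < k * t)%R by rewrite mulr_gt0.
  have kt1 : (k * t <= 1)%R by rewrite mulrC -ler_pdivlMr// div1r.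
  have := @lebesgue_rV_scale _ _ (k * t)^-1%R B; rewrite invrK invr_gt0 => <- //.
  congr lebesgue_rV; apply/seteqP; split=> x; rewrite /xsection/= inE/= row_cons0/= row_consK.
    by case.
  by rewrite kt0 kt1.
rewrite notin_setE /= in_itv/= => ht.
rewrite (_ : xsection _ _ = set0) ?measure0//.
rewrite -subset0 => x; rewrite /xsection/= inE/= row_cons0/= => -[/andP[kt0 kt1] _].
apply: ht; rewrite -(pmulr_rgt0 _ k0) kt0/=.
by rewrite -[leRHS]div1r ler_pdivlMr// mulrC.
Qed.

Lemma row_cons_isometry m (h : R) (x y : 'rV[R]_m) :
  pnorm 2 (row_cons (h, x) - row_cons (h, y)) = pnorm 2 (x - y)%R.
Proof.
have E i : ((row_cons (h, x) - row_cons (h, y)) 0 i =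
    row_cons (h, x) 0 i - row_cons (h, y) 0 i)%R.
  by rewrite mxE [X in (_ + X)%R]mxE.
rewrite !pnorm2E big_ord_recl E !row_cons0 subrr expr0n/= add0r.
by congr Num.sqrt; apply: eq_bigr => i _; rewrite E !row_consS !mxE.
Qed.

(* The reflection exchanging the unit normal of the hyperplane and the first
   basis vector reduces to a cone over a horizontal hyperplane. *)
Lemma hausdorff_raw_hyperplane m (w : 'rV[R]_m.+1) (A : set 'rV[R]_m.+1) :
  (0 < pnorm 2 w)%R -> measurable A -> (forall x, A x -> rowdot x w = 1%R) ->
  hausdorff_raw m A = hausdorff_raw m (@unit_cube R m) *
    ((m.+1%:R * pnorm 2 w)%:E * lebesgue_rV
      [set y : 'rV[R]_m.+1 | (0 < rowdot y w <= 1)%R /\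
                             A ((rowdot y w)^-1 *: y)%R]).
Proof.
set k := pnorm 2 w => k0 mA Aw.
pose u := (k^-1 *: w)%R.
have u1 : pnorm 2 u = 1%R.
  by rewrite /u pnorm2Z gtr0_norm ?invr_gt0// mulVf// gt_eqF.
pose O := reflection (u - delta_mx 0 0)%R.
have OK : involutive O by exact: reflectionK.
have OZ a z : O (a *: z)%R = (a *: O z)%R by exact: reflectionZ.
have mO : measurable_fun setT O by exact: measurable_reflection.
(* Hence [O] carries the hyperplane [<x, w> = 1] to the horizontal one at height [k^-1]. *)
have O0 y : (k * O y 0 0 = rowdot y w)%R.
  by rewrite /O reflection_coord// /u rowdotZr mulrA mulfV ?gt_eqF// mul1r.
pose B := [set v : 'rV[R]_m | A (O (row_cons (k^-1, v)%R))].
have mB : measurable B.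
  apply: (@measurable_preimageT _ _ _ _ (fun v => O (row_cons (k^-1, v)%R))) => //.
  apply: (measurableT_comp mO); apply: measurable_fun_rowvec => i.
  case: (unliftP ord0 i) => [j ->|->].
    by under eq_fun do rewrite row_consS; exact: measurable_coord.
  by under eq_fun do rewrite row_cons0/=; exact: measurable_cst.
have -> : hausdorff_raw m A = hausdorff_raw m B.
  rewrite -(@hausdorff_raw_isometry _ m _ _ (fun v => O (row_cons (k^-1, v)%R)) B).
    congr hausdorff_raw; apply/seteqP; split=> [x Ax|_ [v Bv <-]//].
    have Ox : row_cons (k^-1, row_tail (O x))%R = O x.
      rewrite -[RHS]row_tailK; congr (row_cons (_, _)).
      by apply: (@mulfI _ k); rewrite ?gt_eqF// O0 Aw// mulfV// gt_eqF.
    by exists (row_tail (O x)); rewrite /B/= Ox OK.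
  move=> x y; rewrite -[in LHS](reflectionB) pnorm2_reflection.
  exact: row_cons_isometry.
rewrite hausdorff_raw_lebesgue//; congr (_ * _).
have mrd : measurable_fun setT (rowdot ^~ w).
  by apply: measurable_sum => j; apply: measurable_funM => //; exact: measurable_coord.
have mC := measurable_cone_preimage mrd (@measurable_id _ _ setT) mA.
rewrite -(lebesgue_rV_isometry mO (reflectionD _) OK (pnorm2_reflection _) mC).
have -> : lebesgue_rV B = (m.+1%:R * k)%:E * (((m.+1%:R * k)^-1)%:E * lebesgue_rV B).
  by rewrite muleA -EFinM mulfV ?mul1e// mulf_neq0// gt_eqF.
congr (_ * _); rewrite -lebesgue_rV_horizontal_cone//.
have zE (z : 'rV[R]_m.+1) : (0 < k * z 0 0)%R ->
    row_cons (k^-1, (k * z 0 0)^-1 *: row_tail z)%R = ((k * z 0 0)^-1 *: z)%R.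
  move=> kz0; have z0 : z 0%R 0%R != 0%R.
    by apply: contraTneq kz0 => ->; rewrite mulr0 ltxx.
  apply/esym/row_consP => [|j]; last by rewrite !mxE.
  by rewrite mxE invfM/= -mulrA mulVf// mulr1.
congr lebesgue_rV; apply/seteqP; split => z /=; rewrite -O0 OK /B/= => -[h1];
  by have /andP[h0 _] := h1; rewrite zE// OZ.
Qed.

End cone_over_hyperplane.

(** * Comparison of the simplex with its tangent hyperplanes *)

Section powR_local.
Context {R : realType}.

Lemma powR_continuous_gt0 (a x : R) : 0 < x -> {for x, continuous (@powR R ^~ a)}.
Proof.
move=> x0; apply: differentiable_continuous; apply/derivable1_diffP.
by have [] := is_derive1_powR a x0.
Qed.

Lemma powR_MVT (p s t : R) : 0 < s -> s <= t ->
  exists2 c, s <= c <= t & t `^ p - s `^ p = p * c `^ (p - 1) * (t - s).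
Proof.
move=> s0 st.
have [||c cst ->] := @MVT_segment R (@powR R ^~ p)
    (fun c => p * c `^ (p - 1)) s t st.
- move=> x; rewrite in_itv/= => /andP[sx _].
  exact: is_derive1_powR (lt_trans s0 sx).
- apply/continuous_in_subspaceT => x; rewrite inE/= in_itv/= => /andP[sx _].
  exact: powR_continuous_gt0 (lt_le_trans s0 sx).
- by exists c => //; rewrite in_itv in cst.
Qed.

(** Differentiability at [x0] in the strict sense: both [s] and [t] vary, as is needed to compare
    distances between arbitrary pairs of points. By the mean value theorem the slope is
    [p * c ^ (p - 1)] with [c] between them. *)
Lemma powR_strict_differentiable (p x0 e : R) : 0 < p -> 0 < x0 -> 0 < e ->
  exists2 r, 0 < r &
    (forall s, `|s - x0| < r -> 0 < s /\ `|s `^ (p - 1) - x0 `^ (p - 1)| <= e) /\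
    (forall s t, `|s - x0| < r -> `|t - x0| < r ->
      `|s `^ p - t `^ p - p * x0 `^ (p - 1) * (s - t)| <= p * e * `|s - t|).
Proof.
move=> p0 x00 e0.
have /cvgrPdist_le/(_ _ e0) := @powR_continuous_gt0 (p - 1) x0 x00.
move=> /nbhs_ballP[r' /= r'0 H].
(* The bound [x0] on the radius keeps [s] positive. *)
pose r := Num.min r' x0.
have r0 : 0 < r by rewrite lt_min r'0.
have near s : `|s - x0| < r -> 0 < s /\ `|s `^ (p - 1) - x0 `^ (p - 1)| <= e.
  rewrite lt_min => /andP[sr' sx0]; split.
    by move: sx0; rewrite ltr_distl subrr => /andP[].
  by rewrite distrC; apply: H; rewrite /ball/= distrC.
exists r => //; split => // s t sr tr.
wlog st : s t sr tr / s <= t.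
  move=> W; have [st|/ltW ts] := leP s t; first exact: W.
  have -> : s `^ p - t `^ p - p * x0 `^ (p - 1) * (s - t) =
      - (t `^ p - s `^ p - p * x0 `^ (p - 1) * (t - s)) by ring.
  by rewrite normrN (distrC s t); exact: W.
have [s0 _] := near _ sr.
have [c /andP[sc ct] E] := powR_MVT p s0 st.
have cr : `|c - x0| < r.
  move: sr tr; rewrite !ltr_distl => /andP[sr1 sr2] /andP[tr1 tr2].
  by rewrite (lt_le_trans sr1)// (le_lt_trans ct).
have [_ ce] := near _ cr.
have -> : s `^ p - t `^ p - p * x0 `^ (p - 1) * (s - t) =
    p * (c `^ (p - 1) - x0 `^ (p - 1)) * (s - t).
  by rewrite -(opprB (t `^ p)) E; ring.
by rewrite !normrM (gtr0_norm p0) ler_wpM2r// ler_wpM2l// ltW.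
Qed.

End powR_local.

Section simplex_local.
Context {R : realType} (p : R) (p0 : 0 < p) (n : nat).
Implicit Types x y z : 'rV[R]_n.

Definition simplex_pos : set 'rV[R]_n :=
  simplex p n `&` [set x | forall i, 0 < x 0 i].

(** The gradient of the [p]-norm at points of [simplex_pos] ([gradient_pnorm]). At a zero coordinate
    with [p < 1] the entry is 0 by the convention of [powR]. *)
Definition normal x : 'rV[R]_n := \row_i x 0 i `^ (p - 1).

Lemma exists_common_radius (P : 'I_n -> R -> Prop) :
  (forall i, exists2 r, 0 < r & P i r) ->
  (forall i r s, 0 < s -> s <= r -> P i r -> P i s) ->
  exists2 r, 0 < r & forall i, P i r.
Proof.
move=> H mono.
pose f i := projT1 (cid2 (H i)).
have f0 i : 0 < f i by rewrite /f; case: cid2.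
have fP i : P i (f i) by rewrite /f; case: cid2.
exists (\big[Num.min/1]_i f i).
  by elim/big_ind : _ => // x y x0 y0; rewrite lt_min x0.
move=> i; apply: mono (fP i); last first.
  exact: bigmin_le_cond.
by elim/big_ind : _ => // x y x0 y0; rewrite lt_min x0.
Qed.

Lemma simplex_le1 x i : simplex p n x -> 0 <= x 0 i <= 1.
Proof.
move=> [x0 x1]; rewrite x0/= leNgt; apply/negP => xi1.
have : 1 < x 0 i `^ p.
  have := gt0_ltr_powR p0 _ _ xi1; rewrite !nnegrE powR1; apply => //.
by rewrite ltNge -x1 (bigD1 i)//= lerDl sumr_ge0// => j _; exact: powR_ge0.
Qed.

Lemma pnorm2_simplex_le x : simplex p n x -> pnorm 2 x <= n%:R.
Proof.
move=> Dx; rewrite -[leRHS]mulr1; apply: pnorm2_le_bound => i.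
by have /andP[h0 h1] := simplex_le1 i Dx; rewrite ger0_norm.
Qed.

Lemma rowdot_normal x : simplex_pos x -> rowdot x (normal x) = 1.
Proof.
move=> [[_ <-] xpos]; apply: eq_bigr => i _.
by rewrite mxE mulr_powRB1// ltW.
Qed.

(* On the simplex [sum_i x_i ^ p] is constant, so that the increment of the
   linearized function is of second order. *)
Lemma simplex_flat x0 (e : R) : simplex_pos x0 -> 0 < e ->
  exists2 r, 0 < r & forall x y, simplex p n x -> simplex p n y ->
    (forall i, `|x 0 i - x0 0 i| < r) -> (forall i, `|y 0 i - x0 0 i| < r) ->
    [/\ forall i, 0 < x 0 i,
        forall i, `|normal x 0 i - normal x0 0 i| <= e &
        `|rowdot x (normal x0) - rowdot y (normal x0)| <= n%:R * e * pnorm 2 (x - y)].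
Proof.
move=> [Dx0 x0pos] e0.
have [i|i s t s0 st [H1 H2]|r r0 H] := @exists_common_radius (fun i r =>
    (forall s, `|s - x0 0 i| < r ->
      0 < s /\ `|s `^ (p - 1) - x0 0 i `^ (p - 1)| <= e) /\
    (forall s t, `|s - x0 0 i| < r -> `|t - x0 0 i| < r ->
      `|s `^ p - t `^ p - p * x0 0 i `^ (p - 1) * (s - t)| <= p * e * `|s - t|)).
- exact: powR_strict_differentiable.
- split=> [u ut|u v ut vt].
    by apply: H1; exact: lt_le_trans ut _.
  by apply: H2; [exact: lt_le_trans ut _|exact: lt_le_trans vt _].
exists r => // x y Dx Dy xr yr; split=> [i|i|].
- by have [/(_ _ (xr i))[]] := H i.
- by rewrite !mxE; have [/(_ _ (xr i))[]] := H i.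
rewrite -(ler_pM2l p0) -[p in leLHS]gtr0_norm// -normrM.
have -> : p * (rowdot x (normal x0) - rowdot y (normal x0)) =
    - \sum_i (x 0 i `^ p - y 0 i `^ p
              - p * x0 0 i `^ (p - 1) * (x 0 i - y 0 i)).
  rewrite !sumrB (proj2 Dx) (proj2 Dy) subrr sub0r opprK -sumrB mulr_sumr.
  by apply: eq_bigr => i _; rewrite !mxE; ring.
rewrite normrN (le_trans (ler_norm_sum _ _ _))//.
have -> : p * (n%:R * e * pnorm 2 (x - y)) = \sum_(i < n) p * e * pnorm 2 (x - y).
  by rewrite sumr_const card_ord -[RHS]mulr_natl; ring.
apply: ler_sum => i _; have [_ /(_ _ _ (xr i) (yr i))] := H i.
move/le_trans; apply; rewrite ler_wpM2l ?mulr_ge0 ?(ltW p0) ?(ltW e0)//.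
by have := coord_le_pnorm2 (x - y) i; rewrite !mxE.
Qed.

End simplex_local.

Arguments simplex_pos {R} p {n} _.
Arguments normal {R} p {n} x.

Section radial_projection.
Context {R : realType} (n : nat).
Implicit Types x y w : 'rV[R]_n.

Lemma near1_bounds (a c h : R) : 0 < c <= 1 -> 7 * h <= c -> `|a - 1| <= h ->
  [/\ 0 < a, a <= 1 + c & 1 <= (1 + c) * a].
Proof.
move=> /andP[c0 c1] hc; rewrite ler_distl => /andP[a1 a2].
have a0 : 0 < a by lra.
by split => //; [lra|nra].
Qed.

(** The margin [1 - L^-1] is dictated by the lower bound [N >= W - d >= W / L]; the upper bound asks
    for less, as [1 - L^-1 <= L - 1]. *)
Lemma ratio_bounds (L N W d : R) : 1 < L -> 0 <= W -> d <= (1 - L^-1) * W ->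
  (N <= W + d -> N <= L * W) /\ (W <= N + d -> W <= L * N).
Proof.
move=> L1 W0 dW; have L0 : 0 < L by lra.
have LL : L * L^-1 = 1 by rewrite mulfV// gt_eqF.
have Li : 0 < L^-1 by rewrite invr_gt0.
move: (L^-1) LL Li dW => K LL K0 dW; split=> H.
  have h : 1 - K <= L - 1 by nra.
  by have := ler_wpM2r W0 h; lra.
have : K * W <= N by lra.
by rewrite -(ler_pM2l L0) mulrA LL mul1r.
Qed.

(** Replacing [b] by [a] as the divisor of [y] costs about [|a - b| * |y|], which is at most
    [h * |x - y|]. What remains is division by a number near 1; the 7 is merely large enough for
    both inequalities. *)
Lemma radial_bilipschitz x y (a b c h M : R) :
  0 < c <= 1 -> 7 * h <= c -> `|a - 1| <= h -> `|b - 1| <= h ->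
  `|a - b| * M <= h * pnorm 2 (x - y) -> pnorm 2 y <= M ->
  pnorm 2 (a^-1 *: x - b^-1 *: y) <= (1 + c) * pnorm 2 (x - y) /\
  pnorm 2 (x - y) <= (1 + c) * pnorm 2 (a^-1 *: x - b^-1 *: y).
Proof.
move=> /andP[c0 c1] hc; rewrite !ler_distl => /andP[a1 a2] /andP[b1 b2].
have a0 : 0 < a by lra.
have b0 : 0 < b by lra.
have bh : 0 < b - h by lra.
move=> abM yM.
have an0 : a != 0 by rewrite gt_eqF.
have bn0 : b != 0 by rewrite gt_eqF.
set D := pnorm 2 (_ *: _ - _); set d := pnorm 2 (x - y) in abM *.
have d0 : 0 <= d by exact: pnorm2_ge0.
have D0 : 0 <= D by exact: pnorm2_ge0.
have up : D <= a^-1 * d + `|a - b| * M / (a * b).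
  have -> : D = pnorm 2 (a^-1 *: (x - y) + ((b - a) / (a * b)) *: y).
    congr pnorm; rewrite scalerBr -addrA; congr (_ + _).
    rewrite -!scaleNr -scalerDl; congr (_ *: _); field.
    by rewrite ?an0 ?bn0.
  apply: le_trans (ler_pnorm2D _ _) _.
  rewrite (pnorm2Z _ (x - y)) (pnorm2Z _ y) -/d.
  rewrite (gtr0_norm (_ : 0 < a^-1)) ?invr_gt0// lerD2l.
  rewrite normrM normfV (gtr0_norm (mulr_gt0 a0 b0)) distrC mulrAC.
  rewrite ler_wpM2r ?invr_ge0 ?mulr_ge0 ?(ltW a0) ?(ltW b0)//.
  exact: ler_wpM2l.
have low : d <= a * D + `|a - b| * M / b.
  have -> : d = pnorm 2 (a *: (a^-1 *: x - b^-1 *: y) + ((a - b) / b) *: y).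
    congr pnorm; rewrite scalerBr !scalerA mulfV// scale1r -addrA; congr (_ + _).
    by rewrite -(scaleNr _ y) -scalerDl -scaleN1r; congr (_ *: _); field.
  apply: le_trans (ler_pnorm2D _ _) _.
  rewrite (pnorm2Z a) (pnorm2Z _ y) -/D (gtr0_norm a0) lerD2l.
  rewrite normrM normfV (gtr0_norm b0) mulrAC.
  rewrite ler_wpM2r ?invr_ge0 ?(ltW b0)//.
  exact: ler_wpM2l.
clearbody D d; clear yM; split.
  apply: le_trans up _; apply: (@le_trans _ _ (a^-1 * d + h * d / (a * b))).
    by rewrite lerD2l ler_wpM2r// invr_ge0 mulr_ge0// ltW.
  have -> : a^-1 * d + h * d / (a * b) = (b + h) / (a * b) * d.
    by field; rewrite ?an0 ?bn0.
  rewrite ler_wpM2r// ler_pdivrMr ?mulr_gt0//.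
  (* Indeed [a >= 1 - c / 7], and [(1 + c) (1 - c / 7) >= 1 + 5c / 7] because [c <= 1]. *)
  have e1 : 1 + 5 / 7 * c <= (1 + c) * a by nra.
  have e2 : (1 + 5 / 7 * c) * b <= (1 + c) * a * b by rewrite ler_wpM2r// ltW.
  rewrite mulrA; apply: le_trans e2; nra.
have low' : d * (b - h) <= a * b * D.
  have : d * b <= (a * D + `|a - b| * M / b) * b by rewrite ler_wpM2r// ltW.
  rewrite mulrDl divfK// => H; lra.
rewrite -(ler_pM2r bh); apply: le_trans low' _.
rewrite (mulrAC (1 + c)) ler_wpM2r//.
have e1 : a * b <= (1 + h) * b by rewrite ler_wpM2r// ltW.
apply: le_trans e1 _; nra.
Qed.

Variables (p : R) (p0 : 0 < p).

(** [simplex_flat] is used in two ways: against the base point, where [<x0, w> = 1], it puts [a] and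
    [b] near 1; on the pair [x], [y] it bounds [a - b] by a small multiple of their distance. *)
Lemma simplex_bilipschitz (x0 : 'rV[R]_n) (L : R) : (0 < n)%N ->
  simplex_pos p x0 -> 1 < L <= 2 ->
  exists2 r, 0 < r & forall x y, simplex p n x -> simplex p n y ->
    (forall i, `|x 0 i - x0 0 i| < r) -> (forall i, `|y 0 i - x0 0 i| < r) ->
    let w := normal p x0 in let a := rowdot x w in let b := rowdot y w in
    [/\ forall i, 0 < x 0 i,
        [/\ 0 < a, a <= L & 1 <= L * a],
        pnorm 2 (normal p x) <= L * pnorm 2 w,
        pnorm 2 w <= L * pnorm 2 (normal p x) &
        pnorm 2 (a^-1 *: x - b^-1 *: y) <= L * pnorm 2 (x - y) /\
        pnorm 2 (x - y) <= L * pnorm 2 (a^-1 *: x - b^-1 *: y)].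
Proof.
move=> n0 Dx0 /andP[L1 L2]; pose c := L - 1.
have c0 : 0 < c by rewrite subr_gt0.
have c1 : c <= 1 by rewrite /c; lra.
have nR0 : 0 < n%:R :> R by rewrite ltr0n.
have wpos : 0 < pnorm 2 (normal p x0).
  rewrite (lt_le_trans _ (coord_le_pnorm2 _ (Ordinal n0)))// normr_gt0 mxE.
  by rewrite gt_eqF// powR_gt0//; exact: (proj2 Dx0).
pose W := pnorm 2 (normal p x0).
(* The first entry gives [7h <= c] for [h = n * n * e], one [n] coming from [simplex_flat] and one
   from the bound [n] on the norms; the second is the margin of [ratio_bounds]. *)
pose e := Num.min (c / 7 / (n%:R * n%:R)) ((1 - L^-1) * W / n%:R).
have e0 : 0 < e.
  rewrite lt_min !divr_gt0 ?mulr_gt0//= subr_gt0 invf_lt1//.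
  by rewrite (lt_trans _ L1).
have eh : 7 * (n%:R * n%:R * e) <= c.
  have : e <= c / 7 / (n%:R * n%:R) by rewrite ge_min lexx.
  rewrite ler_pdivlMr ?mulr_gt0// => H; lra.
have eW : n%:R * e <= (1 - L^-1) * W.
  have : e <= (1 - L^-1) * W / n%:R by rewrite ge_min lexx orbT.
  by rewrite ler_pdivlMr ?mulr_gt0// mulrC.
have [r r0 H] := simplex_flat p0 Dx0 e0.
(* A radius at most 1 bounds the distance to [x0] by [n]. *)
pose r' := Num.min r 1.
have r'0 : 0 < r' by rewrite lt_min r0/=.
exists r'; first exact: r'0.
move=> x y Dx Dy xr yr.
have r'r (z : 'rV[R]_n) : (forall i, `|z 0 i - x0 0 i| < r') ->
    (forall i, `|z 0 i - x0 0 i| < r) /\ pnorm 2 (z - x0) <= n%:R.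
  move=> zr; split=> [i|]; first by rewrite (lt_le_trans (zr i))// ge_min lexx.
  rewrite -[leRHS]mulr1; apply: pnorm2_le_bound => i; rewrite !mxE.
  by rewrite (le_trans (ltW (zr i)))// ge_min lexx orbT.
have x0r i : `|x0 0 i - x0 0 i| < r by rewrite subrr normr0.
have [xrr xn] := r'r _ xr; have [yrr yn] := r'r _ yr.
have [xpos xnorm xy] := H _ _ Dx Dy xrr yrr.
have [_ _ xx0] := H _ _ Dx (proj1 Dx0) xrr x0r.
have [_ _ yx0] := H _ _ Dy (proj1 Dx0) yrr x0r.
have w1 := rowdot_normal p0 Dx0; rewrite w1 in xx0 yx0.
have ne0 : 0 <= n%:R * e by rewrite mulr_ge0// ltW.
pose h := n%:R * n%:R * e.
have near1 z : `|rowdot z (normal p x0) - 1| <= n%:R * e * pnorm 2 (z - x0) ->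
    pnorm 2 (z - x0) <= n%:R -> `|rowdot z (normal p x0) - 1| <= h.
  move=> z1 zn; apply: le_trans z1 _.
  by rewrite (_ : h = n%:R * e * n%:R) ?ler_wpM2l// /h; ring.
have a1 := near1 _ xx0 xn; have b1 := near1 _ yx0 yn.
move=> w a b; rewrite -/a in a1 xy; rewrite -/b in b1 xy.
have LE : L = 1 + c by rewrite /c; ring.
have hc : 7 * h <= c by exact: eh.
have nw : pnorm 2 (normal p x - w) <= n%:R * e.
  by apply: pnorm2_le_bound => i; have := xnorm i; rewrite !mxE.
have [ratio1 ratio2] := ratio_bounds (pnorm 2 (normal p x)) L1 (ltW wpos) eW.
have c01 : 0 < c <= 1 by rewrite c0.
have abM : `|a - b| * n%:R <= h * pnorm 2 (x - y).
  have -> : h * pnorm 2 (x - y) = (n%:R * e * pnorm 2 (x - y)) * n%:R.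
    by rewrite /h -!mulrA; congr (_ * _); rewrite mulrCA; congr (_ * _); rewrite mulrC.
  exact: ler_wpM2r.
split.
- exact: xpos.
- by rewrite LE; exact: near1_bounds c01 hc a1.
- apply: ratio1; have -> : normal p x = w + (normal p x - w) by rewrite addrC subrK.
  by apply: le_trans (ler_pnorm2D _ _) _; rewrite lerD2l.
- apply: ratio2; have wE : w = normal p x - (normal p x - w) by rewrite subKr.
  rewrite -/w {1}wE; apply: le_trans (ler_pnorm2D _ _) _.
  by rewrite pnorm2N lerD2l.
rewrite LE; exact: radial_bilipschitz c01 hc a1 b1 abM (pnorm2_simplex_le p0 Dy).
Qed.

End radial_projection.

(** * Cones over small pieces of the simplex *)

Section pcone.
Context {R : realType} (p : R) (p0 : 0 < p) (m : nat).
Local Notation n := m.+1.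
Implicit Types (x y z w : 'rV[R]_n) (A : set 'rV[R]_n).

Lemma pnormZ (t : R) x : pnorm p (t *: x) = `|t| * pnorm p x.
Proof.
rewrite /pnorm; have -> : \sum_j `|(t *: x) 0 j| `^ p =
    `|t| `^ p * \sum_j `|x 0 j| `^ p.
  by rewrite mulr_sumr; apply: eq_bigr => j _; rewrite mxE normrM powRM.
rewrite powRM ?powR_ge0//; last by rewrite sumr_ge0// => *; exact: powR_ge0.
by rewrite -powRrM mulfV ?gt_eqF// powRr1.
Qed.

Lemma pnorm_simplex x : simplex p n x -> pnorm p x = 1.
Proof.
move=> [x0 x1]; rewrite /pnorm (eq_bigr (fun j => x 0 j `^ p)) ?x1 ?powR1//.
by move=> j _; rewrite ger0_norm.
Qed.

Definition pnormalize y : 'rV[R]_n := (pnorm p y)^-1 *: y.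

Lemma measurable_pnormalize : measurable_fun setT pnormalize.
Proof.
apply: measurable_fun_rowvec => i.
have -> : (fun y => pnormalize y 0 i) = (fun y => pnorm p y `^ (- 1) * y 0 i).
  by apply/funext => y; rewrite mxE powR_inv1// powR_ge0.
apply: measurable_funM; last exact: measurable_coord.
apply: (measurableT_comp (measurable_powR (- 1))); exact: measurable_pnorm.
Qed.

Lemma pnormalizeZ (t : R) y : 0 < t -> pnormalize (t *: y) = pnormalize y.
Proof.
move=> t0; rewrite /pnormalize pnormZ gtr0_norm// scalerA invfM.
by rewrite mulrAC mulVf ?mul1r// gt_eqF.
Qed.

Lemma pnormalize_simplex x : simplex p n x -> pnormalize x = x.
Proof. by move=> Dx; rewrite /pnormalize pnorm_simplex// invr1 scale1r. Qed.

Lemma simplex_neq0 x : simplex p n x -> x != 0.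
Proof.
move=> Dx; apply/eqP => x_eq0; have := pnorm_simplex Dx.
rewrite x_eq0 -(scale0r (0 : 'rV_n)) pnormZ normr0 mul0r => /eqP.
by rewrite eq_sym oner_eq0.
Qed.

(** If the norm vanished, [pnormalize y] would be 0 by the convention for [0^-1], and 0 is not on
    the simplex. *)
Lemma pnormalize_simplex_gt0 y : simplex p n (pnormalize y) -> 0 < pnorm p y.
Proof.
move=> /simplex_neq0 H; rewrite lt_neqAle powR_ge0 andbT eq_sym.
by apply: contraNneq H => h; rewrite /pnormalize h invr0 scale0r.
Qed.

(* For [A] in the simplex, the cone [0, 1] . A without its apex. *)
Definition pcone A := [set y | 0 < pnorm p y <= 1 /\ A (pnormalize y)].

Lemma measurable_pcone A : measurable A -> measurable (pcone A).
Proof.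
by move=> mA; have := measurable_cone_preimage (@measurable_pnorm R p n) (@measurable_id _ _ setT) mA.
Qed.

(** The apex belongs to the dilate only when [A] is non-empty, hence two inclusions instead of an
    equality. *)
Lemma pcone_dilate A : A `<=` simplex p n ->
  pcone A `<=` dilate `[0, 1] A /\ dilate `[0, 1] A `<=` pcone A `|` cube 0 0.
Proof.
move=> AD; split=> [y [/andP[y0 y1] Ay]|_ [t t01 [x Ax <-]]].
  exists (pnorm p y); first by rewrite /= in_itv/= y1 ltW.
  exists (pnormalize y) => //.
  by rewrite /pnormalize scalerA mulfV ?gt_eqF// scale1r.
move: t01; rewrite /= in_itv/= => /andP[t0 t1].
move: t0; rewrite le_eqVlt => /predU1P[<-|t0].
  by right=> i; rewrite scale0r subrr normr0.
left; split.
  by rewrite pnormZ (pnorm_simplex (AD _ Ax)) mulr1 gtr0_norm// t0.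
by rewrite pnormalizeZ// pnormalize_simplex//; exact: AD.
Qed.

Lemma measurable_dilate A : measurable A -> A `<=` simplex p n ->
  measurable (dilate `[0, 1] A).
Proof.
move=> mA AD; have [h1 h2] := pcone_dilate AD.
have m0 : measurable (cube (0 : 'rV[R]_n) 0) by exact: measurable_cube.
have [D0|D0] := pselect (dilate `[0, 1] A 0).
  rewrite (_ : dilate _ _ = pcone A `|` cube 0 0).
    by apply: measurableU => //; exact: measurable_pcone.
  apply/seteqP; split => // y [/h1//|y0].
  suff -> : y = 0 by [].
  by apply/rowP => i; apply/eqP; have := y0 i; rewrite mxE subr0 normr_le0.
rewrite (_ : dilate _ _ = pcone A); first exact: measurable_pcone.
apply/seteqP; split => // y Dy; have [//|y0] := h2 _ Dy.
exfalso; apply: D0; suff <- : y = 0 by [].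
by apply/rowP => i; apply/eqP; have := y0 i; rewrite mxE subr0 normr_le0.
Qed.

Local Open Scope ereal_scope.

Lemma lebesgue_rV_pcone A : measurable A -> A `<=` simplex p n ->
  lebesgue_rV (dilate `[0%R, 1%R] A) = lebesgue_rV (pcone A).
Proof.
move=> mA AD; have [h1 h2] := pcone_dilate AD.
have mP := measurable_pcone mA; have mD := measurable_dilate mA AD.
have m0 : measurable (cube (0 : 'rV[R]_n)%R 0%R) by exact: measurable_cube.
apply/eqP; rewrite eq_le; apply/andP; split; last by apply: le_measure; rewrite ?inE.
apply: (@le_trans _ _ (lebesgue_rV (pcone A `|` cube (0 : 'rV[R]_n)%R 0%R))).
  by apply: le_measure; rewrite ?inE//; exact: measurableU.
apply: (le_trans (measureU2 _ mP m0)).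
rewrite -[X in _ + X]/(lebesgue_rV (cube (0 : 'rV[R]_n)%R 0%R)).
by rewrite lebesgue_rV_cube// mul0rn expr0n/= adde0.
Qed.

(** [T] is the value that [hausdorff_raw_hyperplane] would give if [A] lay in the tangent hyperplane
    at [x0]. The exponent [m] is lost between [A] and its radial shadow [B], the exponent [n]
    between the two cones. *)
Lemma hausdorff_pcone_local (x0 : 'rV[R]_n) (L : R) :
  simplex_pos p x0 -> (1 < L <= 2)%R ->
  exists2 r : R, (0 < r)%R & forall A, measurable A -> A `<=` simplex p n ->
    (forall x, A x -> forall i, `|x 0%R i - x0 0%R i| < r)%R ->
    let W := pnorm 2 (normal p x0) in
    let T := hausdorff_raw m (@unit_cube R m) *
             ((n%:R * W)%:E * lebesgue_rV (pcone A)) in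
    [/\ forall x, A x -> (pnorm 2 (normal p x) <= L * W)%R /\
                         (W <= L * pnorm 2 (normal p x))%R,
        hausdorff_raw m A <= (L ^+ (m + n))%:E * T &
        T <= (L ^+ (m + n))%:E * hausdorff_raw m A].
Proof.
move=> Dx0 L12; have [r r0 H] := simplex_bilipschitz p0 (ltn0Sn m) Dx0 L12.
exists r; first exact: r0.
move=> A mA AD Ar.
have L1 : (1 < L)%R by case/andP: L12.
have L0 : (0 < L)%R by exact: lt_trans L1.
pose w := normal p x0.
have {}H x y : A x -> A y -> _ := fun Ax Ay => H x y (AD _ Ax) (AD _ Ay) (Ar _ Ax) (Ar _ Ay).
have Aw x : A x -> [/\ 0 < rowdot x w, rowdot x w <= L & 1 <= L * rowdot x w]%R.
  by move=> Ax; have [] := H _ _ Ax Ax.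
pose proj x := ((rowdot x w)^-1 *: x)%R.
(* The shadow of [A] is written with preimages, which makes its measurability immediate; [projA]
   identifies it with the image. *)
pose B := [set z | rowdot z w = 1%R /\ A (pnormalize z)].
have mrd : measurable_fun setT (rowdot ^~ w).
  by apply: measurable_sum => j; apply: measurable_funM => //; exact: measurable_coord.
have mB : measurable B.
  apply: measurableI.
    exact: (measurable_preimageT mrd (measurable_set1 1%R)).
  exact: measurable_preimageT measurable_pnormalize mA.
have projA : proj @` A = B.
  apply/seteqP; split=> [_ [x Ax <-]|z [zw Az]].
    have [a0 _ _] := Aw _ Ax; split.
      by rewrite /proj rowdotZl mulVf// gt_eqF.
    rewrite /proj pnormalizeZ ?invr_gt0// pnormalize_simplex//.
    exact: AD.
  exists (pnormalize z) => //.
  have N0 := pnormalize_simplex_gt0 (AD _ Az).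
  rewrite /proj /pnormalize rowdotZl zw mulr1 invrK scalerA mulfV ?scale1r//.
  by rewrite gt_eqF.
have HBA : hausdorff_raw m B <= (L ^+ m)%:E * hausdorff_raw m A.
  rewrite -projA; apply: (hausdorff_raw_lipschitz m L0) => x y Ax Ay.
  by have [_ _ _ _ [h _]] := H _ _ Ax Ay; exact: h.
have HAB : hausdorff_raw m A <= (L ^+ m)%:E * hausdorff_raw m B.
  rewrite -projA; apply: (hausdorff_raw_expanding m L0) => x y Ax Ay.
  by have [_ _ _ _ [_ h]] := H _ _ Ax Ay; exact: h.
move=> W T.
have W0 : (0 < W)%R.
  rewrite (lt_le_trans _ (coord_le_pnorm2 _ 0%R))// normr_gt0 mxE.
  by rewrite gt_eqF// powR_gt0//; exact: (proj2 Dx0).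
pose C := [set y | (0 < rowdot y w <= 1)%R /\ A (pnormalize y)].
have mC : measurable C.
  rewrite (_ : C = (rowdot ^~ w) @^-1` `]0%R, 1%R] `&` (pnormalize @^-1` A)).
    apply: measurableI; first exact: measurable_preimageT.
    exact: measurable_preimageT measurable_pnormalize mA.
  by apply/seteqP; split => y; rewrite /= in_itv.
have BC : [set y : 'rV[R]_n | (0 < rowdot y w <= 1)%R /\
    B ((rowdot y w)^-1 *: y)%R] = C.
  apply/seteqP; split=> y [h01]; have /andP[h0 _] := h01.
    by move=> [_]; rewrite pnormalizeZ ?invr_gt0.
  move=> Ay; split=> //; split; first by rewrite rowdotZl mulVf// gt_eqF.
  by rewrite pnormalizeZ ?invr_gt0.
have HB : hausdorff_raw m B = hausdorff_raw m (@unit_cube R m) *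
    ((n%:R * W)%:E * lebesgue_rV C).
  by rewrite (hausdorff_raw_hyperplane W0 mB) ?BC// => x [].
(* On a ray the two gauges [rowdot _ w] and [pnorm p] differ by a factor in [[1 / L, L]], so each
   cone lies in the other one dilated by [L]. *)
have pw y : A (pnormalize y) -> (rowdot y w = pnorm p y * rowdot (pnormalize y) w)%R.
  move=> Ay; have N0 := pnormalize_simplex_gt0 (AD _ Ay).
  by rewrite /pnormalize rowdotZl mulrA mulfV ?mul1r// gt_eqF.
have Li0 : (0 < L^-1)%R by rewrite invr_gt0.
have mP := measurable_pcone mA.
have scale (D : set 'rV[R]_n) : measurable D ->
    lebesgue_rV [set x | D (L^-1 *: x)%R] = (L ^+ n)%:E * lebesgue_rV D.
  by move=> mD; rewrite lebesgue_rV_scale// invrK.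
have mscale (D : set 'rV[R]_n) : measurable D -> measurable [set x | D (L^-1 *: x)%R].
  by move=> mD; exact: measurable_preimageT (measurable_rowvecZ _) mD.
have PC : lebesgue_rV (pcone A) <= (L ^+ n)%:E * lebesgue_rV C.
  rewrite -scale//; apply: le_measure; rewrite ?inE//; first exact: mscale.
  move=> y [/andP[y0 y1] Ay]; have [a0 a1 _] := Aw _ Ay.
  rewrite /C/= rowdotZl pw// pnormalizeZ//; split => //.
  rewrite !mulr_gt0//= ler_pdivrMl// mulr1 -[leRHS]mul1r.
  by apply: ler_pM; [exact: ltW|exact: ltW|exact: y1|exact: a1].
have CP : lebesgue_rV C <= (L ^+ n)%:E * lebesgue_rV (pcone A).
  rewrite -scale//; apply: le_measure; rewrite ?inE//; first exact: mscale.
  move=> y [/andP[y0 y1] Ay]; have [a0 _ a1] := Aw _ Ay.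
  have N0 := pnormalize_simplex_gt0 (AD _ Ay).
  rewrite /pcone/= pnormZ pnormalizeZ// gtr0_norm//; split => //.
  rewrite mulr_gt0//= ler_pdivrMl// mulr1.
  rewrite -(ler_pM2r a0) -pw// (le_trans y1)//.
have TE D : hausdorff_raw m (@unit_cube R m) * ((n%:R * W)%:E * ((L ^+ n)%:E * D))
    = (L ^+ n)%:E * (hausdorff_raw m (@unit_cube R m) * ((n%:R * W)%:E * D)).
  by rewrite (muleCA (n%:R * W)%:E) (muleCA (hausdorff_raw m _)).
have nW0 : 0 <= (n%:R * W)%:E by rewrite lee_fin mulr_ge0// ltW.
have Ln0 k : 0 <= (L ^+ k)%:E by rewrite lee_fin exprn_ge0// ltW.
have Hu0 : 0 <= hausdorff_raw m (@unit_cube R m) by exact: outer_measure_ge0.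
split.
- by move=> x Ax; have [_ _ h1 h2 _] := H _ _ Ax Ax; split; [exact: h1|exact: h2].
- apply: le_trans HAB _; rewrite exprD EFinM -muleA.
  apply: lee_wpmul2l => //; rewrite HB -TE.
  by apply: lee_wpmul2l => //; apply: lee_wpmul2l.
- rewrite addnC exprD EFinM -muleA.
  apply: (@le_trans _ _ ((L ^+ n)%:E * hausdorff_raw m B)); last exact: lee_wpmul2l.
  rewrite HB -TE; apply: lee_wpmul2l => //; exact: lee_wpmul2l.
Qed.

End pcone.

(** * From local to global *)

Section countable_localization.
Context {R : realType} (n : nat).

Definition cell (k : nat) (z : 'I_n -> int) : set 'rV[R]_n :=
  [set y | forall i, (z i)%:~R <= k.+1%:R * y 0 i < (z i + 1)%:~R].

Lemma measurable_cell k z : measurable (cell k z).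
Proof.
rewrite (_ : cell k z = \bigcap_(i in [set: 'I_n])
    (fun y : 'rV[R]_n => k.+1%:R * y 0 i) @^-1` `[(z i)%:~R, (z i + 1)%:~R[).
  apply: fin_bigcap_measurable; first exact: finite_finset.
  move=> i _; apply: measurable_preimageT => //.
  by apply: measurable_funM => //; exact: measurable_coord.
apply/seteqP; split=> [y yz i _|y yz i]; first by rewrite /= in_itv/=; exact: yz.
by have := yz i I; rewrite /= in_itv.
Qed.

Lemma cell_dist k z x y : cell k z x -> cell k z y ->
  forall i, `|x 0 i - y 0 i| < k.+1%:R^-1.
Proof.
move=> xz yz i; have /andP[x1 x2] := xz i; have /andP[y1 y2] := yz i.
have k0 : 0 < k.+1%:R :> R by rewrite ltr0n.
rewrite -(ltr_pM2l k0) mulfV ?gt_eqF// -[X in X * `|_|]gtr0_norm// -normrM.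
move: x2 y2; rewrite intrD mulrBr ltr_distl => x2 y2.
by apply/andP; split; lra.
Qed.

(* The cover consists of the cells of the grids of mesh [1 / (k + 1)] that lie in a
   neighborhood satisfying [P], made disjoint. *)
Lemma countable_localization (D : set 'rV[R]_n) (P : set 'rV[R]_n -> Prop) :
  (forall A B, A `<=` B -> P B -> P A) -> P set0 ->
  (forall x, D x -> exists2 r, 0 < r & P [set y | forall i, `|y 0 i - x 0 i| < r]) ->
  exists E : (set 'rV[R]_n)^nat, [/\ forall k, measurable (E k), forall k, P (E k),
    trivIset setT E & D `<=` \bigcup_k E k].
Proof.
move=> mono P0 H.
pose T : countType := (nat * {ffun 'I_n -> int})%type.
pose F (t : T) := if pselect (P (cell t.1 t.2)) then cell t.1 t.2 else set0.
pose E k := if unpickle k is Some t then F t else set0.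
have mF t : measurable (F t).
  rewrite /F; case: pselect => h; last exact: measurable0.
  exact: (measurable_cell t.1 t.2).
have PF t : P (F t) by rewrite /F; case: pselect.
have mE k : measurable (E k) by rewrite /E; case: unpickle.
have PE k : P (E k) by rewrite /E; case: unpickle.
exists (seqDU E); split.
- move=> k; apply: measurableD => //.
  by apply: bigsetU_measurable => i _; exact: mE.
- by move=> k; apply: mono (PE k); exact: subset_seqDU.
- exact: trivIset_seqDU.
rewrite -seqDU_bigcup_eq => x Dx; have [r r0 Pr] := H x Dx.
pose k := Num.truncn r^-1.
have kr : k.+1%:R^-1 <= r.
  by rewrite invf_ple ?posrE// ltW// truncnS_gt.
pose z : {ffun 'I_n -> int} := [ffun i => Num.floor (k.+1%:R * x 0 i)].
have xz : cell k z x by move=> i; rewrite ffunE; exact: floor_itv.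
have Pz : P (cell k z).
  apply: mono Pr => y yz i; exact: lt_le_trans (cell_dist yz xz i) kr.
exists (pickle ((k, z) : T)) => //.
by rewrite /E pickleK /F; case: pselect.
Qed.

End countable_localization.

Section cone_base.
Context {R : realType} (p : R) (p0 : 0 < p) (m : nat).
Local Notation n := m.+1.
Implicit Types (x y : 'rV[R]_n) (A : set 'rV[R]_n).
Local Open Scope ereal_scope.

Lemma pcone_simplex_fin : lebesgue_rV (pcone p (simplex p n)) < +oo.
Proof.
have mP : measurable (pcone p (simplex p n : set 'rV[R]_n)).
  by apply: measurable_pcone; exact: measurable_simplex.
apply: (@le_lt_trans _ _ (lebesgue_rV (cube (0 : 'rV[R]_n)%R 1%R))).
  apply: le_measure; rewrite ?inE//; first exact: measurable_cube.
  move=> y [/andP[N0 N1] Dy] i; rewrite mxE subr0.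
  have -> : y = (pnorm p y *: pnormalize p y)%R.
    by rewrite /pnormalize scalerA mulfV ?scale1r// gt_eqF.
  have /andP[h0 h1] := simplex_le1 p0 i Dy.
  rewrite mxE normrM (gtr0_norm N0) (ger0_norm h0) -[leRHS]mulr1.
  by apply: ler_pM => //; exact: ltW.
by rewrite lebesgue_rV_cube// ltry.
Qed.

Lemma pcone_simplex_gt0 : 0 < lebesgue_rV (pcone p (simplex p n)).
Proof.
(* Since [c ^ p = 1 / n], a vector with all coordinates in []0, c]] has [p]-norm at most 1; the cube
   [Q] consists of such vectors. *)
pose c := ((n%:R^-1) `^ p^-1)%R.
have c0 : (0 < c)%R by rewrite powR_gt0// invr_gt0 ltr0n.
pose Q := cube (const_mx (c / 2)%R : 'rV[R]_n) (c / 4)%R.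
apply: (@lt_le_trans _ _ (lebesgue_rV Q)).
  by rewrite lebesgue_rV_cube ?divr_ge0 ?(ltW c0)// lte_fin exprn_gt0// mulrn_wgt0// divr_gt0.
apply: le_measure; rewrite ?inE; first exact: measurable_cube.
  by apply: measurable_pcone; exact: measurable_simplex.
move=> y yc; have yb i : (0 < y 0 i <= c)%R.
  by have := yc i; rewrite mxE ler_distl => /andP[h1 h2]; apply/andP; split; lra.
have y0 i : (0 <= y 0 i)%R by have /andP[/ltW] := yb i.
have SE : (\sum_j `|y 0 j| `^ p = \sum_j y 0 j `^ p)%R.
  by apply: eq_bigr => j _; rewrite ger0_norm.
have S0 : (0 < \sum_j y 0 j `^ p)%R.
  rewrite (bigD1 ord0)//= ltr_pwDl ?powR_gt0//; first by have /andP[] := yb ord0.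
  by rewrite sumr_ge0// => *; exact: powR_ge0.
have N0 : (0 < pnorm p y)%R by rewrite /pnorm SE powR_gt0.
have S1 : (\sum_j y 0 j `^ p <= 1)%R.
  have -> : (1 = \sum_(j < n) n%:R^-1 :> R)%R.
    by rewrite sumr_const card_ord -[RHS]mulr_natr mulVf// pnatr_eq0.
  apply: ler_sum => j _; have /andP[_ yjc] := yb j.
  have -> : (n%:R^-1 = c `^ p :> R)%R.
    by rewrite /c -powRrM mulVf ?gt_eqF// powRr1// invr_ge0.
  by apply: ge0_ler_powR; rewrite ?nnegrE ?(ltW p0) ?(ltW c0).
split.
  rewrite N0/= /pnorm SE.
  have := @ge0_ler_powR R p^-1 _ _ 1%R; rewrite powR1 => /(_ _ (\sum_j y 0 j `^ p)%R).
  by apply => //; rewrite ?invr_ge0 ?nnegrE ?(ltW p0) ?(ltW S0).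
split=> [i|]; first by rewrite mxE mulr_ge0// invr_ge0 ltW.
under eq_bigr => i _ do rewrite mxE (powRM _ _ (y0 i)) ?invr_ge0 ?(ltW N0)//.
rewrite -mulr_sumr -powR_inv1 ?(ltW N0)// powRAC powR_inv1 ?powR_ge0//.
rewrite /pnorm SE -powRrM mulVf ?gt_eqF// powRr1 ?(ltW S0)//.
by rewrite mulVf// gt_eqF.
Qed.

End cone_base.

(** * Hausdorff measure in the interior as an integral of the density *)

Section cone_density_formula.
Context {R : realType} (p : R) (p0 : 0 < p) (m : nat).
Local Notation n := m.+1.
Implicit Types (x y : 'rV[R]_n) (A : set 'rV[R]_n).
Local Open Scope ereal_scope.

(** By convexity the power lies below its chord [1 + (2 ^ k - 1) * e] on [[0, 1]]; it is this
    sharper form that the induction carries. *)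
Lemma expr_le_affine (e : R) k : (0 <= e <= 1 -> (1 + e) ^+ k <= 1 + 2 ^+ k * e)%R.
Proof.
move=> /andP[e0 e1].
suff : ((1 + e) ^+ k <= 1 + (2 ^+ k - 1) * e)%R by move=> h; lra.
have : (1 <= 2 ^+ k :> R)%R by rewrite exprn_ege1// ler1n.
elim: k => [|k ih]; first by rewrite !expr0; lra.
rewrite ![(_ ^+ k.+1)%R]exprS => _.
have k1 : (1 <= 2 ^+ k :> R)%R by rewrite exprn_ege1// ler1n.
have {}ih := ih k1.
move: ((1 + e) ^+ k)%R (2 ^+ k)%R ih k1 => a b ih k1.
have : ((1 + e) * a <= (1 + e) * (1 + (b - 1) * e))%R.
  by rewrite ler_wpM2l// addr_ge0.
move/le_trans; apply.
have : ((b - 1) * (e * e) <= (b - 1) * e)%R.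
  by rewrite ler_wpM2l ?subr_ge0// ler_piMr.
by move=> h; lra.
Qed.

Lemma lee_scaled_limit (x y : \bar R) k : 0 <= x -> 0 <= y ->
  (forall L : R, (1 < L <= 2)%R -> x <= (L ^+ k)%:E * y) -> x <= y.
Proof.
move=> x0 y0 H; have [->|yoo] := eqVneq y +oo; first by rewrite leey.
have yfin : y \is a fin_num by rewrite ge0_fin_numE// ltey.
apply/lee_addgt0Pr => d d0.
(* With [e <= d / C] the excess [2 ^ k * e * y] is at most [d]; the summand [d] keeps [C] positive
   when [y = 0]. *)
pose C := (2 ^+ k * fine y + d)%R.
have fy0 : (0 <= fine y)%R by rewrite fine_ge0.
have C0 : (0 < C)%R by rewrite ltr_wpDl// mulr_ge0// exprn_ge0.
pose e := Num.min 1%R (d / C)%R.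
have e0 : (0 < e)%R by rewrite lt_min ltr01/= divr_gt0.
have e1 : (e <= 1)%R by rewrite ge_min lexx.
have eC : (e * C <= d)%R by rewrite -ler_pdivlMr// ge_min lexx orbT.
have L12 : (1 < 1 + e <= 2)%R by lra.
apply: le_trans (H _ L12) _; rewrite -(fineK yfin) -EFinM -EFinD lee_fin.
have e01 : (0 <= e <= 1)%R by rewrite (ltW e0).
have := ler_wpM2r fy0 (expr_le_affine k e01).
move/le_trans; apply; rewrite mulrDl mul1r lerD2l (le_trans _ eC)//.
rewrite mulrAC mulrC ler_wpM2l ?(ltW e0)// lerDl ltW//.
Qed.

Lemma cone_density_pnorm2 x : cone_density p x = pnorm 2 (normal p x).
Proof.
rewrite pnorm2E; congr Num.sqrt; apply: eq_bigr => i _.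
rewrite mxE -powR_mulrn ?powR_ge0// -powRrM; congr (_ `^ _)%R; ring.
Qed.

Lemma cone_density_ge0 x : (0 <= cone_density p x)%R.
Proof. exact: sqrtr_ge0. Qed.

Lemma measurable_cone_density : measurable_fun setT (@cone_density R p n).
Proof.
have -> : @cone_density R p n = pnorm 2 \o (fun x : 'rV[R]_n => normal p x).
  by apply/funext => x; exact: cone_density_pnorm2.
apply: measurableT_comp; first exact: measurable_pnorm.
apply: measurable_fun_rowvec => i; under eq_fun do rewrite mxE.
exact: (measurableT_comp (measurable_powR _) (measurable_coord i)).
Qed.

Notation cm := (cone_measure p0 n).
Notation K := (lebesgue_rV (pcone p (simplex p n : set 'rV[R]_n))).

Lemma cone_measure_pcone A : measurable A -> A `<=` simplex p n ->
  lebesgue_rV (pcone p A) = cm A * K.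
Proof.
move=> mA AD; rewrite /cone_measure (setIidl AD) (lebesgue_rV_pcone p0 mA AD).
rewrite (lebesgue_rV_pcone p0 (@measurable_simplex R p n) (@subset_refl _ _)).
have K0 := pcone_simplex_gt0 p0 m; have Kfin := pcone_simplex_fin p0 m.
have Kf : K \is a fin_num by rewrite ge0_fin_numE// ltW.
rewrite -muleA [_^-1 * _]muleC divee ?mule1//.
by rewrite gt_eqF.
Qed.

Local Notation T := (hausdorff_raw m (@unit_cube R m) * (n%:R%:E * K)).

Lemma cone_constant_gt0 : exists2 t : R, (0 < t)%R & T = t%:E.
Proof.
have K0 := pcone_simplex_gt0 p0 m; have Kfin := pcone_simplex_fin p0 m.
have H0 := @hausdorff_raw_unit_cube_gt0 R m; have Hfin := @hausdorff_raw_unit_cube_fin R m.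
have Kf : K \is a fin_num by rewrite ge0_fin_numE// ltW.
have Hf : hausdorff_raw m (@unit_cube R m) \is a fin_num by rewrite ge0_fin_numE// ltW.
pose t := T; exists (fine t); last by rewrite fineK// !fin_numM.
rewrite fine_gt0// -ge0_fin_numE ?fin_numM// ?andbT; first by rewrite !mule_gt0// lte_fin ltr0n.
by rewrite ltW// !mule_gt0// lte_fin ltr0n.
Qed.

(** Quantifying over all Borel pieces of [E] makes the property pass to subsets, as
    [countable_localization] requires. *)
Definition comparable_on (c : R) (E : set 'rV[R]_n) := forall A, measurable A ->
  A `<=` simplex_pos p -> A `<=` E ->
  hausdorff_raw m A <= c%:E * (T * \int[cm]_(x in A) (cone_density p x)%:E) /\
  T * \int[cm]_(x in A) (cone_density p x)%:E <= c%:E * hausdorff_raw m A.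

(** The exponent is one more than in [hausdorff_pcone_local]: a further [L] pays for replacing the
    density on the piece by its value at [x0]. *)
Lemma comparable_local (x0 : 'rV[R]_n) (L : R) :
  simplex_pos p x0 -> (1 < L <= 2)%R ->
  exists2 r : R, (0 < r)%R &
    comparable_on (L ^+ (m + n).+1) [set y | forall i, (`|y 0 i - x0 0 i| < r)%R].
Proof.
move=> Dx0 L12; have [r r0 H] := hausdorff_pcone_local p0 Dx0 L12.
exists r; first exact: r0.
move=> A mA AP Ar; have AD : A `<=` simplex p n by move=> x /AP[].
have {H}[Wb HT TH] := H A mA AD Ar.
set W := pnorm 2 (normal p x0) in Wb HT TH.
have W0 : (0 <= W)%R by exact: pnorm2_ge0.
have [t t0 TE] := cone_constant_gt0.
have L0 : (0 < L)%R by case/andP: L12 => L1 _; exact: lt_trans L1.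
have EQ : hausdorff_raw m (@unit_cube R m) * ((n%:R * W)%:E * lebesgue_rV (pcone p A))
    = T * (W%:E * cm A).
  rewrite cone_measure_pcone// /T EFinM.
  by rewrite -[RHS]muleA (muleACA n%:R%:E K) (muleC K).
rewrite EQ in HT TH.
have mg : measurable_fun A (fun x => (cone_density p x)%:E).
  by apply/measurable_EFinP/measurable_funTS; exact: measurable_cone_density.
have mgL : measurable_fun A (fun x => (L * cone_density p x)%:E).
  apply/measurable_EFinP/measurable_funM => //.
  by apply: measurable_funTS; exact: measurable_cone_density.
set I := \int[cm]_(x in A) _.
have WI : W%:E * cm A <= L%:E * I.
  rewrite -integral_cst// -ge0_integralZl//; last 2 first.
  - by move=> x _; rewrite lee_fin cone_density_ge0.
  - by rewrite lee_fin ltW.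
  apply: ge0_le_integral => //.
  - by move=> x Ax; have [_ h] := Wb _ Ax; rewrite -EFinM lee_fin cone_density_pnorm2; exact: h.
have IW : I <= L%:E * (W%:E * cm A).
  rewrite muleA -EFinM -integral_cst//; apply: ge0_le_integral => //.
  - by move=> x _; rewrite lee_fin cone_density_ge0.
  - by move=> x Ax; have [h _] := Wb _ Ax; rewrite lee_fin cone_density_pnorm2; exact: h.
have Lk0 : 0 <= (L ^+ (m + n))%:E by rewrite lee_fin exprn_ge0// ltW.
have T0 : 0 <= T by rewrite TE lee_fin ltW.
have pow_split (X : \bar R) : (L ^+ (m + n).+1)%:E * X = (L ^+ (m + n))%:E * (L%:E * X).
  by rewrite exprSr EFinM muleA.
split.
- apply: le_trans HT _; rewrite pow_split; apply: lee_wpmul2l; first exact: Lk0.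
  by rewrite (muleCA L%:E T); apply: lee_wpmul2l.
- apply: (@le_trans _ _ (L%:E * (T * (W%:E * cm A)))).
    by rewrite (muleCA L%:E T); apply: lee_wpmul2l.
  rewrite pow_split (muleCA (L ^+ (m + n))%:E L%:E).
  apply: lee_wpmul2l; first by rewrite lee_fin ltW.
  exact: TH.
Qed.

(** The constant is the same on every piece, so it factors out of the countable sums to which both
    sides are additive. *)
Lemma comparable_global (L : R) : (1 < L <= 2)%R ->
  comparable_on (L ^+ (m + n).+1) setT.
Proof.
move=> L12; set c := (L ^+ (m + n).+1)%R.
have c0 : (0 <= c)%R.
  by apply: exprn_ge0; case/andP: L12 => /ltW L1 _; exact: le_trans L1.
have [t t0 TE] := cone_constant_gt0.
have [E [mE PE tE DE]] : exists E : (set 'rV[R]_n)^nat, [/\ forall k, measurable (E k),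
    forall k, comparable_on c (E k), trivIset setT E & simplex_pos p `<=` \bigcup_k E k].
  apply: countable_localization.
  - by move=> A B AB PB C mC CP CA; apply: PB => // x /CA /AB.
  - move=> A mA AP; rewrite subset0 => ->.
    by rewrite integral_set0 outer_measure0 !mule0.
  - by move=> x Dx; exact: comparable_local.
move=> A mA AP _.
have mAE k : measurable (A `&` E k) by exact: measurableI.
have tAE : trivIset setT (fun k => A `&` E k) by exact: trivIset_setIl.
have AE : A = \bigcup_k (A `&` E k).
  apply/seteqP; split=> [x Ax|x [k _ []]//].
  by have [k _ Ex] := DE x (AP _ Ax); exists k.
have HA : hausdorff_raw m A = \sum_(k <oo) hausdorff_raw m (A `&` E k).
  rewrite {1}AE.
  have := @measure_semi_bigcup _ _ _ (@hausdorff_borel R m n) (fun k => A `&` E k).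
  by apply => //; exact: bigcupT_measurable.
have IA : \int[cm]_(x in A) (cone_density p x)%:E =
    \sum_(k <oo) \int[cm]_(x in A `&` E k) (cone_density p x)%:E.
  rewrite {1}AE ge0_integral_bigcup//.
  - by apply/measurable_EFinP/measurable_funTS; exact: measurable_cone_density.
  - by move=> x _; rewrite lee_fin cone_density_ge0.
have I0 k : 0 <= \int[cm]_(x in A `&` E k) (cone_density p x)%:E.
  by apply: integral_ge0 => x _; rewrite lee_fin cone_density_ge0.
have H0 k : 0 <= hausdorff_raw m (A `&` E k) by exact: outer_measure_ge0.
have PA k := PE k _ (mAE k) (fun x (h : (A `&` E k) x) => AP x (proj1 h)) (@subIsetr _ _ _).
rewrite HA IA TE -!nneseriesZl//; last by move=> k _; rewrite mule_ge0// lee_fin ltW.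
split; apply: lee_nneseries => [k _ _|k _] //.
- by have [] := PA k; rewrite TE.
- by rewrite mule_ge0// lee_fin ltW.
- by have [] := PA k; rewrite TE.
Qed.

Lemma hausdorff_raw_cone_density A : measurable A -> A `<=` simplex_pos p ->
  hausdorff_raw m A = T * \int[cm]_(x in A) (cone_density p x)%:E.
Proof.
move=> mA AP; have [t t0 TE] := cone_constant_gt0.
have TI0 : 0 <= T * \int[cm]_(x in A) (cone_density p x)%:E.
  rewrite TE; apply: mule_ge0; first by rewrite lee_fin ltW.
  by apply: integral_ge0 => x _; rewrite lee_fin cone_density_ge0.
have H0 : 0 <= hausdorff_raw m A by exact: outer_measure_ge0.
apply/eqP; rewrite eq_le; apply/andP; split;
  apply: (@lee_scaled_limit _ _ (m + n).+1) => // L L12;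
  by have [] := comparable_global L12 mA AP (@subsetT _ _).
Qed.

End cone_density_formula.

(** * The simplex and its boundary *)

Section simplex_measure.
Context {R : realType} (p : R) (p0 : 0 < p).
Local Open Scope ereal_scope.

(** Otherwise [x] would exceed [y] in every coordinate, and so would its sum of [p]-th powers, which
    is 1 for both. *)
Lemma simplex_exists_le n (x y : 'rV[R]_n) : (0 < n)%N ->
  simplex p n x -> simplex p n y -> exists i, (x 0%R i <= y 0%R i)%R.
Proof.
move=> n0 [x0 xp] [y0 yp]; apply: contrapT => H.
have yx i : (y 0 i < x 0 i)%R by rewrite ltNge; apply/negP => h; apply: H; exists i.
have : (\sum_j y 0 j `^ p < \sum_j x 0 j `^ p)%R.
  apply: ltr_sum; first by apply/hasP; exists (Ordinal n0); rewrite ?mem_index_enum.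
  by move=> i _; apply: gt0_ltr_powR; rewrite ?nnegrE.
by rewrite xp yp ltxx.
Qed.

(* On the simplex, [x - y] is neither positive nor negative in all coordinates, so
   that it is controlled by the differences of its coordinates. *)
Lemma hausdorff_raw_simplex_fin m :
  hausdorff_raw m (simplex p m.+1 : set 'rV[R]_m.+1) < +oo.
Proof.
pose q (x : 'rV[R]_m.+1) : 'rV[R]_m := (\row_j (x 0 (lift ord0 j) - x 0 0))%R.
pose L : R := (m.+1%:R * 2)%R.
have L0 : (0 < L)%R by rewrite mulr_gt0// ltr0n.
have qL x y : simplex p m.+1 x -> simplex p m.+1 y ->
    (pnorm 2 (x - y) <= L * pnorm 2 (q x - q y))%R.
  move=> Dx Dy.
  have D0 := pnorm2_ge0 (q x - q y)%R.
  have qD j : (`|(x 0 (lift ord0 j) - y 0 (lift ord0 j)) - (x 0 0 - y 0 0)|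
      <= pnorm 2 (q x - q y))%R.
    apply: le_trans (coord_le_pnorm2 (q x - q y)%R j).
    by rewrite !mxE le_eqVlt; apply/orP; left; apply/eqP; congr (`| _ |)%R; ring.
  rewrite /L -mulrA; move: (pnorm 2 (q x - q y)) D0 qD => D D0 qD.
  have qD' i : (`|(x 0 i - y 0 i) - (x 0 0 - y 0 0)| <= D)%R.
    case: (unliftP ord0 i) => [j ->|->]; first exact: qD.
    by rewrite subrr normr0.
  (* The index [i] bounds [x_0 - y_0] above by [D] and [j] bounds it below by [-D]; every coordinate
     difference is then at most [2D], whence [L]. *)
  have [i xyi] := simplex_exists_le (ltn0Sn m) Dx Dy.
  have [j xyj] := simplex_exists_le (ltn0Sn m) Dy Dx.
  apply: pnorm2_le_bound => k; rewrite !mxE.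
  move: (qD' i) (qD' j) (qD' k); rewrite !ler_norml.
  move=> /andP[i1 i2] /andP[j1 j2] /andP[k1 k2].
  by apply/andP; split; lra.
apply: le_lt_trans (hausdorff_raw_expanding m L0 qL) _.
apply: lte_mul_pinfty; [by rewrite lee_fin exprn_ge0// ltW|by []|].
apply: (@le_lt_trans _ _ (hausdorff_raw m (cube (0 : 'rV[R]_m)%R 1%R))).
  apply: le_outer_measure => _ [x Dx <-] j; rewrite !mxE subr0.
  have /andP[a0 a1] := simplex_le1 p0 (lift ord0 j) Dx.
  have /andP[b0 b1] := simplex_le1 p0 ord0 Dx.
  by rewrite ler_norml; apply/andP; split; lra.
exact: hausdorff_raw_cube_fin.
Qed.

(** A line parallel to the first axis meets the simplex in at most one point, because [t ^ p] is
    injective for [t >= 0]. *)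
Lemma lebesgue_rV_simplex m : lebesgue_rV (simplex p m.+1 : set 'rV[R]_m.+1) = 0.
Proof.
have mD := @measurable_simplex R p m.+1.
rewrite lebesgue_rVSE product_measureE2; last first.
  exact: measurable_preimageT measurable_row_cons mD.
apply: integral0_eq => v _.
set S := ysection _ _.
have Suniq s t : S s -> S t -> s = t.
  rewrite /S /ysection/= !inE/= => -[s0 sp] [t0 tp].
  have {}s0 := s0 0%R; have {}t0 := t0 0%R.
  move: sp tp s0 t0; rewrite !big_ord_recl !row_cons0/= => <- + s0 t0.
  under eq_bigr do rewrite row_consS; under [in X in _ = X]eq_bigr do rewrite row_consS.
  by move/addIr => ts; apply/esym/(powR_injective p0); rewrite ?nnegrE.
have mS : measurable (S : set (measurableTypeR R)).
  by apply: measurable_ysection; exact: measurable_preimageT measurable_row_cons mD.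
have [->|/set0P[s Ss]] := eqVneq S set0; first by rewrite measure0.
have -> : S = [set s] by apply/seteqP; split=> [t St|_ ->//]; exact: Suniq.
exact: lebesgue_measure_set1.
Qed.

(** Inserting a zero coordinate is an isometry from the simplex of one dimension less onto the face.
    In that space this Hausdorff measure is a multiple of Lebesgue measure, for which the simplex is
    null. *)
Lemma hausdorff_raw_face m (i : 'I_m.+2) :
  hausdorff_raw m.+1 (simplex p m.+2 `&` [set x : 'rV[R]_m.+2 | x 0%R i = 0%R]) = 0.
Proof.
pose ins (v : 'rV[R]_m.+1) : 'rV[R]_m.+2 :=
  (\row_k if unlift i k is Some j then v 0 j else 0)%R.
have insi v : ins v 0%R i = 0%R by rewrite mxE unlift_none.
have insl v j : ins v 0%R (lift i j) = v 0%R j by rewrite mxE liftK.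
have ins_isom v w : pnorm 2 (ins v - ins w)%R = pnorm 2 (v - w)%R.
  have E k : ((ins v - ins w) 0 k = ins v 0 k - ins w 0 k)%R.
    by rewrite mxE [X in (_ + X)%R]mxE.
  rewrite !pnorm2E (bigD1_ord i)//= E !insi subrr expr0n/= add0r.
  by congr Num.sqrt; apply: eq_bigr => j _; rewrite E !insl !mxE.
rewrite (_ : _ `&` _ = ins @` simplex p m.+1).
  rewrite hausdorff_raw_isometry// hausdorff_raw_lebesgue; last exact: measurable_simplex.
  by rewrite lebesgue_rV_simplex mule0.
apply/seteqP; split=> [x [[x0 xp] xi]|_ [v [v0 vp] <-]].
  exists (\row_j x 0 (lift i j))%R.
    split=> [j|]; first by rewrite mxE.
    rewrite -xp (bigD1_ord i)//= xi powR0 ?gt_eqF// add0r.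
    by apply: eq_bigr => j _; rewrite mxE.
  apply/rowP => k; case: (unliftP i k) => [j ->|->].
    by rewrite insl mxE.
  by rewrite insi xi.
split; last exact: insi.
split=> [k|].
  by case: (unliftP i k) => [j ->|->]; rewrite ?insl ?insi.
rewrite -vp (bigD1_ord i)//= insi powR0 ?gt_eqF// add0r.
by apply: eq_bigr => j _; rewrite insl.
Qed.

(** The finitely many faces are indexed by all naturals, with empty terms from [n] on, to suit
    countable subadditivity. *)
Lemma simplex_boundary n : (simplex p n : set 'rV[R]_n) `\` simplex_pos p `<=`
  \bigcup_(k in [set: nat]) \bigcup_(i in [set i : 'I_n | i = k :> nat])
    (simplex p n `&` [set x | x 0%R i = 0%R]).
Proof.
move=> x [Dx Px]; have [i xi] : exists i, x 0%R i = 0%R.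
  apply: contrapT => H; apply: Px; split=> // i.
  rewrite lt_neqAle (proj1 Dx) andbT eq_sym; apply/eqP => h; apply: H; by exists i.
by exists i => //; exists i.
Qed.

Lemma measurable_face n (i : 'I_n) :
  measurable (simplex p n `&` [set x : 'rV[R]_n | x 0%R i = 0%R]).
Proof.
apply: measurableI; first exact: measurable_simplex.
exact: measurable_preimageT (measurable_coord i) (measurable_set1 0%R).
Qed.

Lemma measurable_simplex_pos n : measurable (simplex_pos p : set 'rV[R]_n).
Proof.
apply: measurableI; first exact: measurable_simplex.
rewrite (_ : (fun _ => _) = \bigcap_(i in [set: 'I_n])
    (fun x : 'rV[R]_n => x 0%R i) @^-1` `]0%R, +oo[).
  apply: fin_bigcap_measurable; first exact: finite_finset.
  by move=> i _; apply: measurable_preimageT => //; exact: measurable_coord.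
apply/seteqP; split=> [x h i _|x h i].
  by rewrite /= in_itv/= andbT; exact: h.
by have := h i I; rewrite /= in_itv/= andbT.
Qed.

Lemma measure_simplex_boundary n (mu : {measure set 'rV[R]_n -> \bar R}) :
  (forall i, mu (simplex p n `&` [set x : 'rV[R]_n | x 0%R i = 0%R]) = 0) ->
  mu (simplex p n `\` simplex_pos p) = 0.
Proof.
move=> H; apply/eqP; rewrite eq_le measure_ge0 andbT.
pose F k := \bigcup_(i in [set i : 'I_n | i = k :> nat])
    (simplex p n `&` [set x : 'rV[R]_n | x 0%R i = 0%R]).
have F_cases k : F k = set0 \/
    exists i, F k = simplex p n `&` [set x : 'rV[R]_n | x 0%R i = 0%R].
  have [kn|nk] := ltnP k n; last first.
    left; rewrite -subset0 => x [i /= ik _].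
    by have := ltn_ord i; rewrite ik ltnNge nk.
  right; exists (Ordinal kn); apply/seteqP; split=> [x [i /= ik]|x h].
    by have -> : i = Ordinal kn by exact/val_inj.
  by exists (Ordinal kn).
have mF k : measurable (F k).
  by have [->|[i ->]] := F_cases k; [exact: measurable0|exact: measurable_face].
have F0 k : mu (F k) = 0.
  by have [->|[i ->]] := F_cases k; [exact: measure0|exact: H].
apply: (@le_trans _ _ (\sum_(k <oo) mu (F k))).
  apply: measure_sigma_subadditive => //; last exact: simplex_boundary.
  by apply: measurableD; [exact: measurable_simplex|exact: measurable_simplex_pos].
by rewrite eseries0.
Qed.

End simplex_measure.

(** * The density *)

Section gradient_pnorm.
Context {R : realType} (p : R) (p0 : 0 < p).

Lemma is_derive_powR_normr (t : R) : 0 < t ->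
  is_derive t (1 : R) (fun s : R => `|s| `^ p) (p * t `^ (p - 1)).
Proof.
move=> t0; apply: near_eq_is_derive (is_derive1_powR p t0).
near=> s; rewrite gtr0_norm//; near: s; exact: lt_nbhsr.
Unshelve. all: by end_near. Qed.

Lemma differentiable_pnorm n (x : 'rV[R]_n) : simplex_pos p x ->
  differentiable (pnorm p : 'rV[R]_n -> R) x.
Proof.
move=> [Dx xpos].
have -> : (pnorm p : 'rV[R]_n -> R) = (@powR R ^~ p^-1) \o
    (\sum_(j < n) (fun y : 'rV[R]_n => `|y 0 j| `^ p)).
  by apply/funext => y; rewrite /pnorm /= fct_sumE.
have S1 : (\sum_(j < n) (fun y : 'rV[R]_n => `|y 0 j| `^ p)) x = 1.
  rewrite fct_sumE -(proj2 Dx); apply: eq_bigr => j _.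
  by rewrite ger0_norm// ltW.
apply: differentiable_comp.
  apply: differentiable_sum => j.
  apply: (@differentiable_comp _ _ _ _ (fun y : 'rV[R]_n => y 0 j) (fun s : R => `|s| `^ p)).
    exact: differentiable_coord.
  by apply/derivable1_diffP; have [] := is_derive_powR_normr (xpos j).
by rewrite S1; apply/derivable1_diffP; have [] := is_derive1_powR p^-1 (@ltr01 R).
Qed.

(** Along a basis vector the norm is the one-variable function [G]. Its outer power is
    differentiated where the sum of [p]-th powers is 1, so only the factors [p^-1] and [p] remain,
    and they cancel. *)
Lemma gradient_pnorm n (x : 'rV[R]_n) : simplex_pos p x ->
  gradient (pnorm p) x = normal p x.
Proof.
move=> Px; have [Dx xpos] := Px; apply/rowP => i; rewrite !mxE.
rewrite -(deriveE _ (differentiable_pnorm Px)).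
pose c := \sum_(j < n | j != i) x 0 j `^ p.
pose G (s : R) := (`|s| `^ p + c) `^ p^-1.
have fG h : pnorm p (h *: delta_mx 0 i + x) = G (h + x 0 i).
  have ei : (h *: delta_mx 0 i + x) 0 i = h + x 0 i by rewrite !mxE !eqxx mulr1.
  have ej j : j != i -> (h *: delta_mx 0 i + x) 0 j = x 0 j.
    by move=> ji; rewrite !mxE (negbTE ji) andbF mulr0 add0r.
  rewrite /pnorm /G (bigD1 i isT) ei; congr ((_ + _) `^ _).
  by apply: eq_bigr => j ji; rewrite ej// ger0_norm// ltW.
have fx : pnorm p x = G (x 0 i).
  by rewrite -[x in LHS]add0r -(scale0r (delta_mx 0 i)) fG add0r.
have -> : 'D_(delta_mx 0 i) (pnorm p) x = 'D_1 G (x 0 i).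
  rewrite /derive.
  have -> : (fun h : R => h^-1 *: ((pnorm p \o shift x) (h *: delta_mx 0 i) - pnorm p x)) =
      (fun h : R => h^-1 *: ((G \o shift (x 0 i)) (h *: 1) - G (x 0 i))).
    apply/funext => h; rewrite fx [in LHS]/= [in LHS]fG [in RHS]/=.
    have -> : h *: (1 : R^o) = h by exact: mulr1.
    reflexivity.
  reflexivity.
have xc : `|x 0 i| `^ p + c = 1.
  by rewrite -(proj2 Dx) (bigD1 i)//= ger0_norm// ltW.
have dS : is_derive (x 0 i) (1 : R) (fun s : R => `|s| `^ p + c) (p * x 0 i `^ (p - 1)).
  have := is_derive_powR_normr (xpos i) => d1.
  have := is_deriveD d1 (is_derive_cst c (x 0 i) (1 : R)).
  by rewrite addr0.
have dG : is_derive (x 0 i) (1 : R) G (p^-1 * 1 `^ (p^-1 - 1) * (p * x 0 i `^ (p - 1))).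
  have d2 : is_derive ((fun s : R => `|s| `^ p + c) (x 0 i)) (1 : R)
      (@powR R ^~ p^-1) (p^-1 * 1 `^ (p^-1 - 1)).
    by rewrite [X in is_derive X]xc; exact: is_derive1_powR (@ltr01 R).
  exact: (@is_derive1_comp _ (@powR R ^~ p^-1) (fun s : R => `|s| `^ p + c) _ _ _ d2 dS).
by rewrite (@derive_val _ _ _ _ _ _ _ dG) powR1 mulr1 mulrA mulVf ?mul1r// gt_eqF.
Qed.

End gradient_pnorm.

(** * The surface measure and its Radon-Nikodym derivative *)

Section surface_density.
Context {R : realType} (p : R) (p0 : 0 < p) (m : nat).
Local Notation n := m.+2.
Implicit Types (A : set 'rV[R]_n).
Local Open Scope ereal_scope.
Local Notation D := (simplex p n : set 'rV[R]_n).
Local Notation D0 := (simplex_pos p : set 'rV[R]_n).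
Local Notation cm := (cone_measure p0 n).
Local Notation K := (lebesgue_rV (pcone p D)).
Local Notation g := (fun x : 'rV[R]_n => (cone_density p x)%:E).

(** The cone over a face stays in a coordinate hyperplane. *)
Lemma cone_measure_face (i : 'I_n) : cm (D `&` [set x | x 0%R i = 0%R]) = 0.
Proof.
set F := D `&` _; have mF : measurable F by exact: measurable_face.
have FD : F `<=` D by exact: subIsetl.
have P0 : lebesgue_rV (pcone p F) = 0.
  apply/eqP; rewrite eq_le measure_ge0 andbT -(lebesgue_rV_hyperplane i 0%R).
  apply: le_measure; rewrite ?inE; first exact: measurable_pcone.
    exact: measurable_preimageT (measurable_coord i) (measurable_set1 0%R).
  move=> y [/andP[N0 _] [_ /=]]; rewrite mxE => /eqP.
  by rewrite mulf_eq0 invr_eq0 gt_eqF//= => /eqP.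
have := cone_measure_pcone p0 mF FD; rewrite P0 => /esym/eqP.
by rewrite mule_eq0 [K == 0]gt_eqF ?pcone_simplex_gt0// orbF => /eqP.
Qed.

Lemma hausdorff_simplex_density A : measurable A -> A `<=` D ->
  hausdorff m.+1 A = n%:R%:E * K * \int[cm]_(x in A) g x.
Proof.
move=> mA AD.
have mD0 : measurable D0 by exact: measurable_simplex_pos.
have mI : measurable (A `&` D0) by exact: measurableI.
have mB : measurable (A `\` D0) by exact: measurableD.
have null (mu : {measure set 'rV[R]_n -> \bar R}) :
    (forall i, mu (D `&` [set x : 'rV[R]_n | x 0%R i = 0%R]) = 0) -> mu (A `\` D0) = 0.
  move=> mu0; apply/eqP; rewrite eq_le measure_ge0 andbT.
  rewrite -(measure_simplex_boundary mu0); apply: le_measure; rewrite ?inE//.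
    by apply: measurableD => //; exact: measurable_simplex.
  by move=> x [/AD Dx nx]; split.
have H0 : hausdorff_raw m.+1 (A `\` D0) = 0.
  exact: (null (@hausdorff_borel R m.+1 n) (@hausdorff_raw_face R p p0 m)).
have cm0 : cm (A `\` D0) = 0 by exact: null cone_measure_face.
have HA : hausdorff_raw m.+1 A = hausdorff_raw m.+1 (A `&` D0).
  have := measureDI (@hausdorff_borel R m.+1 n) mA mD0.
  by rewrite [X in X + _]H0 add0e.
have IA : \int[cm]_(x in A) g x = \int[cm]_(x in A `&` D0) g x.
  rewrite (ge0_negligible_integral mB mA)//.
  - by congr (integral _ _ _); rewrite setDD.
  - by apply/measurable_EFinP/measurable_funTS; exact: measurable_cone_density.
  - by move=> x _; rewrite lee_fin cone_density_ge0.
rewrite /hausdorff HA (hausdorff_raw_cone_density p0 mI (@subIsetr _ _ _)) IA.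
set k := hausdorff_raw m.+1 (unit_cube m.+1).
have k0 : 0 < k by exact: hausdorff_raw_unit_cube_gt0.
have kfin : k \is a fin_num by rewrite ge0_fin_numE ?ltW// hausdorff_raw_unit_cube_fin.
move: (\int[cm]_(x in A) g x) => I.
(* The raw measure of the unit cube, coming from the hyperplane formula, cancels the normalization
   in [hausdorff]. *)
rewrite muleAC; congr (_ * _).
by rewrite muleC muleA mulVe ?mul1e// gt_eqF.
Qed.

(** Cauchy-Schwarz applied to [1 = <x, normal x>], which holds on the boundary as well. It makes the
    normalizing constant positive. *)
Lemma cone_density_lower x : D x -> (n%:R^-1 <= cone_density p x)%R.
Proof.
move=> Dx; have x1 : rowdot x (normal p x) = 1%R.
  by rewrite -(proj2 Dx); apply: eq_bigr => i _; rewrite mxE mulr_powRB1//; exact: (proj1 Dx).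
have n0 : (0 < n%:R :> R)%R by rewrite ltr0n.
have := Cauchy_Schwarz_sum x (normal p x); rewrite -/(rowdot _ _) x1.
rewrite cone_density_pnorm2 => h.
have h2 := ler_wpM2r (pnorm2_ge0 (normal p x)) (pnorm2_simplex_le p0 Dx).
move: (pnorm 2 x) (pnorm 2 (normal p x)) h h2 => a b h h2.
by rewrite -(ler_pM2l n0) mulfV ?gt_eqF// (le_trans h).
Qed.

Lemma pcone_simplex_fin_num : K \is a fin_num.
Proof. by rewrite ge0_fin_numE// pcone_simplex_fin. Qed.

(** An infinite constant would, by [hausdorff_simplex_density] for the whole simplex, give it
    infinite Hausdorff measure. *)
Lemma cone_density_cst_pos : exists2 c : R, (0 < c)%R & cone_density_cst p0 n = c%:E.
Proof.
have mD : measurable D by exact: measurable_simplex.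
have c0 : 0 < cone_density_cst p0 n.
  apply: (@lt_le_trans _ _ (\int[cm]_(x in D) (n%:R^-1)%:E)).
    rewrite integral_cst// mule_gt0// ?lte_fin ?invr_gt0 ?ltr0n//.
    have := cone_measure_pcone p0 mD (@subset_refl _ _).
    rewrite lt0e measure_ge0 andbT; apply: contra_eq_neq => ->.
    by rewrite mul0e gt_eqF// pcone_simplex_gt0.
  apply: ge0_le_integral => //.
  - by apply/measurable_EFinP/measurable_funTS; exact: measurable_cone_density.
  - by move=> x Dx; rewrite lee_fin cone_density_lower.
have n0 : (0 < n%:R :> R)%R by rewrite ltr0n.
have Hfin : hausdorff m.+1 D < +oo.
  apply: lte_mul_pinfty; first exact: outer_measure_ge0.
    rewrite ge0_fin_numE; first exact: hausdorff_raw_simplex_fin.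
    exact: outer_measure_ge0.
  have k0 := @hausdorff_raw_unit_cube_gt0 R m.+1.
  have kfin : hausdorff_raw m.+1 (@unit_cube R m.+1) \is a fin_num.
    by rewrite ge0_fin_numE ?ltW// hausdorff_raw_unit_cube_fin.
  move: k0; rewrite -(fineK kfin) lte_fin => k0.
  by rewrite inver gt_eqF// ltry.
have cfin : cone_density_cst p0 n \is a fin_num.
  rewrite ge0_fin_numE ?(ltW c0)// ltey; apply/eqP => coo.
  move: Hfin; rewrite (hausdorff_simplex_density mD (@subset_refl _ _)).
  rewrite -/(cone_density_cst p0 n) coo gt0_muley ?ltxx//.
  by rewrite mule_gt0 ?lte_fin// pcone_simplex_gt0.
by exists (fine (cone_density_cst p0 n)); [rewrite -lte_fin fineK|rewrite fineK].
Qed.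

Lemma surface_measure_density A : measurable A ->
  surface_measure p n A = (cone_density_cst p0 n)^-1 * \int[cm]_(x in A `&` D) g x.
Proof.
move=> mA; have [c c0 cE] := cone_density_cst_pos.
have mD : measurable D by exact: measurable_simplex.
have mAD : measurable (A `&` D) by exact: measurableI.
rewrite /surface_measure hausdorff_simplex_density// hausdorff_simplex_density//.
rewrite -/(cone_density_cst p0 n) cE.
have := pcone_simplex_gt0 p0 m.+1; rewrite -(fineK pcone_simplex_fin_num).
move: (fine K) => k; rewrite lte_fin => k0.
have n0 : (0 < n%:R :> R)%R by rewrite ltr0n.
move: (\int[cm]_(x in A `&` D) g x) => I.
rewrite -!EFinM !inver !gt_eqF ?mulr_gt0// muleAC -EFinM; congr (_%:E * _).
by field; rewrite ?gt_eqF.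
Qed.

Lemma surface_measure_dominated : surface_measure p n `<< cm.
Proof.
apply/null_content_dominatesP => A mA A0.
have mAD : measurable (A `&` D) by apply: measurableI => //; exact: measurable_simplex.
have AD0 : cm (A `&` D) = 0.
  by apply/eqP; rewrite eq_le measure_ge0 andbT -A0; apply: le_measure; rewrite ?inE.
have mg : measurable_fun (A `&` D) g.
  by apply/measurable_EFinP/measurable_funTS; exact: measurable_cone_density.
by rewrite (surface_measure_density mA) (null_set_integral mAD mg AD0) mule0.
Qed.

Local Open Scope charge_scope.

(** Both functions have the same integral over every Borel subset of the simplex, and the derivative
    is integrable. *)
Lemma Radon_Nikodym_surface_measure :
  ae_eq cm D ('d (charge_of_finite_measure (surface_measure p n)) '/d cm)
    (fun x => (cone_density_cst p0 n)^-1 * (cone_density p x)%:E).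
Proof.
have [c c0 cE] := cone_density_cst_pos.
have mD : measurable D by exact: measurable_simplex.
have dom := surface_measure_dominated.
apply: integral_ae_eq => //.
- apply: (integrableS measurableT) => //.
  exact: Radon_Nikodym_integrable.
- rewrite cE inver gt_eqF//; apply/measurable_EFinP/measurable_funM => //.
  by apply: measurable_funTS; exact: measurable_cone_density.
move=> E ED mE; rewrite -Radon_Nikodym_integral//.
rewrite ge0_integralZl//.
- by rewrite /= surface_measure_density// (setIidl ED).
- by apply/measurable_EFinP/measurable_funTS; exact: measurable_cone_density.
- by move=> x _; rewrite lee_fin cone_density_ge0.
- by rewrite inve_nonneg// cE lee_fin ltW.
Qed.

Lemma surface_normalization :
  n%:R%:E * lebesgue_rV (dilate `[0%R, 1%R] D) / hausdorff m.+1 D =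
  (cone_density_cst p0 n)^-1.
Proof.
have [c c0 cE] := cone_density_cst_pos.
have mD : measurable D by exact: measurable_simplex.
rewrite (lebesgue_rV_pcone p0 mD (@subset_refl _ _)).
rewrite hausdorff_simplex_density// -/(cone_density_cst p0 n) cE.
have := pcone_simplex_gt0 p0 m.+1; rewrite -(fineK pcone_simplex_fin_num).
move: (fine K) => k; rewrite lte_fin => k0.
have n0 : (0 < n%:R :> R)%R by rewrite ltr0n.
rewrite -!EFinM !inver !gt_eqF ?mulr_gt0// -EFinM; congr (_%:E).
by field; rewrite ?gt_eqF.
Qed.

Lemma cone_measure_ae_simplex_pos : {ae cm, forall x, D x -> D0 x}.
Proof.
exists (D `\` D0); split.
- by apply: measurableD; [exact: measurable_simplex|exact: measurable_simplex_pos].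
- exact: measure_simplex_boundary cone_measure_face.
- by move=> x /= /not_implyP[].
Qed.

End surface_density.

Unset Implicit Arguments.
Local Open Scope classical_set_scope.
Local Open Scope ereal_scope.
Local Open Scope charge_scope.

Theorem lemma10 (R : realType) (p : R) (p_gt0 : (0 < p)%R) (n : nat)
    (n_ge2 : (2 <= n)%N) :
  surface_measure p n `<< cone_measure p_gt0 n /\
  {ae cone_measure p_gt0 n, forall x : 'rV[R]_n, simplex p n x ->
    ('d (charge_of_finite_measure (surface_measure p n))
       '/d (cone_measure p_gt0 n)) x =
      n%:R%:E * lebesgue_rV (dilate `[0%R, 1%R] (simplex p n))
        / hausdorff n.-1 (simplex p n)
        * (pnorm 2 (gradient (pnorm p) x))%:E /\
    n%:R%:E * lebesgue_rV (dilate `[0%R, 1%R] (simplex p n))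
        / hausdorff n.-1 (simplex p n)
        * (pnorm 2 (gradient (pnorm p) x))%:E =
      (cone_density_cst p_gt0 n)^-1 * (cone_density p x)%:E}.
Proof.
move: n n_ge2 => [//|[//|m]] _; split; first exact: surface_measure_dominated.
(* The gradient is known at interior points only, which is enough almost everywhere. *)
have aeD := cone_measure_ae_simplex_pos p_gt0 m.
have aeRN := Radon_Nikodym_surface_measure p_gt0 m.
apply: filterS2 aeD aeRN => x Px RNx Dx.
have Dx0 := Px Dx.
have gE : pnorm 2 (gradient (pnorm p) x) = cone_density p x.
  by rewrite cone_density_pnorm2 (gradient_pnorm p_gt0 Dx0).
rewrite gE (surface_normalization p_gt0 m); split; last reflexivity.
exact: RNx Dx.
Qed.
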